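(* Fix an integer $k\ge 1$, a ratio $\xi>0$, and a constant $\gamma\ge\max\{1,\xi^{-1}\}$. There exist a constant $C>0$, depending only on $\xi,\gamma$ if $k=1$ and only on $\xi,\gamma,k$ if $k\ge 2$, and an integer $N$ depending only on $\xi,\gamma,k$, such that the following holds for all $n\ge N$ (with $m=\xi n$ an integer). Let $\mathsf R,\mathsf R'\in[0,\gamma]^n$ be service range vectors with $\mathsf R\succeq\mathsf R'$ ($\mathsf R$ majorizes $\mathsf R'$) and $\|\mathsf R^{\downarrow}-\mathsf R'^{\downarrow}\|_1>\theta n$, where (U1) if $k=1$: $\theta> C\left(\frac{\log n}{n}\right)^{1/3}$; (U2) if $k\ge 2$: $\theta> C\left(\frac1n\right)^{\frac{1}{4(k+1)}}$. Then $\mu_m(\mathsf R')>\mu_m(\mathsf R)$.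
   Context: Model: supply locations $s_1,\dots,s_n$ and demand locations $d_1,\dots,d_m$ are drawn independently and uniformly from $[0,1]^k$, with $\xi=m/n$ fixed. Given a service range vector $\mathsf R=(r_1,\dots,r_n)\in\mathbb R_{\ge0}^n$, the random bipartite graph $G\sim\mathbb G(m,\mathsf R)$ has vertex classes $[n]$ (supply) and $[m]$ (demand), and supply $i$ is adjacent to demand $j$ iff $\|s_i-d_j\|_2\le (r_i/n)^{1/k}$. $M(G)$ denotes the size of a maximum matching of $G$, and $\mu_m(\mathsf R)=\mathbb E_{G\sim\mathbb G(m,\mathsf R)}[M(G)]$. For $\mathbf x\in\mathbb R^n$, $\mathbf x^{\downarrow}$ is its non-increasing rearrangement. $\mathbf x\succeq\mathbf y$ ($\mathbf x$ majorizes $\mathbf y$) means $\sum_{i=1}^{\ell}x_i^{\downarrow}\ge\sum_{i=1}^{\ell}y_i^{\downarrow}$ for $\ell=1,\dots,n-1$ and $\sum_{i=1}^n x_i^{\downarrow}=\sum_{i=1}^n y_i^{\downarrow}$. *)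

(* Defs.v *)
From HB Require Import structures.
From mathcomp Require Import all_boot all_order all_algebra.
From mathcomp Require Import all_classical all_reals all_analysis.

Set Implicit Arguments.
Unset Strict Implicit.
Unset Printing Implicit Defensive.

Import Order.TTheory GRing.Theory Num.Theory.

Local Open Scope classical_set_scope.
Local Open Scope ring_scope.

Section iid.
Context d (T : measurableType d) (R : realType).

Definition tuple_cons n (x : T * n.-tuple T) : n.+1.-tuple T :=
  [tuple of x.1 :: x.2].

Lemma measurable_tuple_cons n :
  measurable_fun [set: T * n.-tuple T] (@tuple_cons n).
Proof. exact: measurable_cons. Qed.

HB.instance Definition _ n :=
  isMeasurableFun.Build _ _ _ _ (@tuple_cons n) (@measurable_tuple_cons n).

(* The n-fold product of P, i.e. the law of n independent draws from P. *)
Fixpoint iid_prob (P : probability T R) n : probability (n.-tuple T) R :=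
  match n with
  | 0 => \d_([tuple] : 0.-tuple T)
  | n'.+1 => distribution (P \x iid_prob P n')%E (@tuple_cons n')
  end.

Lemma iid_prob_box (P : probability T R) n (A : 'I_n -> set T) :
  (forall i, measurable (A i)) ->
  iid_prob P n [set x | forall i, A i (tnth x i)] = (\prod_(i < n) P (A i))%E.
Proof.
elim: n A => [|n IH] A mA.
  by rewrite big_ord0 /= diracE mem_set//= => -[].
rewrite big_ord_recl -IH//= /distribution /pushforward.
have mB : measurable [set x : n.-tuple T | forall i, A (lift ord0 i) (tnth x i)].
  rewrite [X in measurable X](_ : _ =
      \bigcap_(i in [set: 'I_n]) ((tnth (T:=T))^~ i @^-1` A (lift ord0 i))).
    apply: fin_bigcap_measurable; first exact: finite_finset.
    by move=> i _; rewrite -[X in measurable X]setTI; exact: measurable_tnth.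
  by apply/seteqP; split=> [x H i _|x H i] /=; [exact: H | exact: (H i)].
rewrite -product_measure1E//.
congr (product_measure1 _ _ _); apply/seteqP; split=> -[x t] /=.
  move=> H; split; first by have := H ord0.
  by move=> i; have := H (lift ord0 i); rewrite tnthS.
move=> [Ax At] i; case: (unliftP ord0 i) => [j ->|->] //.
by rewrite tnthS; exact: At.
Qed.

End iid.

Section majorization.
Context (R : realType) (n : nat).

(* >=%R sorts from the largest entry to the smallest. *)
Definition decr (x : n.-tuple R) : seq R := sort >=%R x.

Definition majorizes (x y : n.-tuple R) : Prop :=
  (forall l, (1 <= l < n)%N ->
     \sum_(i < l) (decr y)`_i <= \sum_(i < l) (decr x)`_i) /\
  \sum_(i < n) (decr x)`_i = \sum_(i < n) (decr y)`_i.

Definition decr_dist1 (x y : n.-tuple R) : R :=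
  \sum_(i < n) `|(decr x)`_i - (decr y)`_i|.

End majorization.

Section matching.
Context (S D : finType).

(* A bipartite graph with classes S and D is a boolean relation G : S -> D ->
   bool; the pair (i, j) stands for the edge between i and j. *)
Definition is_matching (G : S -> D -> bool) (M : {set S * D}) : bool :=
  [forall e in M, G e.1 e.2] &&
  [forall e in M, forall f in M,
     (e != f) ==> ((e.1 != f.1) && (e.2 != f.2))].

Definition matching_number (G : S -> D -> bool) : nat :=
  \max_(M : {set S * D} | is_matching G M) #|M|.

End matching.

Section random_graph.
Context (R : realType) (k n m : nat).

(* Points of R^k are k-tuples: the library equips n.-tuple T with the product
   sigma-algebra, which it does not provide for row vectors. *)
Definition dist2 (x y : k.-tuple R) : R :=
  Num.sqrt (\sum_(l < k) (tnth x l - tnth y l) ^+ 2).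

Definition service_graph (r : n.-tuple R)
    (s : n.-tuple (k.-tuple R)) (d : m.-tuple (k.-tuple R)) :
    'I_n -> 'I_m -> bool :=
  fun i j => dist2 (tnth s i) (tnth d j) <= (tnth r i / n%:R) `^ k%:R^-1.

(* The uniform distribution on the cube [0, 1]^k. The alias measurableTypeR R
   is R with its Borel sigma-algebra, as in the library's uniform_prob. *)
Definition uniform_cube : probability (k.-tuple (measurableTypeR R)) R :=
  @iid_prob _ (measurableTypeR R) R (uniform_prob (@ltr01 R)) k.

(* The sample space: n supply and m demand locations, all independent. *)
Definition location_prob :
    probability (n.-tuple (k.-tuple (measurableTypeR R)) *
                 m.-tuple (k.-tuple (measurableTypeR R)))%type R :=
  (iid_prob uniform_cube n \x iid_prob uniform_cube m)%E.

Definition mean_matching (r : n.-tuple R) : \bar R :=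
  'E_location_prob[
    fun w => (matching_number (service_graph r w.1 w.2))%:R : R].

End random_graph.

Arguments mean_matching {R} k {n} m r.

(* Main.v *)
(* Add the supplies of a set Z last. A new supply raises the matching number
   exactly when it meets a demand that some maximum matching of the rest leaves
   free, so the mean matching number is affine in the "gain" of its range x, the
   mean volume of the union of the balls of radius (x/n)^(1/k) around the free
   demands. The part of this union in each Voronoi cell is star-shaped, and
   Kneser's inequality makes its volume concave in x; the loss of volume where
   the balls of an isolated pair of demands overlap makes the gain strongly
   concave, with a modulus independent of n.

   If R majorizes R', then R' = D R with D doubly stochastic. Drawing each
   coordinate i of R' independently from the entries of R with law D i lowers
   the mean by at least a multiple of |R|^2 - |R'|^2, by strong concavity, while
   the tuple so drawn is, once sorted, within O(sqrt n) of R in l^1, and the gain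
   is Lipschitz. Since |R|^2 - |R'|^2 is at least n theta^2, this beats the error
   sqrt n when theta > C n^(-1/4), which covers k >= 2.

   For k = 1, pass from R to R' by at most n transfers between two supplies j, l.
   With probability 1 - O(n^(-2/3)) the supplies leave a gap between s_j and s_l
   which disconnects the graph, and then the increments of the matching number
   due to j and to l add up; so each transfer gains what strong concavity
   predicts up to O(n^(-2/3)), and the total error n^(1/3) is beaten by
   n theta^2 when theta > C n^(-1/3). *)

Require Import Defs.
From mathcomp Require Import all_boot all_order all_algebra.
From mathcomp Require Import fingroup perm.
From mathcomp Require Import all_classical all_reals all_analysis.
From mathcomp Require Import measurable_realfun.
From mathcomp Require Import ring lra zify.

Set Implicit Arguments.
Unset Strict Implicit.
Unset Printing Implicit Defensive.

Import Order.TTheory GRing.Theory Num.Theory.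
Import numFieldNormedType.Exports.

Local Open Scope ring_scope.

(** * Maximum matchings *)

(** In the variable x = n radius^k the ball of a lone demand has volume linear in x, so strict
    concavity can only come from balls that meet. For two demands a and b with b uniform, the mean
    volume of the part of the ball of a lying nearer to b is exactly quadratic in x, of order
    (x/n)^2. There are of order n^2 pairs, each isolated with probability bounded below: hence a
    modulus free of n.

    The obstacle is that strong concavity holds in one range at a time. Two supplies compete for
    free demands: by submodularity their joint gain is at most the sum of the separate gains,
    whereas a transfer needs the reverse for the new vector. Resampling changes one coordinate at a
    time and never meets this problem; its price is the comparison of R with a random selection of
    its own entries.

    On the line a gap restores additivity. A block of J cells is fully occupied with probability
    exponentially small in J, while two given supplies lie within J cells of each other with
    probability O(J/n). The choice J = n^(1/3) is, up to logarithms, the longest that (U1)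
    affords. *)

Section bipartite_matching.
Context (S D : finType).
Implicit Types (G H : S -> D -> bool) (M A B : {set S * D}) (Z : {set S}) (i l : S) (j : D).

Lemma matchingP G M :
  reflect [/\ forall e, e \in M -> G e.1 e.2,
              forall e f, e \in M -> f \in M -> e.1 = f.1 -> e = f &
              forall e f, e \in M -> f \in M -> e.2 = f.2 -> e = f]
          (is_matching G M).
Proof.
apply: (iffP andP) => [[/forall_inP GM /forall_inP MM]|[GM M1 M2]].
  split=> // e f eM fM ef; apply/eqP; apply: contraT => nef;
    have /forall_inP/(_ f fM)/implyP/(_ nef)/andP[] := MM e eM;
    by rewrite ef eqxx.
split; apply/forall_inP => // e eM; apply/forall_inP => f fM; apply/implyP => nef.
by apply/andP; split; apply: contraNneq nef => ef; apply/eqP; [exact: M1|exact: M2].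
Qed.

Lemma matching_sub G H M : (forall i j, G i j -> H i j) ->
  is_matching G M -> is_matching H M.
Proof.
move=> GH /matchingP[GM M1 M2]; apply/matchingP; split=> // e eM.
exact/GH/GM.
Qed.

Lemma leq_matching_number G M : is_matching G M -> (#|M| <= matching_number G)%N.
Proof. by move=> mM; exact: (leq_bigmax_cond (F := fun M : {set S * D} => #|M|)). Qed.

Lemma max_matching G : exists2 M, is_matching G M & #|M| = matching_number G.
Proof.
have m0 : is_matching G finset.set0 by apply/matchingP; split=> e; rewrite inE.
rewrite /matching_number.
have [|M mM ->] := @eq_bigmax_cond _ (fun M => is_matching G M) (fun M : {set S * D} => #|M|).
  by apply/card_gt0P; exists finset.set0.
by exists M.
Qed.

Lemma le_matching_number G H : (forall i j, G i j -> H i j) ->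
  (matching_number G <= matching_number H)%N.
Proof.
move=> GH; have [M mM <-] := max_matching G.
exact/leq_matching_number/(matching_sub GH).
Qed.

Lemma eq_matching_number G H : (forall i j, G i j = H i j) ->
  matching_number G = matching_number H.
Proof.
by move=> GH; apply/eqP; rewrite eqn_leq !le_matching_number// => i j; rewrite GH.
Qed.

(** The inessential vertices on the demand side, in the sense of Gallai and Edmonds. *)
Definition avail G : {set D} :=
  [set j | [exists M : {set S * D}, [&& is_matching G M, #|M| == matching_number G
     & [forall e in M, e.2 != j]]]].

Lemma availP G j : reflect
  (exists M, [/\ is_matching G M, #|M| = matching_number G &
     forall e, e \in M -> e.2 != j]) (j \in avail G).
Proof.
rewrite inE; apply: (iffP existsP) => [[M /and3P[mM /eqP cM /forall_inP jM]]|[M [mM cM jM]]].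
  by exists M.
by exists M; rewrite mM cM eqxx; apply/forall_inP.
Qed.

Lemma avail_isolated G j : (forall i, ~~ G i j) -> j \in avail G.
Proof.
move=> Gj; apply/availP; have [M mM cM] := max_matching G.
exists M; split=> // e eM; apply: contraNneq (Gj e.1) => <-.
by have /matchingP[-> //] := mM.
Qed.

(** Supplies are isolated, not removed: all graphs keep the same vertex types. *)
Definition without (Z : {set S}) G : S -> D -> bool := fun i j => (i \notin Z) && G i j.

Lemma matching_add G M i j : is_matching G M -> G i j ->
  (forall e, e \in M -> e.1 != i) -> (forall e, e \in M -> e.2 != j) ->
  is_matching G ((i, j) |: M) /\ #|(i, j) |: M| = #|M|.+1.
Proof.
move=> /matchingP[GM M1 M2] Gij iM jM; split; last first.
  rewrite cardsU1 (_ : (i, j) \notin M) ?add1n//.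
  by apply/negP => /iM; rewrite eqxx.
apply/matchingP; split=> [e|e f|e f]; rewrite !inE.
- by case/predU1P => [->|/GM].
- case/predU1P => [->|eM] /predU1P [->|fM] //= ef; last exact: M1.
    by have := iM f fM; rewrite -ef eqxx.
  by have := iM e eM; rewrite ef eqxx.
- case/predU1P => [->|eM] /predU1P [->|fM] //= ef; last exact: M2.
    by have := jM f fM; rewrite -ef eqxx.
  by have := jM e eM; rewrite ef eqxx.
Qed.

Lemma matching_subset G M M' : is_matching G M -> M' \subset M -> is_matching G M'.
Proof.
move=> /matchingP[GM M1 M2] /fintype.subsetP s; apply/matchingP; split=> [e /s/GM //|e f /s eM /s fM|e f /s eM /s fM].
- exact: M1.
- exact: M2.
Qed.

Lemma without_sub Z G M : is_matching (without Z G) M -> is_matching G M.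
Proof. by apply: matching_sub => a b /andP[]. Qed.

Lemma without_matching Z G M : is_matching G M ->
  (forall e, e \in M -> e.1 \notin Z) -> is_matching (without Z G) M.
Proof.
move=> /matchingP[GM M1 M2] Zm; apply/matchingP; split=> // e eM.
by rewrite /without Zm//= GM.
Qed.

(** If a maximum matching uses an edge (i, j), dropping it leaves a matching of the rest which
    misses j. Either the rest has a larger matching and nothing is gained by i, or this one is
    maximum and shows that j is available. *)
Lemma matching_number_without1 G i :
  matching_number G = (matching_number (without [set i] G) +
    [exists j in avail (without [set i] G), G i j])%N.
Proof.
set H := without [set i] G.
have iH M : is_matching H M -> forall e, e \in M -> e.1 != i.
  by move=> /matchingP[HM _ _] e /HM; rewrite /H /without inE => /andP[].
apply/eqP; rewrite eqn_leq; apply/andP; split; last first.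
  have [/exists_inP[j /availP[M [mM cM jM]] Gij]|_] := boolP [exists j in avail H, G i j].
    have [mM' cM'] := matching_add (without_sub mM) Gij (iH M mM) jM.
    by rewrite addn1 -cM -cM'; exact: leq_matching_number.
  by rewrite addn0; apply: le_matching_number => a b /andP[].
have [M mM cM] := max_matching G.
have [/exists_inP[[i' j] eM /eqP /= ii]|/exists_inPn noi] := boolP [exists e in M, e.1 == i]; last first.
  rewrite -cM (leq_trans _ (leq_addr _ _))//; apply: leq_matching_number.
  by apply: without_matching => // e eM; rewrite inE; exact: noi.
move: eM; rewrite {}ii => eM {i'}.
have [GM M1 M2] := matchingP _ _ mM.
pose M' := M :\ (i, j).
have mM' : is_matching H M'.
  apply: without_matching; first exact: (matching_subset mM (finset.subsetDl _ _)).
  move=> e; rewrite !inE => /andP[ne eM']; apply: contra ne => /eqP ei.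
  by apply/eqP; exact: M1.
have cM' : #|M'|.+1 = matching_number G by rewrite -cM (cardsD1 (i, j) M) eM.
have le := leq_matching_number mM'; rewrite -cM'.
have [_|] := boolP [exists j in avail H, G i j]; first by rewrite addn1 ltnS.
rewrite addn0 => /exists_inPn noj.
rewrite ltn_neqAle le andbT; apply/negP => /eqP E.
have := noj j; rewrite (GM _ eM) => /(_ _)/negP; apply => //.
apply/availP; exists M'; split=> // e; rewrite !inE => /andP[ne eM'].
by apply: contra ne => /eqP ej; apply/eqP; exact: M2.
Qed.

(* Exchanges the two matchings along the alternating path issued from [i]. *)
Lemma alternating_exchange G A B i :
  is_matching G A -> is_matching G B -> (forall e, e \in B -> e.1 != i) ->
  exists A' B', [/\ is_matching G A', is_matching G B',
    (#|A'| + #|B'| = #|A| + #|B|)%N,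
    (forall e, e \in A' -> e.1 != i) &
    (forall j, (forall e, e \in A -> e.2 != j) -> forall e, e \in A' -> e.2 != j)].
Proof.
move=> /matchingP[GA A1 A2] /matchingP[GB B1 B2] iB.
(* One step follows an edge of [A] to a demand and returns along the edge of [B]. Swapping [A] and
   [B] on the reachable supplies keeps both matchings because of [fwd] and [bwd]; [bwd] rests on [i]
   having no edge in [B]. *)
pose step : rel S := fun s s' => [exists d, ((s, d) \in A) && ((s', d) \in B)].
pose Rch := [set s | connect step i s].
have iR : i \in Rch by rewrite inE.
have fwd s s' d : s \in Rch -> (s, d) \in A -> (s', d) \in B -> s' \in Rch.
  rewrite !inE => sR sA sB; apply: (connect_trans sR); apply: connect1.
  by apply/existsP; exists d; rewrite sA.
have bwd s d : s \in Rch -> (s, d) \in B -> exists2 s', s' \in Rch & (s', d) \in A.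
  rewrite inE => /connectP[p]; case/lastP: p => [_ /= ->|p s'].
    by move=> /iB; rewrite eqxx.
  rewrite rcons_path last_rcons => /andP[pp /existsP[d' /andP[sA sB]]] -> sd.
  have [dd] := B1 _ _ sd sB erefl; exists (last i p); last by rewrite dd.
  by rewrite inE; apply/connectP; exists p.
clearbody Rch; clear step.
pose A' := [set e in A | e.1 \notin Rch] :|: [set e in B | e.1 \in Rch].
pose B' := [set e in B | e.1 \notin Rch] :|: [set e in A | e.1 \in Rch].
exists A', B'; split.
- apply/matchingP; split=> [e|[s d] [s' d']|[s d] [s' d']]; rewrite !inE.
  + by case/orP => /andP[eM _]; [exact: GA|exact: GB].
  + move=> /orP[]/andP[eM /= sR] /orP[]/andP[fM /= sR'] ss; subst s'.
    * exact: A1.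
    * by rewrite sR' in sR.
    * by rewrite sR in sR'.
    * exact: B1.
  + move=> /orP[]/andP[eM /= sR] /orP[]/andP[fM /= sR'] /= dd; subst d'.
    * exact: A2.
    * have [t tR tA] := bwd _ _ (sR') fM.
      by have [st] := A2 _ _ eM tA erefl; rewrite st tR in sR.
    * have [t tR tA] := bwd _ _ (sR) eM.
      by have [st] := A2 _ _ fM tA erefl; rewrite st tR in sR'.
    * exact: B2.
- apply/matchingP; split=> [e|[s d] [s' d']|[s d] [s' d']]; rewrite !inE.
  + by case/orP => /andP[eM _]; [exact: GB|exact: GA].
  + move=> /orP[]/andP[eM /= sR] /orP[]/andP[fM /= sR'] ss; subst s'.
    * exact: B1.
    * by rewrite sR' in sR.
    * by rewrite sR in sR'.
    * exact: A1.
  + move=> /orP[]/andP[eM /= sR] /orP[]/andP[fM /= sR'] /= dd; subst d'.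
    * exact: B2.
    * by have := fwd _ _ _ sR' fM eM; rewrite (negbTE sR).
    * by have := fwd _ _ _ sR eM fM; rewrite (negbTE sR').
    * exact: A2.
- have cU (X Y : {set S * D}) : #|[set e in X | e.1 \notin Rch] :|: [set e in Y | e.1 \in Rch]| =
     (#|[set e in X | e.1 \notin Rch]| + #|[set e in Y | e.1 \in Rch]|)%N.
    rewrite cardsU (_ : _ :&: _ = finset.set0) ?cards0 ?subn0//.
    by apply/setP => e; rewrite !inE; case: (e.1 \in Rch); rewrite ?andbF.
  have cS (X : {set S * D}) : #|X| =
     (#|[set e in X | e.1 \notin Rch]| + #|[set e in X | e.1 \in Rch]|)%N.
    rewrite -cU; congr #|pred_of_set _|; apply/setP => e; rewrite !inE.
    by case: (e.1 \in Rch); rewrite ?andbF ?andbT ?orbF.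
  by rewrite !cU (cS A) (cS B); lia.
- move=> e; rewrite !inE => /orP[]/andP[eM sR]; last exact: iB.
  by apply: contraNneq sR => ->.
- move=> j jA [s d]; rewrite !inE => /orP[]/andP[eM /= sR]; first exact: (jA _ eM).
  by have [t tR tA] := bwd _ _ sR eM; exact: (jA _ tA).
Qed.

(** Exchange a maximum matching A of G missing j with a maximum matching B of the graph without i.
    Sizes add up to the same total and B' is no larger than A, so A' is at least as large as B; it
    avoids both i and j. *)
Lemma avail_without_sub G i : avail G \subset avail (without [set i] G).
Proof.
apply/fintype.subsetP => j /availP[A [mA cA jA]]; apply/availP.
have [B mB cB] := max_matching (without [set i] G).
have iB e : e \in B -> e.1 != i.
  by have /matchingP[HB _ _] := mB; move=> /HB /andP[]; rewrite inE.
have [A' [B' [mA' mB' cAB iA' jA']]] := alternating_exchange mA (without_sub mB) iB.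
have mA2 : is_matching (without [set i] G) A'.
  by apply: without_matching => // e /iA'; rewrite inE.
exists A'; split=> //; last exact: jA'.
apply/eqP; rewrite eqn_leq leq_matching_number//=.
have := leq_matching_number mB'; rewrite -cA -cB => h.
by rewrite -(leq_add2r #|B'|) cAB addnC leq_add2r.
Qed.

Lemma without_without Z Z' G a b : without Z (without Z' G) a b = without (Z :|: Z') G a b.
Proof. by rewrite /without inE negb_or andbA. Qed.

Lemma eq_avail G H : (forall a b, G a b = H a b) -> avail G = avail H.
Proof.
move=> GH; have -> // : G = H.
by apply/funext => a; apply/funext => b.
Qed.

Definition reaches Z G i : bool := [exists j in avail (without Z G), G i j].

(** Diminishing returns: in the presence of i, the supply l finds no demand available that was not
    already available without i. *)
Lemma matching_number_without2_le G i l : i != l ->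
  (matching_number G <= matching_number (without [set i; l] G) +
     reaches [set i; l] G i + reaches [set i; l] G l)%N.
Proof.
move=> il; rewrite (matching_number_without1 G l) leq_add//.
  rewrite (matching_number_without1 (without [set l] G) i) leq_add//.
    by apply/eq_leq/eq_matching_number => a b; rewrite without_without.
  rewrite /reaches (@eq_avail _ (without [set i; l] G)); last by move=> a b; rewrite without_without.
  case: (boolP [exists _ in _, _]) => // /exists_inP[j ja /andP[_ Gj]].
  by rewrite lt0b; apply/exists_inP; exists j.
case: (boolP [exists _ in _, _]) => // /exists_inP[j ja Gj].
rewrite lt0b; apply/exists_inP; exists j => //.
have /fintype.subsetP/(_ j ja) := avail_without_sub (without [set l] G) i.
by rewrite (@eq_avail _ (without [set i; l] G))// => a b; rewrite without_without.
Qed.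

Definition disconnected G i l : Prop :=
  exists (K : {set S}) (L : {set D}), [/\ i \in K, l \notin K &
    forall a b, G a b -> (a \in K) = (b \in L)].

(** Without separation i and l may compete for the same last free demand. Here a matching missing
    the demand j of i is used on the side of i, and one missing the demand h of l on the other side;
    the combination misses both and takes both new edges. *)
Lemma matching_number_without2_ge G i l : i != l -> disconnected G i l ->
  (matching_number (without [set i; l] G) +
     reaches [set i; l] G i + reaches [set i; l] G l <= matching_number G)%N.
Proof.
move=> il [K [L [iK lK KL]]]; set H := without [set i; l] G.
have one s : s \in [set i; l] -> (matching_number H + reaches [set i; l] G s <= matching_number G)%N.
  move=> sil; rewrite /reaches; case: exists_inP => [[j /availP[M [mM cM jM]] Gj]|_]; last first.
    by rewrite addn0; apply: le_matching_number => a b /andP[].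
  have sM e : e \in M -> e.1 != s.
    have /matchingP[HM _ _] := mM; move=> /HM /andP[+ _].
    by apply: contraNneq => ->.
  have [mM' cM'] := matching_add (without_sub mM) Gj sM jM.
  by rewrite addn1 -cM -cM' leq_matching_number.
have [ri|_] := boolP (reaches [set i; l] G i); last by rewrite addn0 one// !inE eqxx orbT.
have [rl|_] := boolP (reaches [set i; l] G l); last by rewrite addn0; have := one i; rewrite ri; apply; rewrite !inE eqxx.
have /exists_inP[j /availP[A [mA cA jA]] Gij] := ri.
have /exists_inP[h /availP[B [mB cB hB]] Glh] := rl.
have [HA A1 A2] := matchingP _ _ mA; have [HB B1 B2] := matchingP _ _ mB.
have jL : j \in L by rewrite -(KL _ _ Gij).
have hL : h \notin L by rewrite -(KL _ _ Glh).
have HKL a b : H a b -> (a \in K) = (b \in L) by move=> /andP[_]; exact: KL.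
pose mix (X Y : {set S * D}) := [set e in X | e.1 \in K] :|: [set e in Y | e.1 \notin K].
have mmix X Y : is_matching H X -> is_matching H Y -> is_matching H (mix X Y).
  move=> /matchingP[HX X1 X2] /matchingP[HY Y1 Y2].
  apply/matchingP; split=> [e|[s d] [s' d']|[s d] [s' d']]; rewrite !inE.
  - by case/orP => /andP[eM _]; [exact: HX|exact: HY].
  - move=> /orP[]/andP[eM /= sR] /orP[]/andP[fM /= sR'] ss; subst s'.
    + exact: X1.
    + by rewrite sR in sR'.
    + by rewrite sR' in sR.
    + exact: Y1.
  - move=> /orP[]/andP[eM /= sR] /orP[]/andP[fM /= sR'] /= dd; subst d'.
    + exact: X2.
    + by move: sR sR'; rewrite (HKL _ _ (HX _ eM)) (HKL _ _ (HY _ fM)) /= => ->.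
    + by move: sR sR'; rewrite (HKL _ _ (HX _ fM)) (HKL _ _ (HY _ eM)) /= => /negbTE ->.
    + exact: Y2.
have cU (X Y : {set S * D}) : #|mix X Y| =
     (#|[set e in X | e.1 \in K]| + #|[set e in Y | e.1 \notin K]|)%N.
  rewrite cardsU (_ : _ :&: _ = finset.set0) ?cards0 ?subn0//.
  by apply/setP => e; rewrite !inE; case: (e.1 \in K); rewrite ?andbF.
have cS (X : {set S * D}) : #|X| =
     (#|[set e in X | e.1 \in K]| + #|[set e in X | e.1 \notin K]|)%N.
  rewrite -cU; congr #|pred_of_set _|; apply/setP => e; rewrite !inE.
  by case: (e.1 \in K); rewrite ?andbF ?andbT ?orbF.
(* The two mixtures have together the size of [A] and [B], and [mix B A] is at most maximum, so
   [mix A B] is maximum. *)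
have cmix : (matching_number H <= #|mix A B|)%N.
  have := leq_matching_number (mmix _ _ mB mA).
  rewrite cU => h'; rewrite -(leq_add2r (matching_number H)) cU -{1}cA -{1}cB (cS A) (cS B).
  by rewrite [X in (_ + X <= _)%N]addnC addnACA leq_add2l addnC.
pose M0 := mix A B.
have mM0 : is_matching G M0 := without_sub (mmix _ _ mA mB).
have out e : e \in M0 -> (e.1 != i) && (e.1 != l).
  have /matchingP[HM _ _] := mmix _ _ mA mB.
  by move=> /HM /andP[]; rewrite !inE negb_or.
have j0 e : e \in M0 -> e.2 != j.
  rewrite !inE => /orP[]/andP[eM sK]; first exact: jA.
  by apply: contraNneq sK => ej; rewrite (HKL _ _ (HB _ eM)) ej.
have h0 e : e \in M0 -> e.2 != h.
  rewrite !inE => /orP[]/andP[eM sK]; last exact: hB.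
  by apply: contraTneq sK => eh; rewrite (HKL _ _ (HA _ eM)) eh.
have [m1 c1] := matching_add mM0 Gij (fun e eM => proj1 (andP (out e eM))) j0.
have l1 e : e \in (i, j) |: M0 -> e.1 != l.
  by rewrite in_setU1 => /predU1P[->//|/out/andP[]].
have h1 e : e \in (i, j) |: M0 -> e.2 != h.
  rewrite in_setU1 => /predU1P[-> /=|]; last exact: h0.
  by apply: contraNneq hL => <-.
have [m2 c2] := matching_add m1 Glh l1 h1.
have := leq_matching_number m2; rewrite c2 c1 -/M0 => h2.
by rewrite !addn1; apply: leq_trans h2.
Qed.

Lemma matching_number_perm G (s : {perm S}) :
  matching_number (fun i j => G (s i) j) = matching_number G.
Proof.
have le H (q : {perm S}) : (matching_number (fun i j => H (q i) j) <= matching_number H)%N.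
  have [M /matchingP[HM M1 M2] <-] := max_matching (fun i j => H (q i) j).
  pose h (e : S * D) := (q e.1, e.2).
  have hI : injective h by move=> [a b] [a' b'] [/perm_inj -> ->].
  rewrite -(card_imset (mem M) hI); apply: leq_matching_number.
  apply/matchingP; split=> [_ /imsetP[e eM ->]|_ _ /imsetP[e eM ->] /imsetP[f fM ->] /=|
    _ _ /imsetP[e eM ->] /imsetP[f fM ->] /=].
  - exact: HM.
  - by move=> /perm_inj ef; rewrite (M1 e f).
  - by move=> ef; rewrite (M2 e f).
apply/eqP; rewrite eqn_leq le /=.
have := le (fun i j => G (s i) j) (s^-1)%g; apply: leq_trans.
by apply: le_matching_number => i j; rewrite permKV.
Qed.

End bipartite_matching.

Local Open Scope classical_set_scope.
Local Open Scope ring_scope.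

(** * Expectations of bounded functions *)

Section bounded_measurable.
Context d (T : measurableType d) (R : realType).
Implicit Types f g : T -> R.

(** A class closed under all operations used below, including partial integration, and integrable
    for every probability; expectations can thus be handled as real numbers. *)
Definition bmfun f :=
  measurable_fun setT f /\ exists M, forall x, `|f x| <= M.

Lemma bmfun_cst (c : R) : bmfun (fun=> c).
Proof. by split; [exact: measurable_cst|exists `|c|]. Qed.

Lemma bmfunD f g : bmfun f -> bmfun g -> bmfun (fun x => f x + g x).
Proof.
move=> [mf [M fM]] [mg [N gN]]; split; first exact: measurable_funD.
by exists (M + N) => x; rewrite (le_trans (ler_normD _ _))// lerD.
Qed.

Lemma bmfunM f g : bmfun f -> bmfun g -> bmfun (fun x => f x * g x).
Proof.
move=> [mf [M fM]] [mg [N gN]]; split; first exact: measurable_funM.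
by exists (M * N) => x; rewrite normrM ler_pM.
Qed.

Lemma bmfunN f : bmfun f -> bmfun (fun x => - f x).
Proof.
move=> bf; rewrite (_ : (fun x => _) = fun x => (-1) * f x).
  exact: (bmfunM (bmfun_cst _)).
by apply/funext => x; rewrite mulN1r.
Qed.

Lemma bmfunB f g : bmfun f -> bmfun g -> bmfun (fun x => f x - g x).
Proof. by move=> bf bg; exact: (bmfunD bf (bmfunN bg)). Qed.

Lemma bmfun_sum (I : Type) (s : seq I) (p : pred I) (F : I -> T -> R) :
  (forall i, bmfun (F i)) -> bmfun (fun x => \sum_(i <- s | p i) F i x).
Proof.
move=> bF; elim: s => [|i s IH].
  by under eq_fun do rewrite big_nil; exact: bmfun_cst.
under eq_fun do rewrite big_cons.
by case: (p i) => //; exact: bmfunD.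
Qed.

Lemma bmfun_prod (I : Type) (s : seq I) (p : pred I) (F : I -> T -> R) :
  (forall i, bmfun (F i)) -> bmfun (fun x => \prod_(i <- s | p i) F i x).
Proof.
move=> bF; elim: s => [|i s IH].
  by under eq_fun do rewrite big_nil; exact: bmfun_cst.
under eq_fun do rewrite big_cons.
by case: (p i) => //; exact: bmfunM.
Qed.

Lemma bmfun_bool (b : T -> bool) :
  measurable_fun setT b -> bmfun (fun x => (b x)%:R).
Proof.
move=> mb; split; last by exists 1 => x; case: (b x); rewrite ?normr1 ?normr0.
rewrite (_ : (fun x => _) = \1_(b @^-1` [set true])).
  apply: measurable_indic; rewrite -[X in measurable X]setTI.
  exact: mb.
apply/funext => x; rewrite indicE; congr (_%:R); apply/esym.
by case: (boolP (b x)) => bx; [rewrite mem_set|rewrite memNset//= (negbTE bx)].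
Qed.

(** A function of finitely many events is a finite combination of products of indicators. Any
    functional of the random graph is measurable for this reason, however intricate its
    combinatorics. *)
Lemma bmfun_finbool (I : finType) (b : I -> T -> bool) (F : {ffun I -> bool} -> R) :
  (forall i, measurable_fun setT (b i)) ->
  bmfun (fun x => F [ffun i => b i x]).
Proof.
move=> mb.
rewrite (_ : (fun x => _) =
  fun x => \sum_(be : {ffun I -> bool}) F be * (\prod_i (b i x == be i)%:R)).
  apply: bmfun_sum => be; apply: bmfunM; first exact: bmfun_cst.
  apply: bmfun_prod => i; apply: bmfun_bool.
  rewrite (_ : (fun x => _) = if be i then b i else (fun x => ~~ b i x)).
    by case: (be i) => //; exact: measurable_neg.
  by apply/funext => x; case: (be i); case: (b i x).
apply/funext => x; rewrite (bigD1 [ffun i => b i x])//=.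
rewrite [X in _ * X]big1 ?mulr1; last by move=> i _; rewrite ffunE eqxx.
rewrite big1 ?addr0// => be /negP ne.
rewrite (_ : \prod_i _ = 0) ?mulr0//; apply/eqP/prodf_eq0.
have [i bi|H] := pickP (fun i => b i x != be i).
  by exists i => //; rewrite (negbTE bi).
exfalso; apply: ne; apply/eqP/ffunP => i; rewrite ffunE.
by have /negbFE/eqP := H i.
Qed.

End bounded_measurable.

Lemma bmfun_comp d d' (T : measurableType d) (T' : measurableType d')
  (R : realType) (f : T' -> R) (g : T -> T') :
  bmfun f -> measurable_fun setT g -> bmfun (fun x => f (g x)).
Proof.
move=> [mf [M fM]] mg; split; first exact: (measurableT_comp mf mg).
by exists M.
Qed.

Section expectation.
Context d (T : measurableType d) (R : realType) (P : probability T R).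
Implicit Types f g : T -> R.

Definition Ex f : R := \int[P]_x f x.

Lemma bmfun_integrable f : bmfun f -> P.-integrable setT (EFin \o f).
Proof.
move=> [mf [M fM]].
apply: (@le_integrable _ _ _ _ setT measurableT (EFin \o f) (EFin \o cst M)).
- exact/measurable_EFinP.
- by move=> x _; rewrite /= lee_fin (le_trans (fM x))// ler_norm.
- exact: finite_measure_integrable_cst.
Qed.

Lemma EFin_Ex f : bmfun f -> (Ex f)%:E = (\int[P]_x (f x)%:E)%E.
Proof.
move=> bf; rewrite /Ex /Rintegral fineK//.
exact/integrable_fin_num/bmfun_integrable.
Qed.

Lemma ExD f g : bmfun f -> bmfun g -> Ex (fun x => f x + g x) = Ex f + Ex g.
Proof. by move=> bf bg; apply: RintegralD => //; exact: bmfun_integrable. Qed.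

Lemma ExB f g : bmfun f -> bmfun g -> Ex (fun x => f x - g x) = Ex f - Ex g.
Proof. by move=> bf bg; apply: RintegralB => //; exact: bmfun_integrable. Qed.

Lemma ExZ c f : bmfun f -> Ex (fun x => c * f x) = c * Ex f.
Proof. by move=> bf; apply: RintegralZl => //; exact: bmfun_integrable. Qed.

Lemma Ex_cst c : Ex (fun=> c) = c.
Proof. by rewrite /Ex Rintegral_cst// [X in fine X](_ : _ = 1%E) ?mulr1//; exact: probability_setT. Qed.

Lemma le_Ex f g : bmfun f -> bmfun g -> (forall x, f x <= g x) -> Ex f <= Ex g.
Proof.
by move=> bf bg fg; apply: le_Rintegral => // *;
  [exact: bmfun_integrable | exact: bmfun_integrable].
Qed.

Lemma Ex_ge0 f : (forall x, 0 <= f x) -> 0 <= Ex f.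
Proof. by move=> f0; apply: Rintegral_ge0. Qed.

Lemma eq_Ex f g : f =1 g -> Ex f = Ex g.
Proof. by move=> fg; apply: eq_Rintegral => x _. Qed.

Lemma Ex_sum (I : Type) (s : seq I) (p : pred I) (F : I -> T -> R) :
  (forall i, bmfun (F i)) ->
  Ex (fun x => \sum_(i <- s | p i) F i x) = \sum_(i <- s | p i) Ex (F i).
Proof.
move=> bF; elim: s => [|i s IH].
  by rewrite big_nil -[RHS]Ex_cst; apply: eq_Ex => x; rewrite big_nil.
rewrite big_cons -IH; case: ifP => pi.
  rewrite -ExD//; last exact: bmfun_sum.
  by apply: eq_Ex => x; rewrite big_cons pi.
by apply: eq_Ex => x; rewrite big_cons pi.
Qed.

Lemma Ex_bool (b : T -> bool) : measurable_fun setT b ->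
  (Ex (fun x => (b x)%:R))%:E = P [set x | b x].
Proof.
move=> mb; rewrite EFin_Ex; last exact: bmfun_bool.
rewrite (_ : [set x | b x] = b @^-1` [set true])//.
have mA : measurable (b @^-1` [set true]).
  by rewrite -[X in measurable X]setTI; exact: mb.
transitivity (\int[P]_x (\1_(b @^-1` [set true]) x)%:E)%E; last first.
  by rewrite integral_indic// setIT.
apply: eq_integral => x _; rewrite indicE; congr (_%:R%:E).
by case: (boolP (b x)) => bx; [rewrite mem_set|rewrite memNset//= (negbTE bx)].
Qed.

(** Sample points range over the whole of R^k and lie in the cube only almost surely; comparisons
    that need them in the cube go through this lemma. *)
Lemma le_Ex_as (C : T -> bool) f g : measurable_fun setT C ->
  Ex (fun x => (C x)%:R) = 1 -> bmfun f -> bmfun g ->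
  (forall x, C x -> f x <= g x) -> Ex f <= Ex g.
Proof.
move=> mC PC bf bg fg.
have bC := bmfun_bool R mC.
have ex0 h : bmfun h -> Ex (fun x => h x * (1 - (C x)%:R)) = 0.
  move=> [mh [M hM]]; apply/eqP; rewrite -normr_le0.
  have bh : bmfun (fun x => h x * (1 - (C x)%:R)).
    by apply: bmfunM => //; [split=> //; exists M | apply: bmfunB => //; exact: bmfun_cst].
  apply: (@le_trans _ _ (M * Ex (fun x => 1 - (C x)%:R))).
    rewrite -ExZ; last by apply: bmfunB => //; exact: bmfun_cst.
    rewrite ler_norml; apply/andP; split.
      rewrite -[leLHS]mulN1r -ExZ; last first.
        by apply: bmfunM; [exact: bmfun_cst|apply: bmfunB => //; exact: bmfun_cst].
      apply: le_Ex => //.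
        by do 2 (apply: bmfunM; first exact: bmfun_cst); apply: bmfunB => //; exact: bmfun_cst.
      move=> x; have := hM x; rewrite ler_norml => /andP[h1 h2].
      by case: (C x); rewrite /= ?mulr1n ?mulr0n; lra.
    apply: le_Ex => //.
      by apply: bmfunM; [exact: bmfun_cst|apply: bmfunB => //; exact: bmfun_cst].
    move=> x; have := hM x; rewrite ler_norml => /andP[h1 h2].
    by case: (C x); rewrite /= ?mulr1n ?mulr0n; lra.
  by rewrite ExB ?Ex_cst ?PC ?subrr ?mulr0//; exact: bmfun_cst.
have split h : bmfun h -> Ex h = Ex (fun x => h x * (C x)%:R).
  move=> bh; rewrite -[RHS]addr0 -(ex0 _ bh) -ExD.
  - by apply: eq_Ex => x; ring.
  - exact: bmfunM.
  - by apply: bmfunM => //; apply: bmfunB => //; exact: bmfun_cst.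
rewrite (split f)// (split g)//; apply: le_Ex; try exact: bmfunM.
by move=> x; case: (boolP (C x)) => Cx; rewrite ?mulr1 ?mulr0//; exact: fg.
Qed.

End expectation.

Section fubini.
Context d1 d2 (T1 : measurableType d1) (T2 : measurableType d2) (R : realType)
  (P1 : probability T1 R) (P2 : probability T2 R).
Implicit Types f : T1 * T2 -> R.

Lemma bmfun_Ex f : bmfun f -> bmfun (fun x => Ex P2 (fun y => f (x, y))).
Proof.
move=> bf.
have bf1 x : bmfun (fun y => f (x, y)).
  by apply: (bmfun_comp bf); exact: measurable_pair1.
split.
  apply/measurable_EFinP.
  rewrite (_ : _ \o _ = fun x => (\int[P2]_y (EFin \o f) (x, y))%E).
    have := @measurable_fubini_F _ _ _ _ _ P1 P2 (EFin \o f).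
    by apply; exact: (bmfun_integrable (P1 \x P2)%E bf).
  by apply/funext => x /=; rewrite EFin_Ex.
have [_ [M fM]] := bf; exists M => x.
rewrite ler_norml; apply/andP; split.
  rewrite -(Ex_cst P2 (- M)); apply: le_Ex => //; first exact: bmfun_cst.
  by move=> y; have := fM (x, y); rewrite ler_norml => /andP[].
rewrite -[leRHS](Ex_cst P2 M); apply: le_Ex => //; first exact: bmfun_cst.
by move=> y; have := fM (x, y); rewrite ler_norml => /andP[].
Qed.

Lemma Ex_prod f : bmfun f ->
  Ex (P1 \x P2)%E f = Ex P1 (fun x => Ex P2 (fun y => f (x, y))).
Proof.
move=> bf; apply: EFin_inj; rewrite EFin_Ex//.
rewrite -(@integral12_prod_meas1 _ _ _ _ _ P1 P2 (EFin \o f)); last first.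
  exact: (bmfun_integrable (P1 \x P2)%E bf).
rewrite EFin_Ex; last exact: bmfun_Ex.
apply: eq_integral => x _; rewrite EFin_Ex//.
by apply: (bmfun_comp bf); exact: measurable_pair1.
Qed.

End fubini.

Section fubini_swap.
Context d1 d2 (T1 : measurableType d1) (T2 : measurableType d2) (R : realType)
  (P1 : probability T1 R) (P2 : probability T2 R).

Lemma Ex_swap (f : T1 -> T2 -> R) : bmfun (fun z => f z.1 z.2) ->
  Ex P1 (fun x => Ex P2 (f x)) = Ex P2 (fun y => Ex P1 (f ^~ y)).
Proof.
move=> bf.
have bs : bmfun (fun z : T2 * T1 => f z.2 z.1).
  apply: (@bmfun_comp _ _ _ _ _ (fun z => f z.1 z.2) (fun z => (z.2, z.1))) => //.
  exact: measurable_fun_pair.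
apply: EFin_inj; rewrite !EFin_Ex//; last 2 first.
- exact: (@bmfun_Ex _ _ _ _ _ P2 P1 (fun z => f z.2 z.1)).
- exact: (@bmfun_Ex _ _ _ _ _ P1 P2 (fun z => f z.1 z.2)).
have := @Fubini _ _ _ _ _ P1 P2 (EFin \o (fun z => f z.1 z.2)).
move=> /(_ (bmfun_integrable (P1 \x P2)%E bf)) /= H.
rewrite -[LHS]/(\int[P1]_x (Ex P2 (f x))%:E)%E.
transitivity (\int[P1]_x \int[P2]_y (f x y)%:E)%E.
  apply: eq_integral => x _; rewrite EFin_Ex//.
  apply: (@bmfun_comp _ _ _ _ _ (fun z => f z.1 z.2) (fun y => (x, y))) => //.
  exact: measurable_pair1.
rewrite H; apply: eq_integral => y _; rewrite EFin_Ex//.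
apply: (@bmfun_comp _ _ _ _ _ (fun z => f z.1 z.2) (fun x => (x, y))) => //.
Qed.

End fubini_swap.

Lemma Ex_pushforward d d' (T : measurableType d) (T' : measurableType d')
  (R : realType) (P : probability T R) (phi : {mfun T >-> T'}) (f : T' -> R) :
  bmfun f -> Ex (distribution P phi) f = Ex P (fun x => f (phi x)).
Proof.
move=> bf; rewrite /Ex /Rintegral; congr fine.
have mphi : measurable_fun setT phi by [].
rewrite (@integral_pushforward _ _ _ _ _ phi mphi P setT (EFin \o f))//.
- by apply/measurable_EFinP; have [] := bf.
- rewrite preimage_setT; apply: (bmfun_integrable P (f := f \o phi)).
  exact: (bmfun_comp bf).
Qed.

(** * Independent samples *)

Section replace_coordinate.
Variables (T : Type) (n : nat).
Implicit Types (t : n.-tuple T) (i j : 'I_n) (x y : T).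

Definition upd t i x : n.-tuple T :=
  [tuple if j == i then x else tnth t j | j < n].

Definition tperm_tuple t (s : {perm 'I_n}) : n.-tuple T :=
  [tuple tnth t (s j) | j < n].

Lemma tnth_upd t i x j : tnth (upd t i x) j = if j == i then x else tnth t j.
Proof. by rewrite tnth_mktuple. Qed.

End replace_coordinate.

Lemma upd_cons0 d (T : measurableType d) n (x y : T) (t : n.-tuple T) :
  upd (tuple_cons (x, t)) ord0 y = tuple_cons (y, t).
Proof.
apply: eq_from_tnth => j; rewrite tnth_upd.
by case: (unliftP ord0 j) => [k ->|->] //=; rewrite !tnthS.
Qed.

Lemma upd_consS d (T : measurableType d) n (x y : T) (t : n.-tuple T) (i : 'I_n) :
  upd (tuple_cons (x, t)) (lift ord0 i) y = tuple_cons (x, upd t i y).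
Proof.
apply: eq_from_tnth => j; rewrite tnth_upd.
case: (unliftP ord0 j) => [k ->|->] //=; rewrite !tnthS tnth_upd.
by rewrite (inj_eq lift_inj).
Qed.

Section iid_resampling.
Context d (T : measurableType d) (R : realType) (P : probability T R).

Lemma measurable_upd n (i : 'I_n) :
  measurable_fun setT (fun z : n.-tuple T * T => upd z.1 i z.2).
Proof.
apply/measurable_fun_tnthP => j.
rewrite (_ : _ \o _ = if j == i then snd else (fun z => tnth z.1 j)).
  case: (j == i) => //.
  exact: (measurableT_comp (measurable_tnth j) measurable_fst).
by apply/funext => z /=; rewrite tnth_upd; case: (j == i).
Qed.

Lemma measurable_fun_upd d' (T' : measurableType d') n (i : 'I_n)
  (f : T' -> n.-tuple T) (g : T' -> T) :
  measurable_fun setT f -> measurable_fun setT g ->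
  measurable_fun setT (fun z => upd (f z) i (g z)).
Proof.
move=> mf mg.
exact: (measurableT_comp (measurable_upd i) (measurable_fun_pair mf mg)).
Qed.

Lemma Ex_iidS n (f : n.+1.-tuple T -> R) : bmfun f ->
  Ex (iid_prob P n.+1) f =
  Ex P (fun x => Ex (iid_prob P n) (fun t => f (tuple_cons (x, t)))).
Proof.
move=> bf.
rewrite [LHS](Ex_pushforward (P \x iid_prob P n)%E (@tuple_cons _ T n))//.
rewrite Ex_prod//; apply: (bmfun_comp bf).
exact: measurable_tuple_cons.
Qed.

Lemma bmfun_tuple_cons n (f : n.+1.-tuple T -> R) x : bmfun f ->
  bmfun (fun t : n.-tuple T => f (tuple_cons (x, t))).
Proof.
move=> bf; apply: (bmfun_comp bf).
apply: (@measurableT_comp _ _ _ _ _ _ (@tuple_cons d T n) _ (fun t => (x, t))).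
- exact: measurable_tuple_cons.
- exact: measurable_pair1.
Qed.

(** This lets one point be integrated out while all the others stay fixed. *)
Lemma Ex_resample n (i : 'I_n) (f : n.-tuple T -> R) : bmfun f ->
  Ex (iid_prob P n) f =
  Ex (iid_prob P n) (fun t => Ex P (fun x => f (upd t i x))).
Proof.
elim: n i f => [[]//|n IH] i f bf.
have bu m (k : 'I_m) (g : m.-tuple T -> R) : bmfun g -> bmfun (fun t => Ex P (fun x => g (upd t k x))).
  move=> bg; apply: (@bmfun_Ex _ _ _ _ _ (iid_prob P m) P (fun z => g (upd z.1 k z.2))).
  by apply: (bmfun_comp bg); exact: measurable_upd.
rewrite Ex_iidS// Ex_iidS; last exact: bu.
case: (unliftP ord0 i) => [j ->|->].
  apply: eq_Ex => x; rewrite (IH j); last exact: bmfun_tuple_cons.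
  by apply: eq_Ex => t; apply: eq_Ex => y; rewrite upd_consS.
rewrite Ex_swap; last first.
  rewrite (_ : (fun z => _) = (fun z => f (tuple_cons z))).
    by apply: (bmfun_comp bf); exact: measurable_tuple_cons.
  by apply/funext => -[].
rewrite -[LHS](Ex_cst P); apply: eq_Ex => x; apply: eq_Ex => t.
by apply: eq_Ex => y; rewrite upd_cons0.
Qed.

(** For a transposition, resample both coordinates and exchange the two inner integrals;
    transpositions generate the rest. *)
Lemma Ex_iid_perm n (s : {perm 'I_n}) (f : n.-tuple T -> R) : bmfun f ->
  Ex (iid_prob P n) (fun t => f (tperm_tuple t s)) = Ex (iid_prob P n) f.
Proof.
have mp m (q : {perm 'I_m}) : measurable_fun setT (fun t : m.-tuple T => tperm_tuple t q).
  apply/measurable_fun_tnthP => j.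
  rewrite (_ : _ \o _ = (fun t => tnth t (q j))); first exact: measurable_tnth.
  by apply/funext => t /=; rewrite tnth_mktuple.
have [ts -> _] := prod_tpermP s.
elim: ts f => [|[i j] ts IH] f bf.
  rewrite big_nil; apply: eq_Ex => t; congr f.
  by apply: eq_from_tnth => l; rewrite tnth_mktuple perm1.
rewrite big_cons /=.
transitivity (Ex (iid_prob P n) (fun t => f (tperm_tuple t (tperm i j)))).
  rewrite -[RHS]IH; last by apply: (bmfun_comp bf); exact: mp.
  apply: eq_Ex => t; congr f; apply: eq_from_tnth => l.
  by rewrite !tnth_mktuple permM.
have [<-|ij] := eqVneq i j.
  apply: eq_Ex => t; congr f.
  by apply: eq_from_tnth => l; rewrite tnth_mktuple tperm1 perm1.
have bu k (g : n.-tuple T -> R) : bmfun g -> bmfun (fun t => Ex P (fun x => g (upd t k x))).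
  move=> bg; apply: (@bmfun_Ex _ _ _ _ _ (iid_prob P n) P (fun z => g (upd z.1 k z.2))).
  by apply: (bmfun_comp bg); exact: measurable_upd.
rewrite (Ex_resample j); last by apply: (bmfun_comp bf); exact: mp.
rewrite (Ex_resample i); last by apply: (bu j (fun t => f (tperm_tuple t (tperm i j)))); apply: (bmfun_comp bf); exact: mp.
rewrite [RHS](Ex_resample j)// [RHS](Ex_resample i); last exact: bu.
apply: eq_Ex => t; rewrite [RHS]Ex_swap; last first.
  apply: (bmfun_comp bf); apply: measurable_fun_upd => //.
  apply: measurable_fun_upd => //; exact: measurable_cst.
apply: eq_Ex => x; apply: eq_Ex => y; congr f.
apply: eq_from_tnth => l; rewrite tnth_mktuple !tnth_upd.
case: tpermP => [->|->|/eqP li /eqP lj].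
- by rewrite !eqxx (negbTE ij).
- by rewrite !eqxx (negbTE ij).
- by rewrite (negbTE li) (negbTE lj).
Qed.

Lemma measurable_all n (b : T -> bool) : measurable_fun setT b ->
  measurable_fun setT (fun t : n.-tuple T => all b t).
Proof.
move=> mb; elim: n => [|n IH].
  rewrite (_ : (fun t => _) = cst true); first exact: measurable_cst.
  by apply/funext => t; rewrite tuple0.
rewrite (_ : (fun t => _) =
    fun t : n.+1.-tuple T => b (tnth t ord0) && all b [tuple of behead t]).
  apply: measurable_and; first exact: (measurableT_comp mb (measurable_tnth ord0)).
  exact: (measurableT_comp IH (measurable_behead (n := n))).
by apply/funext => t; case/tupleP: t => x t.
Qed.

Lemma Ex_iid_all n (b : T -> bool) : measurable_fun setT b ->
  Ex (iid_prob P n) (fun t => (all b t)%:R) = (Ex P (fun x => (b x)%:R)) ^+ n.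
Proof.
move=> mb; elim: n => [|n IH].
  rewrite expr0 -[RHS](Ex_cst (iid_prob P 0)); apply: eq_Ex => t.
  by rewrite tuple0.
rewrite Ex_iidS; last by apply: bmfun_bool; exact: measurable_all.
rewrite exprS -IH mulrC -ExZ; last exact: bmfun_bool.
apply: eq_Ex => x /=; rewrite mulrC -ExZ; last first.
  by apply: bmfun_bool; exact: measurable_all.
by apply: eq_Ex => t; rewrite /= -natrM mulnb.
Qed.

Lemma measurable_has n (b : T -> bool) : measurable_fun setT b ->
  measurable_fun setT (fun t : n.-tuple T => has b t).
Proof.
move=> mb; rewrite (_ : (fun t => _) = fun t : n.-tuple T => ~~ all (predC b) t).
  by apply: measurable_neg; apply: measurable_all; exact: measurable_neg.
by apply/funext => t; rewrite -has_predC; apply: eq_has => x /=; rewrite negbK.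
Qed.

Definition all_hit n (c : T -> nat) (Q : seq nat) (t : n.-tuple T) : bool :=
  all (fun q => has (fun x => c x == q) t) Q.

Lemma measurable_all_hit n (c : T -> nat) Q :
  (forall q, measurable_fun setT (fun x => c x == q)) ->
  measurable_fun setT (@all_hit n c Q).
Proof.
move=> mc; elim: Q => [|q Q IH]; first exact: measurable_cst.
by apply: measurable_and => //; exact: measurable_has.
Qed.

(* The events of hitting disjoint cells are negatively correlated. *)
Lemma Ex_all_hit n (c : T -> nat) (Q : seq nat) (p : R) :
  0 <= p <= 1 ->
  (forall q, measurable_fun setT (fun x => c x == q)) ->
  uniq Q -> (forall q, q \in Q -> Ex P (fun x => (c x == q)%:R) = p) ->
  Ex (iid_prob P n) (fun t => (all_hit c Q t)%:R) <=
  (1 - (1 - p) ^+ n) ^+ (size Q).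
Proof.
move=> /andP[p0 p1] mc.
have bh m Q' : bmfun (fun t : m.-tuple T => (all_hit c Q' t)%:R : R).
  by apply: bmfun_bool; exact: measurable_all_hit.
have bc q : bmfun (fun x => (c x == q)%:R : R) by apply: bmfun_bool.
elim: n Q => [|n IH] Q uQ pQ.
  rewrite expr0 subrr; case: Q uQ pQ => [|q Q] _ _.
    by rewrite expr0 Ex_cst.
  rewrite exprS mul0r -[leRHS](Ex_cst (iid_prob P 0) 0).
  apply: le_Ex; [exact: bh|exact: bmfun_cst|].
  by move=> t; rewrite tuple0.
set a := 1 - (1 - p) ^+ n.
have a0 : 0 <= a by rewrite /a subr_ge0 exprn_ile1// ?subr_ge0// lerBlDr lerDl.
have aS : 1 - (1 - p) ^+ n.+1 = a + p * (1 - a) by rewrite /a exprS; ring.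
have a1 : a <= 1 by rewrite /a lerBlDr lerDl exprn_ge0// subr_ge0.
set J := size Q.
have sumQ x : \sum_(q <- Q) (c x == q)%:R = (c x \in Q)%:R :> R.
  have [xQ|xQ] := boolP (c x \in Q).
    rewrite (bigD1_seq (c x))//= eqxx big1 ?addr0// => q.
    by rewrite eq_sym => /negbTE ->.
  rewrite big_seq big1// => q qQ.
  by case: eqP => // cq; rewrite cq qQ in xQ.
(* The first draw hits one of the [J] cells with probability J p, leaving J - 1 to hit. The
   resulting mixture equals a^J + J a^(J-1) b with b = p (1 - a), the start of the expansion of (a +
   b)^J. *)
have {}aS : J%:R * p * a ^+ J.-1 + (1 - J%:R * p) * a ^+ J <= (1 - (1 - p) ^+ n.+1) ^+ J.
  rewrite aS; have b0 : 0 <= p * (1 - a) by rewrite mulr_ge0// subr_ge0.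
  have -> : J%:R * p * a ^+ J.-1 + (1 - J%:R * p) * a ^+ J =
            a ^+ J + J%:R * a ^+ J.-1 * (p * (1 - a)).
    by case: J => [|J] /=; [ring|rewrite exprS; ring].
  move: b0; move: (p * (1 - a)) => b b0.
  elim: J => [|J IHJ] /=; first by rewrite !expr0; lra.
  have aJ : 0 <= a ^+ J by rewrite exprn_ge0.
  rewrite [leRHS]exprS; apply: le_trans (ler_wpM2l (addr_ge0 a0 b0) IHJ).
  have -> : (a + b) * (a ^+ J + J%:R * a ^+ J.-1 * b) =
     a ^+ J.+1 + J.+1%:R * a ^+ J * b + J%:R * a ^+ J.-1 * b ^+ 2.
    by case: J {IHJ aJ} => [|J] /=; rewrite ?exprS -?[J.+2%:R]natr1 -?[J.+1%:R]natr1; ring.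
  by rewrite lerDl !mulr_ge0// ?exprn_ge0.
apply: le_trans aS.
rewrite Ex_iidS//.
apply: (@le_trans _ _ (Ex P (fun x => \sum_(q <- Q) (c x == q)%:R * a ^+ J.-1 +
    (1 - \sum_(q <- Q) (c x == q)%:R) * a ^+ J))); last first.
  rewrite le_eqVlt; apply/orP; left; apply/eqP; rewrite ExD.
  - under [X in X + _ = _]eq_Ex do rewrite -mulr_suml mulrC.
    under [X in _ + X = _]eq_Ex do rewrite mulrC.
    rewrite ExZ; last exact: bmfun_sum.
    rewrite ExZ; last by apply: bmfunB; [exact: bmfun_cst|exact: bmfun_sum].
    rewrite ExB; [|exact: bmfun_cst|exact: bmfun_sum].
    rewrite Ex_cst Ex_sum//.
    have -> : \sum_(q <- Q) Ex P (fun x => (c x == q)%:R) = J%:R * p.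
      rewrite big_seq (eq_bigr (fun=> p)); last by move=> q qQ; exact: pQ.
      by rewrite -big_seq big_const_seq count_predT -/J iter_addr addr0 mulr_natl.
    by ring.
  - by apply: bmfun_sum => q; apply: bmfunM => //; exact: bmfun_cst.
  - apply: bmfunM; last exact: bmfun_cst.
    by apply: bmfunB; [exact: bmfun_cst|exact: bmfun_sum].
apply: le_Ex.
- apply: (@bmfun_Ex _ _ _ _ _ P (iid_prob P n) (fun z => (all_hit c Q (tuple_cons z))%:R)).
  exact: (bmfun_comp (bh _ _) (measurable_tuple_cons (n := n))).
- apply: bmfunD.
    by apply: bmfun_sum => q; apply: bmfunM => //; exact: bmfun_cst.
  apply: bmfunM; last exact: bmfun_cst.
  by apply: bmfunB; [exact: bmfun_cst|exact: bmfun_sum].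
move=> x; rewrite -mulr_suml sumQ.
have [xQ|xQ] := boolP (c x \in Q); last first.
  rewrite mul0r add0r subr0 mul1r; apply: le_trans (IH Q uQ pQ).
  apply: le_Ex; [exact: (bmfun_tuple_cons x (bh _ Q))|exact: bh|].
  move=> t; rewrite ler_nat; case: (boolP (all_hit _ _ (tuple_cons _))) => // /allP H.
  suff -> : all_hit c Q t by [].
  apply/allP => q qQ; have /= := H q qQ; case: eqP => // cq.
  by rewrite cq qQ in xQ.
rewrite mul1r subrr mul0r addr0.
have -> : J.-1 = size (rem (c x) Q) by rewrite size_rem.
have uR : uniq (rem (c x) Q) by exact: rem_uniq.
apply: le_trans (IH _ uR _); last by move=> q /mem_rem; exact: pQ.
apply: le_Ex; [exact: (bmfun_tuple_cons x (bh _ Q))|exact: bh|].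
move=> t; rewrite ler_nat; case: (boolP (all_hit _ _ (tuple_cons _))) => // /allP H.
suff -> : all_hit c (rem (c x) Q) t by [].
apply/allP => q; rewrite mem_rem_uniq// inE => /andP[qx qQ].
by have /= := H q qQ; rewrite eq_sym (negbTE qx).
Qed.

End iid_resampling.

(** * Balls in the cube *)

Section affine_maps.
Context (R : realType).
Notation U := (uniform_prob (@ltr01 R)).
Notation mu := (@lebesgue_measure R).

Definition unitb (x : R) : bool := 0 <= x <= 1.

Lemma measurable_unitb : measurable_fun setT (unitb : measurableTypeR R -> bool).
Proof. by apply: measurable_and; apply: measurable_fun_ler. Qed.

Lemma measurable_affine (v l : R) :
  measurable_fun setT ((fun x => v + l * x) : measurableTypeR R -> measurableTypeR R).
Proof.
by apply: measurable_funD => //; exact: measurable_funM.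
Qed.

Lemma Ex_unitb : Ex U (fun x => (unitb x)%:R) = 1.
Proof.
apply: EFin_inj; rewrite Ex_bool; last exact: measurable_unitb.
by rewrite /= /uniform_prob integral_uniform_pdf1.
Qed.

(** Change of variables: Lebesgue measure is [l] times its own image under x -> v + l x, as both
    agree on intervals. Only an inequality results, since the image of [0, 1] need not cover
    [0, 1]. *)
Lemma affine_uniform_le (v l : R) (f : measurableTypeR R -> R) :
  0 < l -> bmfun f -> (forall x, 0 <= f x) ->
  l * Ex U (fun x => f (v + l * x) * (unitb (v + l * x))%:R) <= Ex U f.
Proof.
move=> l0 bf f0.
pose h (y : measurableTypeR R) : R := f y * (unitb y)%:R.
have bh : bmfun h by apply: bmfunM => //; apply: bmfun_bool; exact: measurable_unitb.
have h0 y : (0 <= (h y)%:E)%E by rewrite lee_fin mulr_ge0.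
have mh : measurable_fun setT (EFin \o h) by apply/measurable_EFinP; case: bh.
pose phi : measurableTypeR R -> measurableTypeR R := fun x => v + l * x.
have mphi : measurable_fun setT phi by exact: measurable_affine.
have bhp : bmfun (h \o phi) by exact: bmfun_comp bh mphi.
have l0' : 0 <= l by exact: ltW.
pose nu : {measure set (measurableTypeR R) -> \bar R} :=
  mscale (NngNum l0')
    (measure_function_pushforward__canonical__measure_function_Measure mu mphi).
have nuE A : measurable A -> mu A = nu A.
  apply: lebesgue_measure_unique => _ [[a b]] _ <-.
  rewrite /nu /= /mscale /= /pushforward /=.
  rewrite (_ : phi @^-1` _ = `](a - v) / l, (b - v) / l]%classic); last first.
    apply/seteqP; split=> x /=; rewrite !in_itv/= /phi ltr_pdivrMr// ler_pdivlMr// => /andP[h1 h2];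
    apply/andP; split; lra.
  rewrite !lebesgue_measure_itv/= !lte_fin ltr_pM2r ?invr_gt0// ltrD2r.
  case: ifP => _; last by rewrite mule0.
  rewrite -!EFinB -EFinM; congr EFin.
  by field; rewrite gt_eqF.
rewrite -lee_fin EFinM !EFin_Ex//.
rewrite integral_uniform; last 2 first.
- by apply/measurable_EFinP; case: bhp.
- by move=> x; exact: (h0 (phi x)).
rewrite integral_uniform; last 2 first.
- by apply/measurable_EFinP; case: bf.
- by move=> x; rewrite lee_fin.
rewrite subr0 invr1 !mul1e.
have -> : (\int[mu]_(x in `[0%R, 1%R]) (f x)%:E = \int[mu]_x (h x)%:E)%E.
  rewrite [LHS]integral_mkcond; apply: eq_integral => x _.
  rewrite patchE /h /unitb; case: ifPn; rewrite ?inE ?notin_setE /= in_itv /=.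
    by move=> ->; rewrite mulr1.
  by move=> /negP/negbTE ->; rewrite mulr0.
have -> : (\int[mu]_x (h x)%:E = l%:E * \int[mu]_x (h (phi x))%:E)%E.
  rewrite (@eq_measure_integral _ _ _ _ nu); last by move=> A mA _; exact: nuE.
  rewrite ge0_integral_mscale//; congr (_ * _)%E.
  by rewrite (@ge0_integral_pushforward _ _ _ _ _ phi mphi).
apply: lee_wpmul2l; first by rewrite lee_fin.
apply: ge0_subset_integral => //.
  by apply/measurable_EFinP; case: bhp.
by move=> x _; exact: (h0 (phi x)).
Qed.

End affine_maps.

Section cube.
Context (R : realType).
Notation U := (uniform_prob (@ltr01 R)).
Notation pt k := (k.-tuple (measurableTypeR R)).

Definition incube k (x : pt k) : bool := all (@unitb R) x.

Definition affine k (v : pt k) (l : R) (x : pt k) : pt k :=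
  [tuple (tnth v i : R) + l * (tnth x i : R) | i < k].

Lemma measurable_incube k : measurable_fun setT (@incube k).
Proof. exact: measurable_all (@measurable_unitb R). Qed.

Lemma Ex_incube k : Ex (uniform_cube R k) (fun x => (incube x)%:R) = 1.
Proof.
rewrite /uniform_cube Ex_iid_all; first by rewrite Ex_unitb expr1n.
exact: measurable_unitb.
Qed.

Lemma measurable_affinek k (v : pt k) l : measurable_fun setT (affine v l).
Proof.
apply/measurable_fun_tnthP => i.
rewrite (_ : _ \o _ = (fun y : measurableTypeR R => (tnth v i : R) + l * y : measurableTypeR R)
   \o (fun x : pt k => tnth x i)).
  by apply: measurableT_comp; [exact: measurable_affine|exact: measurable_tnth].
by apply/funext => x /=; rewrite tnth_mktuple.
Qed.

(** The volume comparisons below (Kneser's inequality, ball volumes) are instances of this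
    inequality for suitable homotheties. *)
Lemma affine_cube_le k (v : pt k) (l : R) (f : pt k -> R) :
  0 < l -> bmfun f -> (forall x, 0 <= f x) ->
  l ^+ k * Ex (uniform_cube R k) (fun x => f (affine v l x) * (incube (affine v l x))%:R)
  <= Ex (uniform_cube R k) f.
Proof.
move=> l0; elim: k v f => [|k IH] v f bf f0.
  rewrite expr0 mul1r; apply: le_Ex => //.
    apply: bmfunM; first exact: (bmfun_comp bf (measurable_affinek v l)).
    exact: bmfun_bool (measurableT_comp (@measurable_incube 0) (measurable_affinek v l)).
  by move=> x; rewrite [affine v l x]tuple0 [x]tuple0 /= mulr1.
have mf := bmfun_comp bf (measurable_affinek v l).
have bi j (w : pt j) : bmfun (fun x => (incube (affine w l x))%:R : R).
  exact: bmfun_bool (measurableT_comp (@measurable_incube j) (measurable_affinek w l)).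
have bg := bmfunM mf (bi _ v).
rewrite /uniform_cube Ex_iidS// [leRHS]Ex_iidS//.
have [v0 [v' vE]] : exists v0 v', v = tuple_cons (v0, v').
  by case/tupleP: v {mf bi bg} => v0 v'; exists v0, v'.
pose F (y : measurableTypeR R) : R := Ex (iid_prob U k) (fun t => f (tuple_cons (y, t))).
have bF : bmfun F.
  apply: (@bmfun_Ex _ _ _ _ _ U (iid_prob U k) (fun z => f (tuple_cons z))).
  by apply: (bmfun_comp bf); exact: measurable_tuple_cons.
have F0 y : 0 <= F y by apply: Ex_ge0.
apply: le_trans (affine_uniform_le v0 l0 bF F0).
have bu : bmfun (fun x : measurableTypeR R => F (v0 + l * x) * (unitb (v0 + l * x))%:R).
  apply: (@bmfun_comp _ _ _ _ _ (fun y => F y * (unitb y)%:R) (fun x => v0 + l * x)).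
    by apply: bmfunM => //; apply: bmfun_bool; exact: measurable_unitb.
  exact: measurable_affine.
have aE x t : affine v l (tuple_cons (x, t)) = tuple_cons (v0 + l * x, affine v' l t).
  rewrite vE; apply: eq_from_tnth => j; rewrite tnth_mktuple.
  by case: (unliftP ord0 j) => [i ->|->] //=; rewrite !tnthS tnth_mktuple.
have iE a (t : pt k) : incube (tuple_cons (a, t)) = unitb a && incube t by [].
rewrite exprS -mulrA; apply: ler_wpM2l; first exact: ltW.
rewrite -ExZ; last first.
  apply: (@bmfun_Ex _ _ _ _ _ U (iid_prob U k)
   (fun z => f (affine v l (tuple_cons z)) * (incube (affine v l (tuple_cons z)))%:R)).
  by apply: (bmfun_comp bg); exact: measurable_tuple_cons.
apply: le_Ex => //.
  apply: bmfunM; first exact: bmfun_cst.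
  apply: (@bmfun_Ex _ _ _ _ _ U (iid_prob U k)
   (fun z => f (affine v l (tuple_cons z)) * (incube (affine v l (tuple_cons z)))%:R)).
  by apply: (bmfun_comp bg); exact: measurable_tuple_cons.
move=> x; have := IH v' (fun t => f (tuple_cons (v0 + l * x, t))).
move=> /(_ (bmfun_tuple_cons _ bf) (fun=> f0 _)) H.
have [ux|/negbTE ux] := boolP (unitb (v0 + l * x)).
  rewrite mulr1; apply: le_trans H.
  rewrite le_eqVlt; apply/orP; left; apply/eqP; congr (_ * _).
  by apply: eq_Ex => t; rewrite aE iE ux.
rewrite mulr0 (_ : Ex _ _ = 0) ?mulr0// -[RHS](Ex_cst (iid_prob U k)).
by apply: eq_Ex => t; rewrite aE iE ux mulr0.
Qed.

End cube.

(** * Concavity from Kneser's inequality *)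

Section geometric_concavity.
Context (R : realType).
Implicit Types (F : R -> R) (w x y z t q : R).

Lemma le0_small (X K d : R) : 0 < d -> 0 <= K ->
  (forall e, 0 < e < d -> X <= e * K) -> X <= 0.
Proof.
move=> d0 K0 H; rewrite leNgt; apply/negP => X0.
pose e := Num.min (d / 2) (X / (2 * (K + 1))).
have e0 : 0 < e by rewrite lt_min !divr_gt0//; lra.
have ed : e < d by rewrite gt_min; apply/orP; left; lra.
have := H e; rewrite e0 ed => /(_ isT).
have : e * (2 * (K + 1)) <= X.
  by rewrite -ler_pdivlMr; [rewrite ge_min lexx orbT|lra].
by nra.
Qed.

Lemma expr_unbounded q z : 1 < q -> exists r, z <= q ^+ r.
Proof.
move=> q1; have [r zr] : exists r : nat, z / (q - 1) <= r%:R.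
  exists (Num.truncn `|z / (q - 1)|).+1.
  by rewrite (le_trans (ler_norm _))// ltW// truncnS_gt.
exists r; have q0 : 0 < q - 1 by lra.
rewrite ler_pdivrMr// in zr.
apply: le_trans zr _.
elim: r => [|r IH]; first by rewrite mul0r expr0.
rewrite exprS -natr1.
have h : 1 <= q ^+ r by rewrite exprn_ege1// ltW.
by nra.
Qed.

Definition nondecr_ge0 F := forall x y, 0 <= x -> x <= y -> F x <= F y.

(* Kneser's inequality for parallel volumes, in the variable radius^k. *)
Definition kneser F :=
  forall t x y, 1 <= t -> 0 <= x -> x <= y -> F (t * y) - F (t * x) <= t * (F y - F x).

(** Along the geometric progression y q^r, Kneser's inequality bounds every increment to the right
    of y by a scaled copy of the increment A over [y/q, y], and A by scaled copies of those to the
    left. So the chord slope of A separates the two sides. Monotonicity allows z and w to be rounded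
    to the progression, at a cost that vanishes as q tends to 1; no continuity is assumed. *)
Lemma kneser_three_slopes_pos F w y z : nondecr_ge0 F -> kneser F ->
  0 < w -> w < y -> y < z -> (F z - F y) * (y - w) <= (F y - F w) * (z - y).
Proof.
move=> ndF kF w0 wy yz; rewrite -subr_le0.
set B := F z - F y; set C := F y - F w.
have B0 : 0 <= B by rewrite subr_ge0 ndF// ltW//; lra.
have C0 : 0 <= C by rewrite subr_ge0 ndF// ltW//; lra.
have y0 : 0 < y by lra.
(* With q = 1 + e, the final bound B (y - q w) <= C (q z - y) exceeds the wanted one by e (B w + C
   z); the range of [e] ensures q w < y. *)
apply: (@le0_small _ (B * w + C * z) (y / w - 1)).
- by rewrite subr_gt0 ltr_pdivlMr// mul1r.
- by rewrite addr_ge0// mulr_ge0//; lra.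
move=> e /andP[e0 ed]; have [q qE] : exists q, q = 1 + e by eexists.
have q1 : 1 < q by lra.
have q0 : 0 < q by lra.
have qw : q * w < y by rewrite -ltr_pdivlMr// qE; lra.
have [A AE] : exists A, A = F y - F (y / q) by eexists.
have yq0 : 0 <= y / q by rewrite divr_ge0 ?ltW.
have yqy : y / q <= y by rewrite ler_pdivrMr//; nra.
have A0 : 0 <= A by rewrite AE subr_ge0 ndF.
have D0 : 0 < y - y / q by rewrite subr_gt0 ltr_pdivrMr//; nra.
have right r : (F (y * q ^+ r) - F y) * (y - y / q) <= A * (y * q ^+ r - y).
  elim: r => [|r IH]; first by rewrite expr0 mulr1 !subrr mul0r mulr0.
  have qr1 : 1 <= q ^+ r.+1 by rewrite exprn_ege1// ltW.
  have := kF (q ^+ r.+1) (y / q) y qr1 yq0 yqy.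
  have -> : q ^+ r.+1 * (y / q) = y * q ^+ r.
    by rewrite exprS; field; rewrite gt_eqF.
  rewrite [q ^+ r.+1 * y]mulrC -AE => H.
  rewrite -(subrKA (F (y * q ^+ r))) mulrDl.
  have -> : A * (y * q ^+ r.+1 - y) = q ^+ r.+1 * A * (y - y / q) + A * (y * q ^+ r - y).
    by rewrite exprS; field; rewrite gt_eqF.
  by apply: lerD => //; apply: ler_wpM2r => //; exact: ltW.
have left p : A * (y - y / q ^+ p) <= (F y - F (y / q ^+ p)) * (y - y / q).
  elim: p => [|p IH]; first by rewrite expr0 divr1 !subrr mul0r mulr0.
  have qp0 : 0 < q ^+ p by rewrite exprn_gt0.
  have qr1 : 1 <= q ^+ p by rewrite exprn_ege1// ltW.
  have a1 : 0 <= y / q ^+ p.+1 by apply: divr_ge0; [|apply: exprn_ge0]; exact: ltW.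
  have a2 : y / q ^+ p.+1 <= y / q ^+ p.
    apply: ler_wpM2l; first exact: ltW.
    by rewrite lef_pV2 ?posrE ?exprn_gt0// exprS; nra.
  have := kF (q ^+ p) (y / q ^+ p.+1) (y / q ^+ p) qr1 a1 a2.
  have -> : q ^+ p * (y / q ^+ p) = y by field; rewrite gt_eqF.
  have -> : q ^+ p * (y / q ^+ p.+1) = y / q.
    by rewrite exprS; field; rewrite !gt_eqF.
  rewrite -AE => H.
  have -> : F y - F (y / q ^+ p.+1) =
     (F y - F (y / q ^+ p)) + (F (y / q ^+ p) - F (y / q ^+ p.+1)) by ring.
  rewrite mulrDl.
  have -> : A * (y - y / q ^+ p.+1) = A * (y - y / q ^+ p) + A / q ^+ p * (y - y / q).
    by rewrite exprS; field; rewrite !gt_eqF.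
  apply: lerD => //; apply: ler_wpM2r; first exact: ltW.
  by rewrite ler_pdivrMr// mulrC.
have [r zr rmin] : exists2 r, z <= y * q ^+ r & y * q ^+ r <= q * z.
  have exr : exists r, z <= y * q ^+ r.
    have [r hr] := expr_unbounded (z / y) q1; exists r.
    by rewrite mulrC -ler_pdivrMr.
  exists (ex_minn exr); case: ex_minnP => // -[|r] hr hmin.
    by rewrite expr0 mulr1 (le_trans (ltW yz))// ler_peMl ?ltW//; lra.
  rewrite exprS mulrCA ler_pM2l// leNgt; apply/negP => h.
  by have := hmin r (ltW h); rewrite ltnn.
have [p wp pmin] : exists2 p, w <= y / q ^+ p & y / q ^+ p <= q * w.
  have exp : exists p, y / q ^+ p.+1 <= w.
    have [p hp] := expr_unbounded (y / w) q1; exists p.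
    have qp0 : 0 < q ^+ p by rewrite exprn_gt0.
    rewrite ler_pdivrMr ?exprn_gt0// exprS; rewrite ler_pdivrMr// in hp.
    apply: le_trans hp _; rewrite mulrC; apply: ler_wpM2l; first exact: ltW.
    by rewrite ler_peMl// ltW.
  exists (ex_minn exp); case: ex_minnP => p hp hmin.
    case: p hp hmin => [|p] hp hmin; first by rewrite expr0 divr1; lra.
    rewrite leNgt; apply/negP => h.
    by have := hmin p (ltW h); rewrite ltnn.
  rewrite -ler_pdivrMl//; apply: le_trans hp.
  rewrite exprS le_eqVlt; apply/orP; left; apply/eqP; field.
  by rewrite !gt_eqF// exprn_gt0.
have hB : B * (y - y / q) <= A * (q * z - y).
  apply: le_trans (le_trans (right r) _).
    by apply: ler_wpM2r; [exact: ltW|rewrite lerD2r ndF//; lra].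
  by apply: ler_wpM2l => //; rewrite lerD2r.
have hC : A * (y - q * w) <= C * (y - y / q).
  apply: le_trans (le_trans _ (left p)) _.
    by apply: ler_wpM2l => //; rewrite lerD2l lerN2.
  by apply: ler_wpM2r; [exact: ltW|rewrite lerD2l lerN2 ndF//; lra].
have : B * (y - q * w) <= C * (q * z - y).
  rewrite -(ler_pM2r D0) mulrAC.
  apply: (@le_trans _ _ (A * (q * z - y) * (y - q * w))).
    by apply: ler_wpM2r => //; lra.
  by rewrite mulrAC [leRHS]mulrAC; apply: ler_wpM2r => //; nra.
by rewrite qE; nra.
Qed.

Lemma kneser_three_slopes F w y z : nondecr_ge0 F -> kneser F ->
  0 <= w -> w < y -> y < z -> (F z - F y) * (y - w) <= (F y - F w) * (z - y).
Proof.
move=> ndF kF; rewrite le_eqVlt => /predU1P[<-|w0] wy yz; last first.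
  exact: kneser_three_slopes_pos.
rewrite -subr_le0 subr0; apply: (@le0_small _ (F z - F y) y) => //.
  by rewrite subr_ge0 ndF ?ltW.
move=> e /andP[e0 ey].
have := kneser_three_slopes_pos ndF kF e0 ey yz.
have : F 0 <= F e by rewrite ndF// ltW.
by nra.
Qed.

(** Linear in [F], hence it passes through sums over cells and through expectations. *)
Definition jensen_gap (I : finType) (p x : I -> R) F : R :=
  F (\sum_i p i * x i) - \sum_i p i * F (x i).

Lemma kneser_jensen (I : finType) (p x : I -> R) F :
  nondecr_ge0 F -> kneser F ->
  (forall i, 0 <= p i) -> \sum_i p i = 1 -> (forall i, 0 <= x i) ->
  0 <= jensen_gap p x F.
Proof.
move=> ndF kF p0 p1 x0; rewrite subr_ge0.
set y := \sum_i p i * x i.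
have y0 : 0 <= y by apply: sumr_ge0 => i _; rewrite mulr_ge0.
move: (y0); rewrite le_eqVlt => /predU1P[yE|{}y0].
  have /eqP := esym yE; rewrite psumr_eq0; last by move=> i _; rewrite mulr_ge0.
  move=> /allP px.
  rewrite (eq_bigr (fun i => p i * F y)); first by rewrite -mulr_suml p1 mul1r.
  move=> i _; have := px i; rewrite mem_index_enum => /(_ isT)/implyP/(_ isT).
  by rewrite mulf_eq0 => /orP[/eqP ->|/eqP ->]; rewrite ?mul0r// -yE.
(* Slope of a supporting line at [y]: the largest chord slope to the finitely many points on the
   right, or 0 if there are none. By the three slopes inequality it is below every slope on the
   left. *)
pose c := \big[Num.max/0]_(i | y < x i) ((F (x i) - F y) / (x i - y)).
have left_slope w : 0 <= w -> w < y -> c * (y - w) <= F y - F w.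
  move=> w0 wy; rewrite -ler_pdivlMr ?subr_gt0//.
  apply: bigmax_le => [|i yi].
    by rewrite divr_ge0// subr_ge0 ?ndF// ltW.
  rewrite ler_pdivrMr ?subr_gt0// mulrAC ler_pdivlMr ?subr_gt0//.
  exact: kneser_three_slopes.
have sup i : F (x i) <= F y + c * (x i - y).
  have [xy|yx|->] := ltgtP (x i) y.
  - by have := left_slope _ (x0 i) xy; lra.
  - rewrite -lerBlDl -ler_pdivrMr ?subr_gt0//.
    by apply: (@le_bigmax_cond _ _ _ 0 i (fun i => y < x i)  (fun i => (F (x i) - F y) / (x i - y))).
  - by rewrite subrr mulr0 addr0.
apply: (@le_trans _ _ (\sum_i p i * (F y + c * (x i - y)))).
  by apply: ler_sum => i _; apply: ler_wpM2l.
rewrite (eq_bigr (fun i => p i * (F y - c * y) + c * (p i * x i))); last first.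
  by move=> i _; move: (F y) (c) (y) => Fy c0 y1; ring.
by rewrite big_split/= -mulr_suml -mulr_sumr p1 -/y; lra.
Qed.

End geometric_concavity.

(** * Euclidean distance and homotheties *)

Section distance.
Context (R : realType).
Notation pt k := (k.-tuple (measurableTypeR R)).
Notation dst := (@dist2 R _).

Lemma dist2_ge0 k (x y : pt k) : 0 <= dst x y.
Proof. exact: sqrtr_ge0. Qed.

Lemma dist2C k (x y : pt k) : dst x y = dst y x.
Proof.
by rewrite /dist2; congr Num.sqrt; apply: eq_bigr => i _; rewrite -sqrrN opprB.
Qed.

Lemma dist2xx k (x : pt k) : dst x x = 0.
Proof. by rewrite /dist2 big1 ?sqrtr0// => i _; rewrite subrr expr0n. Qed.

Lemma cauchy_schwarz (I : finType) (a b : I -> R) :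
  (\sum_i a i * b i) ^+ 2 <= (\sum_i a i ^+ 2) * (\sum_i b i ^+ 2).
Proof.
rewrite -subr_ge0.
have -> : (\sum_i a i ^+ 2) * (\sum_i b i ^+ 2) - (\sum_i a i * b i) ^+ 2 =
  2^-1 * \sum_i \sum_j (a i * b j - a j * b i) ^+ 2.
  have -> : \sum_i \sum_j (a i * b j - a j * b i) ^+ 2 =
    \sum_i \sum_j (a i ^+ 2 * b j ^+ 2) + \sum_i \sum_j (b i ^+ 2 * a j ^+ 2)
     - 2 * \sum_i \sum_j ((a i * b i) * (a j * b j)).
    rewrite mulr_sumr -big_split -sumrB/=; apply: eq_bigr => i _.
    rewrite mulr_sumr -big_split -sumrB/=; apply: eq_bigr => j _; ring.
  have prod (f g : I -> R) : \sum_i \sum_j f i * g j = (\sum_i f i) * (\sum_j g j).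
    by rewrite mulr_suml; apply: eq_bigr => i _; rewrite mulr_sumr.
  by rewrite !prod; field.
by apply: mulr_ge0 => //; apply: sumr_ge0 => i _; apply: sumr_ge0 => j _; exact: sqr_ge0.
Qed.

Lemma sqrt_sum_triangle (I : finType) (a b : I -> R) :
  Num.sqrt (\sum_i (a i + b i) ^+ 2) <=
  Num.sqrt (\sum_i a i ^+ 2) + Num.sqrt (\sum_i b i ^+ 2).
Proof.
have s0 (c : I -> R) : 0 <= \sum_i c i ^+ 2 by apply: sumr_ge0 => i _; exact: sqr_ge0.
rewrite -[leRHS]ger0_norm ?addr_ge0 ?sqrtr_ge0// -sqrtr_sqr ler_sqrt ?sqr_ge0//.
rewrite sqrrD !sqr_sqrtr//.
have -> : \sum_i (a i + b i) ^+ 2 =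
   \sum_i a i ^+ 2 + (\sum_i a i * b i) *+ 2 + \sum_i b i ^+ 2.
  by rewrite -sumrMnl -!big_split/=; apply: eq_bigr => i _; rewrite sqrrD.
rewrite lerD2r lerD2l lerMn2r/= -sqrtrM//.
apply: le_trans (ler_norm _) _; rewrite -sqrtr_sqr.
by apply: ler_wsqrtr; exact: cauchy_schwarz.
Qed.

Lemma dist2_triangle k (y x z : pt k) : dst x z <= dst x y + dst y z.
Proof.
rewrite /dist2; apply: le_trans (sqrt_sum_triangle _ _).
by apply: ler_wsqrtr; apply: ler_sum => i _; rewrite subrKA.
Qed.

Lemma coord_le_dist2 k (x y : pt k) i : `|(tnth x i : R) - tnth y i| <= dst x y.
Proof.
rewrite -sqrtr_sqr; apply: ler_wsqrtr.
by rewrite (bigD1 i)//= lerDl; apply: sumr_ge0 => j _; exact: sqr_ge0.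
Qed.

Lemma dist2_le_coord k (x y : pt k) (e : R) : 0 <= e ->
  (forall i, `|(tnth x i : R) - tnth y i| <= e) -> dst x y <= k%:R * e.
Proof.
move=> e0 H; rewrite -[leRHS]ger0_norm ?mulr_ge0// -sqrtr_sqr; apply: ler_wsqrtr.
apply: (@le_trans _ _ (\sum_(i < k) e ^+ 2)).
  by apply: ler_sum => i _; rewrite -real_normK ?num_real// lerXn2r// nnegrE.
rewrite sumr_const card_ord exprMn -[leLHS]mulr_natl; apply: ler_wpM2r; first exact: sqr_ge0.
by case: k {x y H} => [|k]; rewrite ?expr0n// expr2 ler_peMl// ler1n.
Qed.

Lemma dist2_affine k (v : pt k) (l : R) x y : 0 <= l ->
  dst (affine v l x) (affine v l y) = l * dst x y.
Proof.
move=> l0; rewrite /dist2 -[X in _ = X * _](ger0_norm l0) -sqrtr_sqr -sqrtrM ?sqr_ge0//.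
congr Num.sqrt; rewrite mulr_sumr; apply: eq_bigr => i _.
by rewrite !tnth_mktuple -exprMn; congr (_ ^+ 2); ring.
Qed.

(** The homothety of centre [a] and ratio [l]. *)
Definition shrink k (a : pt k) (l : R) (x : pt k) : pt k :=
  affine [tuple (1 - l) * (tnth a i : R) | i < k] l x.

Lemma tnth_shrink k (a x : pt k) (l : R) i :
  tnth (shrink a l x) i = (1 - l) * (tnth a i : R) + l * (tnth x i : R).
Proof. by rewrite !tnth_mktuple. Qed.

Lemma shrink_center k (a : pt k) l : shrink a l a = a.
Proof. by apply: eq_from_tnth => i; rewrite tnth_shrink; ring. Qed.

Lemma dist2_shrink k (a x : pt k) (l : R) : 0 <= l ->
  dst (shrink a l x) a = l * dst x a.
Proof. by move=> l0; rewrite -{2}(shrink_center a l) dist2_affine. Qed.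

Lemma dist2_shrink_same k (a x : pt k) (l : R) : l <= 1 ->
  dst x (shrink a l x) = (1 - l) * dst x a.
Proof.
move=> l1; have l0 : 0 <= 1 - l by rewrite subr_ge0.
rewrite /dist2 -[X in _ = X * _](ger0_norm l0) -sqrtr_sqr -sqrtrM ?sqr_ge0//.
congr Num.sqrt; rewrite mulr_sumr; apply: eq_bigr => i _.
by rewrite tnth_shrink -exprMn; congr (_ ^+ 2); ring.
Qed.

Lemma incubeP k (x : pt k) : reflect (forall i, 0 <= (tnth x i : R) <= 1) (incube x).
Proof.
apply: (iffP all_tnthP) => H i; exact: H.
Qed.

Lemma incube_shrink k (a x : pt k) (l : R) : 0 <= l <= 1 ->
  incube a -> incube x -> incube (shrink a l x).
Proof.
move=> /andP[l0 l1] /incubeP ia /incubeP ix; apply/incubeP => i.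
rewrite tnth_shrink.
have /andP[a0 a1] := ia i; have /andP[x0 x1] := ix i.
by apply/andP; split; nra.
Qed.

Lemma measurable_dist2 d (T : measurableType d) k (f g : T -> pt k) :
  measurable_fun setT f -> measurable_fun setT g ->
  measurable_fun setT (fun w => dst (f w) (g w)).
Proof.
move=> mf mg.
have mc (h : T -> pt k) i : measurable_fun setT h ->
    measurable_fun setT (fun w => (tnth (h w) i : R)).
  by move=> mh; exact: (measurableT_comp (measurable_tnth i) mh).
rewrite (_ : (fun w => _) = fun w => (\sum_(i < k) (tnth (f w) i - tnth (g w) i : R) ^+ 2) `^ 2^-1).
  apply: (@measurableT_comp _ _ _ _ _ _ (fun x : R => x `^ 2^-1)).
    exact: measurable_powR.
  apply: measurable_sum => i; apply: measurable_funX.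
  by apply: measurable_funB; exact: mc.
apply/funext => w; rewrite powR12_sqrt//.
by apply: sumr_ge0 => i _; exact: sqr_ge0.
Qed.

End distance.

Section radius.
Context (R : realType) (n k : nat).
Hypothesis k0 : (0 < k)%N.
Hypothesis n0 : (0 < n)%N.

(** The service radius of range [x], so that a full ball has volume proportional to [x]. *)
Definition srad (x : R) : R := (x / n%:R) `^ k%:R^-1.

Lemma srad_ge0 x : 0 <= srad x. Proof. exact: powR_ge0. Qed.

Lemma le_srad x y : 0 <= x -> x <= y -> srad x <= srad y.
Proof.
move=> x0 xy; apply: ge0_ler_powR; rewrite ?nnegrE ?divr_ge0//; first exact: le_trans xy.
by rewrite ler_wpM2r.
Qed.

Lemma sradX x : 0 <= x -> srad x ^+ k = x / n%:R.
Proof.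
move=> x0; rewrite /srad -powR_mulrn ?powR_ge0// -powRrM mulVf ?pnatr_eq0 -?lt0n//.
by rewrite powRr1// divr_ge0.
Qed.

Lemma sradM t x : 0 <= t -> 0 <= x -> srad (t * x) = t `^ k%:R^-1 * srad x.
Proof. by move=> t0 x0; rewrite /srad -mulrA powRM// divr_ge0. Qed.

End radius.
Arguments srad {R} n k x.

(** * Volumes of star-shaped sets and of balls *)

Section star_volume.
Context (R : realType) (n k : nat).
Hypothesis k0 : (0 < k)%N.
Hypothesis n0 : (0 < n)%N.
Notation pt := (k.-tuple (measurableTypeR R)).
Notation dst := (@dist2 R k).
Notation P := (uniform_cube R k).

Definition starvol (a : pt) (W : pt -> bool) (x : R) : R :=
  Ex P (fun u => (W u && (dst u a <= srad n k x))%:R).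

Lemma measurable_ball_cond (a : pt) c : measurable_fun setT (fun u : pt => dst u a <= c).
Proof.
apply: measurable_fun_ler; last exact: measurable_cst.
by apply: measurable_dist2; [exact: measurable_id|exact: measurable_cst].
Qed.

Lemma starvol_nondecr (a : pt) (W : pt -> bool) : measurable_fun setT W -> nondecr_ge0 (starvol a W).
Proof.
move=> mW x y x0 xy; apply: le_Ex.
- by apply: bmfun_bool; apply: measurable_and => //; exact: measurable_ball_cond.
- by apply: bmfun_bool; apply: measurable_and => //; exact: measurable_ball_cond.
move=> u; rewrite ler_nat; case: (W u) => //=.
by have := le_srad n k x0 xy; case: (lerP (dst u a) (srad n k x)) => // h1 h2; rewrite (le_trans h1 h2).
Qed.

(* The homothety of ratio t^(-1/k) centred at [a] maps the shell of radii
   ]srad (t x), srad (t y)] of the star-shaped set into the shell ]srad x, srad y]. *)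
Lemma starvol_kneser (a : pt) (W : pt -> bool) : measurable_fun setT W -> incube a ->
  (forall u (l : R), 0 < l <= 1 -> W u -> W (shrink a l u)) -> kneser (starvol a W).
Proof.
move=> mW ia sW t x y t1 x0 xy.
have t0 : 0 < t by rewrite (lt_le_trans ltr01).
have y0 : 0 <= y by exact: le_trans xy.
pose s := t `^ k%:R^-1.
have s0 : 0 < s by rewrite /s powR_gt0.
have s1 : 1 <= s.
  rewrite /s -[leLHS](powRr0 t); apply: ler_powR => //.
pose l := s^-1.
have l0 : 0 < l by rewrite invr_gt0.
have l1 : l <= 1 by rewrite invf_le1.
have sk : s ^+ k = t.
  rewrite /s -powR_mulrn ?powR_ge0// -powRrM mulVf ?pnatr_eq0 -?lt0n//.
  by rewrite powRr1// ltW.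
have bW z : bmfun (fun u => (W u && (dst u a <= srad n k z))%:R : R).
  by apply: bmfun_bool; apply: measurable_and => //; exact: measurable_ball_cond.
pose shell z w u : R := (W u && ((srad n k z < dst u a) && (dst u a <= srad n k w)))%:R.
have bshell z w : bmfun (shell z w).
  apply: bmfun_bool; apply: measurable_and => //; apply: measurable_and.
    apply: measurable_fun_ltr; first exact: measurable_cst.
    by apply: measurable_dist2; [exact: measurable_id|exact: measurable_cst].
  exact: measurable_ball_cond.
have shellE z w : 0 <= z -> z <= w -> starvol a W w - starvol a W z = Ex P (shell z w).
  move=> z0 zw; rewrite -ExB//; apply: eq_Ex => u; rewrite /shell.
  have := le_srad n k z0 zw; case: (W u) => /=; last by rewrite subrr.
  case: (lerP (dst u a) (srad n k z)) => h1 h2; last by rewrite subr0.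
  by rewrite (le_trans h1 h2) subrr.
rewrite !shellE//; last 2 first.
- by rewrite mulr_ge0// ltW.
- by rewrite ler_wpM2l// ltW.
have := @affine_cube_le R k [tuple (1 - l) * (tnth a i : R) | i < k] l (shell x y) l0 (bshell _ _).
move=> /(_ (fun=> ler0n _ _)).
rewrite -/(shrink a l) exprVn sk ler_pdivrMl//; apply: le_trans.
apply: (le_Ex_as (C := @incube R k)) => //.
- exact: measurable_incube.
- exact: Ex_incube.
- apply: bmfunM; first exact: (bmfun_comp (bshell x y) (measurable_affinek _ _)).
  exact: bmfun_bool (measurableT_comp (@measurable_incube R k) (measurable_affinek _ _)).
move=> u iu; rewrite (incube_shrink _ ia iu); last by rewrite (ltW l0).
rewrite mulr1 /shell ler_nat dist2_shrink; last exact: ltW.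
case: (boolP (W u)) => //= Wu; rewrite sW ?l0//=.
rewrite !sradM ?(ltW t0)// -/s /l.
rewrite [s^-1 * _]mulrC ltr_pdivlMr// ler_pdivrMr// ![_ * s]mulrC.
by [].
Qed.

End star_volume.

Lemma tie_split (R : realDomainType) (x y c : R) :
  ((x <= y) && (y <= c))%:R + ((y <= x) && (x <= c))%:R =
  (x <= c)%R%:R * (y <= c)%R%:R + ((x == y) && (y <= c))%:R :> R.
Proof.
have [xy|yx|->] := ltgtP x y; last by case: (y <= c); rewrite ?mulr1 ?mulr0.
  case: (leP y c) => yc; last by rewrite mulr0 !addr0.
  by rewrite (ltW (lt_le_trans xy yc)) mulr1.
case: (leP x c) => xc; last by rewrite mul0r !addr0.
by rewrite (ltW (lt_le_trans yx xc)) mulr1 add0r addr0.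
Qed.

Section ball_volume.
Context (R : realType) (k : nat).
Hypothesis k0 : (0 < k)%N.
Notation pt := (k.-tuple (measurableTypeR R)).
Notation dst := (@dist2 R k).
Notation P := (uniform_cube R k).

Implicit Types (a b u : pt) (c e : R).

Definition ballvol (a : pt) (c : R) : R := Ex P (fun u => (dst u a <= c)%R%:R).

Definition center : pt := [tuple 2^-1 : R | i < k].

(* The volume of a ball of radius 1 in R^k. *)
Definition unitball : R := 2 ^+ k * ballvol center 2^-1.

Let bb a c : bmfun (fun u : pt => (dst u a <= c)%R%:R : R).
Proof. by apply: bmfun_bool; exact: measurable_ball_cond. Qed.

Lemma le_ballvol a c c' : c <= c' -> ballvol a c <= ballvol a c'.
Proof.
move=> cc; apply: le_Ex => // u; rewrite ler_nat.
by case: (lerP (dst u a) c) => // h; rewrite (le_trans h cc).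
Qed.

Lemma ballvol_ge0 a c : 0 <= ballvol a c.
Proof. by apply: Ex_ge0. Qed.

Lemma ballvol_ub a c : 0 < c -> ballvol a c <= (2 * c) ^+ k.
Proof.
move=> c0; have c20 : 0 < 2 * c by lra.
(* The map of ratio [l] and translation [v] sends the cube of side 2c circumscribed about the ball
   onto the unit cube. *)
pose l := (2 * c)^-1; have l0 : 0 < l by rewrite invr_gt0.
pose v : pt := [tuple - l * ((tnth a i : R) - c) | i < k].
have := @affine_cube_le R k v l (fun=> 1) l0 (bmfun_cst _ 1) (fun=> ler01).
rewrite Ex_cst exprVn ler_pdivrMl ?exprn_gt0// mulr1; apply: le_trans.
apply: le_Ex => //.
  apply: bmfunM; first exact: bmfun_cst.
  exact: bmfun_bool (measurableT_comp (@measurable_incube R k) (measurable_affinek _ _)).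
move=> u; rewrite mul1r ler_nat; case: (lerP (dst u a) c) => // ua.
suff -> : incube (affine v l u) by [].
apply/incubeP => i; rewrite !tnth_mktuple.
have := le_trans (coord_le_dist2 u a i) ua; rewrite ler_norml => /andP[h1 h2].
have -> : - l * (tnth a i - c) + l * tnth u i = (tnth u i - tnth a i + c) / (2 * c).
  by rewrite /l; field; rewrite gt_eqF.
by rewrite divr_ge0 ?ler_pdivrMr//; lra.
Qed.

Lemma ballvol_le_scale a b c c' : 0 < c -> 0 < c' ->
  (forall i, c' <= (tnth b i : R) <= 1 - c') ->
  (c' / c) ^+ k * ballvol a c <= ballvol b c'.
Proof.
move=> c0 c'0 bi; pose l := c' / c.
have l0 : 0 < l by rewrite divr_gt0.
pose v : pt := [tuple (tnth b i : R) - l * (tnth a i : R) | i < k].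
have va : affine v l a = b.
  by apply: eq_from_tnth => i; rewrite !tnth_mktuple subrK.
have := @affine_cube_le R k v l _ l0 (bb b c') (fun=> ler0n _ _).
apply: le_trans; apply: ler_wpM2l; first by rewrite exprn_ge0// ltW.
apply: le_Ex => //.
  apply: bmfunM; first exact: (bmfun_comp (bb b c') (measurable_affinek _ _)).
  exact: bmfun_bool (measurableT_comp (@measurable_incube R k) (measurable_affinek _ _)).
move=> u; rewrite -natrM ler_nat; case: (lerP (dst u a) c) => // ua.
have ub : dst (affine v l u) b <= c'.
  rewrite -{1}va dist2_affine; last exact: ltW.
  by rewrite [leRHS](_ : _ = l * c) ?ler_wpM2l ?(ltW l0)// /l divfK// gt_eqF.
rewrite ub; suff -> : incube (affine v l u) by [].
apply/incubeP => i; have := le_trans (coord_le_dist2 (affine v l u) b i) ub.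
by rewrite ler_norml => /andP[h1 h2]; have /andP[h3 h4] := bi i; lra.
Qed.

(** Scaling to and from the ball inscribed in the cube gives the two inequalities. *)
Lemma ballvol_inside a c : 0 <= c ->
  (forall i, c <= (tnth a i : R) <= 1 - c) ->
  ballvol a c = unitball * c ^+ k.
Proof.
rewrite le_eqVlt => /predU1P[<- _|c0 ai].
  rewrite expr0n -[k == 0%N]negbK -lt0n k0 mulr0; apply/eqP.
  rewrite eq_le ballvol_ge0 andbT.
  apply: (@le0_small _ _ 2 2^-1) => // e /andP[e0 e1].
  apply: le_trans (le_ballvol a (ltW e0)) _; apply: le_trans (ballvol_ub a e0) _.
  rewrite mulrC -{2}[e * 2]expr1 ler_wiXn2l//; lra.
apply/eqP; rewrite eq_le; apply/andP; split.
  have ci i : 2^-1 <= (tnth center i : R) <= 1 - 2^-1 by rewrite tnth_mktuple; lra.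
  have := @ballvol_le_scale a center c 2^-1 c0; rewrite invr_gt0 ltr0n => /(_ isT ci).
  rewrite /unitball => h.
  have -> : 2 ^+ k * ballvol center 2^-1 * c ^+ k = (2 * c) ^+ k * ballvol center 2^-1.
    by rewrite exprMn; ring.
  rewrite -ler_pdivrMl ?exprn_gt0 ?mulr_gt0//; apply: le_trans h.
  by rewrite -exprVn invfM.
have := @ballvol_le_scale center a 2^-1 c; rewrite invr_gt0 ltr0n => /(_ isT c0 ai).
apply: le_trans; rewrite /unitball invrK exprMn le_eqVlt; apply/orP; left; apply/eqP; ring.
Qed.

Lemma unitball_gt0 : 0 < unitball.
Proof.
apply: mulr_gt0; first by rewrite exprn_gt0.
have kR0 : 0 < k%:R :> R by rewrite ltr0n.
(* The concentric cube of side 1/k lies in the inscribed ball, since the distance is at most k times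
   the largest coordinate difference. *)
pose l : R := k%:R^-1; have l0 : 0 < l by rewrite invr_gt0.
have l1 : l <= 1 by rewrite invf_le1// ler1n.
pose v : pt := [tuple 2^-1 - l / 2 | i < k].
have := @affine_cube_le R k v l _ l0 (bb center 2^-1) (fun=> ler0n _ _).
apply: lt_le_trans; apply: mulr_gt0; first by rewrite exprn_gt0.
rewrite (_ : Ex _ _ = 1) //; apply/eqP; rewrite eq_le; apply/andP; split.
  rewrite -[leRHS](Ex_cst P); apply: le_Ex => //; last 2 first.
  - exact: bmfun_cst.
  - by move=> u; rewrite -natrM mulnb lern1 leq_b1.
  apply: bmfunM; first exact: (bmfun_comp (bb center 2^-1) (measurable_affinek _ _)).
  exact: bmfun_bool (measurableT_comp (@measurable_incube R k) (measurable_affinek _ _)).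
rewrite -[leLHS](Ex_incube R k).
apply: (le_Ex_as (C := @incube R k)) => //.
- exact: measurable_incube.
- exact: Ex_incube.
- by apply: bmfun_bool; exact: measurable_incube.
- apply: bmfunM; first exact: (bmfun_comp (bb center 2^-1) (measurable_affinek _ _)).
  exact: bmfun_bool (measurableT_comp (@measurable_incube R k) (measurable_affinek _ _)).
move=> u /[dup] iu /incubeP ui; rewrite iu -natrM ler_nat.
have -> : incube (affine v l u).
  by apply/incubeP => i; rewrite !tnth_mktuple; have := ui i; nra.
have -> // : dst (affine v l u) center <= 2^-1.
have -> : 2^-1 = k%:R * (l / 2) by rewrite /l; field; rewrite gt_eqF.
apply: dist2_le_coord; first by rewrite divr_ge0// ltW.
by move=> i; rewrite !tnth_mktuple ler_norml; have := ui i; nra.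
Qed.

Lemma unitball_ge0 : 0 <= unitball. Proof. exact: ltW unitball_gt0. Qed.

(** The shell between radii (1 - e) c and c has volume at most of order e, by Bernoulli's
    inequality. This disposes of ties when two points exchange roles. *)
Lemma sphere_null a c : 0 <= c -> (forall i, c <= (tnth a i : R) <= 1 - c) ->
  Ex P (fun u => (dst u a == c)%R%:R) = 0.
Proof.
move=> c0 ai; apply/eqP; rewrite eq_le Ex_ge0 ?andbT//.
have me : measurable_fun setT (fun u : pt => dst u a == c).
  apply: measurable_fun_eqr; last exact: measurable_cst.
  by apply: measurable_dist2; [exact: measurable_id|exact: measurable_cst].
have [cE|cn0] := eqVneq c 0; last have {cn0} c_gt0 : 0 < c by rewrite lt_neqAle eq_sym cn0.
  have -> : 0 = ballvol a c by rewrite ballvol_inside// cE expr0n -[k == 0%N]negbK -lt0n k0 mulr0.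
  by apply: le_Ex => //; [exact: bmfun_bool|move=> u; rewrite ler_nat; case: eqP => // ->; rewrite lexx].
apply: (@le0_small _ _ (unitball * c ^+ k * k%:R) 1) => //.
  by do 2 apply: mulr_ge0 => //; [exact: unitball_ge0|exact: exprn_ge0].
move=> e /andP[e0 e1].
apply: (@le_trans _ _ (ballvol a c - ballvol a ((1 - e) * c))).
  rewrite -ExB//; apply: le_Ex => //.
  - exact: bmfun_bool.
  - exact: bmfunB.
  move=> u; have [->|uc] := eqVneq (dst u a) c.
    by rewrite lexx lerBrDl gerDr lern0 eqb0 -ltNge gtr_pMl//; lra.
  rewrite subr_ge0 ler_nat; case: (lerP (dst u a) ((1 - e) * c)) => // h.
  by rewrite (le_trans h)// ler_piMl; [|exact: ltW|lra].
rewrite [X in X - _]ballvol_inside// ballvol_inside; last 2 first.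
- by nra.
- by move=> i; have := ai i; nra.
rewrite exprMn; suff : 1 - e * k%:R <= (1 - e) ^+ k.
  have : 0 <= unitball * c ^+ k by apply: mulr_ge0; [exact: unitball_ge0|exact: exprn_ge0].
  by move: (unitball) (c ^+ k) ((1 - e) ^+ k) => A B D; nra.
elim: (k) => [|j IH]; first by rewrite mulr0 subr0 expr0.
rewrite exprS; apply: le_trans (_ : _ <= (1 - e) * (1 - e * j%:R)) _.
  by rewrite -natr1; have : 0 <= j%:R :> R by []; nra.
by apply: ler_wpM2l => //; lra.
Qed.

(* Exchanging two independent uniform points: P(|b-a| <= |u-a| <= c) is half of
   the probability that both lie in the ball. *)
Lemma Ex_nearer (a : pt) c : 0 <= c -> c <= 8^-1 ->
  (forall i, 4^-1 <= (tnth a i : R) <= 3 / 4) ->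
  Ex P (fun u => Ex P (fun b => ((dst u b <= dst u a) && (dst u a <= c))%:R)) =
  (unitball * c ^+ k) ^+ 2 / 2.
Proof.
move=> c0 c8 ai.
have [S SE] : exists S, S = Ex P (fun u => Ex P (fun b => ((dst b a <= dst u a) && (dst u a <= c))%:R)).
  by eexists.
have d1 : measurable_fun setT (fun z : pt * pt => dst z.1 a).
  by apply: measurable_dist2; [exact: measurable_fst|exact: measurable_cst].
have d2 : measurable_fun setT (fun z : pt * pt => dst z.2 a).
  by apply: measurable_dist2; [exact: measurable_snd|exact: measurable_cst].
have mc : measurable_fun setT (fun z : pt * pt => c) by exact: measurable_cst.
have near i x c' : c' <= 8^-1 -> dst x a <= 8^-1 -> c' <= (tnth x i : R) <= 1 - c'.
  move=> hc' hx; have := le_trans (coord_le_dist2 x a i) hx.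
  by rewrite ler_norml; have := ai i; lra.
have aa : dst a a <= 8^-1.
  by rewrite dist2xx; lra.
(* For fixed [u], the balls of radius |u - a| about [u] and about [a] both lie in the cube and have
   equal volume, so the distance of [b] can be measured from [a] instead of [u]. *)
transitivity S.
  rewrite SE; apply: eq_Ex => u; case: (lerP (dst u a) c) => ua; last first.
    by under eq_Ex do rewrite andbF; under [RHS]eq_Ex do rewrite andbF.
  under eq_Ex do rewrite andbT dist2C; under [RHS]eq_Ex do rewrite andbT.
  have u8 : dst u a <= 8^-1 by exact: (le_trans ua c8).
  rewrite -!/(ballvol _ _) !ballvol_inside ?dist2_ge0// => i.
    exact: (near i a _ u8 aa).
  exact: (near i u _ u8 u8).
have bm1 : bmfun (fun z : pt * pt => ((dst z.2 a <= dst z.1 a) && (dst z.1 a <= c))%:R : R).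
  by apply: bmfun_bool; apply: measurable_and; exact: measurable_fun_ler.
have S2 : S = Ex P (fun u => Ex P (fun b => ((dst u a <= dst b a) && (dst b a <= c))%:R)).
  rewrite SE.
  exact: (@Ex_swap _ _ _ _ _ P P
    (fun u b : pt => ((dst b a <= dst u a) && (dst u a <= c))%:R) bm1).
have tie : Ex P (fun u => Ex P (fun b => ((dst b a == dst u a) && (dst u a <= c))%:R)) = 0.
  rewrite -[RHS](Ex_cst P); apply: eq_Ex => u.
  case: (lerP (dst u a) c) => ua; last first.
    by rewrite -[RHS](Ex_cst P); apply: eq_Ex => b; rewrite andbF.
  under eq_Ex do rewrite andbT.
  apply: sphere_null; first exact: dist2_ge0.
  move=> i; exact: (near i a (dst u a) (le_trans ua c8) aa).
have bm2 : bmfun (fun z : pt * pt => ((dst z.1 a <= dst z.2 a) && (dst z.2 a <= c))%:R : R).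
  by apply: bmfun_bool; apply: measurable_and; exact: measurable_fun_ler.
have bm3 : bmfun (fun z : pt * pt => ((dst z.2 a == dst z.1 a) && (dst z.1 a <= c))%:R : R).
  by apply: bmfun_bool; apply: measurable_and; [exact: measurable_fun_eqr|exact: measurable_fun_ler].
have SS : S + S = unitball * c ^+ k * (unitball * c ^+ k).
  have VE : ballvol a c = unitball * c ^+ k.
    exact: (ballvol_inside c0 (fun i => near i a c c8 aa)).
  have b1 u : bmfun (fun b => ((dst b a <= dst u a) && (dst u a <= c))%:R : R).
    by apply: bmfun_bool; apply: measurable_and; [exact: measurable_ball_cond|exact: measurable_cst].
  have b2 u : bmfun (fun b => ((dst u a <= dst b a) && (dst b a <= c))%:R : R).
    apply: bmfun_bool; apply: measurable_and; last exact: measurable_ball_cond.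
    apply: measurable_fun_ler; first exact: measurable_cst.
    by apply: measurable_dist2; [exact: measurable_id|exact: measurable_cst].
  have b3 u : bmfun (fun b => ((dst b a == dst u a) && (dst u a <= c))%:R : R).
    apply: bmfun_bool; apply: measurable_and; last exact: measurable_cst.
    apply: measurable_fun_eqr; last exact: measurable_cst.
    by apply: measurable_dist2; [exact: measurable_id|exact: measurable_cst].
  have VV : Ex P (fun u => ballvol a c * (dst u a <= c)%R%:R) = ballvol a c * ballvol a c.
    by rewrite ExZ.
  rewrite -VE -VV -[RHS]addr0 -tie {1}SE S2.
  rewrite -ExD; [|exact: (bmfun_Ex P P bm1)|exact: (bmfun_Ex P P bm2)].
  rewrite -ExD; [|by apply: bmfunM => //; exact: bmfun_cst|exact: (bmfun_Ex P P bm3)].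
  apply: eq_Ex => u; rewrite mulrC -ExZ; last exact: bb.
  rewrite -ExD; [|exact: b1|exact: b2].
  rewrite -ExD; [|by apply: bmfunM; [exact: bmfun_cst|exact: bb]|exact: b3].
  apply: eq_Ex => b.
  by rewrite tie_split [X in X + _]mulrC.
by move: SS; move: (unitball * c ^+ k) => A; rewrite expr2 => <-; field.
Qed.

End ball_volume.

(** * The mean matching number *)

Lemma bmfun_boolP d (T : measurableType d) (R : realType) (b : T -> bool) :
  bmfun (fun x => (b x)%:R : R) -> measurable_fun setT b.
Proof.
move=> [mb _]; rewrite (_ : b = fun x => (b x)%:R == 1 :> R).
  by apply: measurable_fun_eqr => //; exact: measurable_cst.
by apply/funext => x; case: (b x); rewrite ?eqxx// eq_sym oner_eq0.
Qed.

Lemma measurable_finbool d (T : measurableType d) (R : realType) (I : finType)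
    (b : I -> T -> bool) (F : {ffun I -> bool} -> bool) :
  (forall i, measurable_fun setT (b i)) ->
  measurable_fun setT (fun x => F [ffun i => b i x]).
Proof.
move=> mb; apply: (@bmfun_boolP _ _ R).
exact: (@bmfun_finbool _ _ R I b (fun f => (F f)%:R)).
Qed.

Section locations.
Context (R : realType) (k n m : nat).
Notation pt := (k.-tuple (measurableTypeR R)).
Notation dst := (@dist2 R k).
Notation P := (uniform_cube R k).
Notation loc := ((n.-tuple pt) * (m.-tuple pt))%type.
Notation LP := (location_prob R k n m).
Implicit Types (r : n.-tuple R) (z : loc) (Z : {set 'I_n}) (i : 'I_n) (j : 'I_m) (u : pt) (x : R).

Definition upds z i u : loc := (upd z.1 i u, z.2).
Definition updd z j u : loc := (z.1, upd z.2 j u).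

Lemma measurable_upds d (T : measurableType d) (f : T -> loc) i (g : T -> pt) :
  measurable_fun setT f -> measurable_fun setT g ->
  measurable_fun setT (fun w => upds (f w) i (g w)).
Proof.
move=> mf mg; apply: measurable_fun_pair.
  by apply: measurable_fun_upd => //; exact: (measurableT_comp measurable_fst mf).
exact: (measurableT_comp measurable_snd mf).
Qed.

Lemma measurable_updd d (T : measurableType d) (f : T -> loc) j (g : T -> pt) :
  measurable_fun setT f -> measurable_fun setT g ->
  measurable_fun setT (fun w => updd (f w) j (g w)).
Proof.
move=> mf mg; apply: measurable_fun_pair.
  exact: (measurableT_comp measurable_fst mf).
by apply: measurable_fun_upd => //; exact: (measurableT_comp measurable_snd mf).
Qed.

Lemma bmfun_upds (f : loc -> R) i : bmfun f -> bmfun (fun zu : loc * pt => f (upds zu.1 i zu.2)).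
Proof.
by move=> bf; apply: (bmfun_comp bf); exact: measurable_upds.
Qed.

Lemma bmfun_updd (f : loc -> R) j : bmfun f -> bmfun (fun zu : loc * pt => f (updd zu.1 j zu.2)).
Proof.
by move=> bf; apply: (bmfun_comp bf); exact: measurable_updd.
Qed.

Lemma Ex_resample_s i (f : loc -> R) : bmfun f ->
  Ex LP f = Ex LP (fun z => Ex P (fun u => f (upds z i u))).
Proof.
move=> bf.
have bx := bmfun_Ex LP P (bmfun_upds i bf).
rewrite [LHS]Ex_prod// [RHS]Ex_prod//=.
have bs : bmfun (fun s => Ex (iid_prob P m) (fun d => f (s, d))).
  exact: (bmfun_Ex (iid_prob P n) (iid_prob P m) bf).
rewrite (Ex_resample P i)//; apply: eq_Ex => s.
rewrite [LHS]Ex_swap//; apply: (bmfun_comp bf).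
apply: measurable_fun_pair => //.
by apply: measurable_fun_upd => //; exact: measurable_cst.
Qed.

Lemma Ex_resample_d j (f : loc -> R) : bmfun f ->
  Ex LP f = Ex LP (fun z => Ex P (fun u => f (updd z j u))).
Proof.
move=> bf.
have bx := bmfun_Ex LP P (bmfun_updd j bf).
rewrite [LHS]Ex_prod// [RHS]Ex_prod//=; apply: eq_Ex => s.
rewrite (Ex_resample P j)//.
by apply: (bmfun_comp bf); exact: measurable_pair1.
Qed.

Lemma measurable_sup i : measurable_fun setT (fun z : loc => tnth z.1 i).
Proof. exact: (measurableT_comp (measurable_tnth i) measurable_fst). Qed.

Lemma measurable_dem j : measurable_fun setT (fun z : loc => tnth z.2 j).
Proof. exact: (measurableT_comp (measurable_tnth j) measurable_snd). Qed.

Lemma bmfun_graph d (T : measurableType d) r (f : T -> loc)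
    (F : ('I_n -> 'I_m -> bool) -> R) : measurable_fun setT f ->
  bmfun (fun w => F (service_graph r (f w).1 (f w).2)).
Proof.
move=> mf.
pose b (e : 'I_n * 'I_m) (w : T) := service_graph r (f w).1 (f w).2 e.1 e.2.
rewrite (_ : (fun w => _) =
   fun w => F (fun i j => [ffun e => b e w] (i, j))); last first.
  by apply/funext => w; congr F; apply/funext => i; apply/funext => j; rewrite ffunE.
apply: (@bmfun_finbool _ _ R _ b (fun h => F (fun i j => h (i, j)))) => e.
apply: measurable_fun_ler; last exact: measurable_cst.
apply: measurable_dist2.
  exact: (measurableT_comp (measurable_sup e.1) mf).
exact: (measurableT_comp (measurable_dem e.2) mf).
Qed.

Definition freed (Z : {set 'I_n}) r z : {set 'I_m} :=
  avail (without Z (service_graph r z.1 z.2)).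

Lemma bmfun_freed d (T : measurableType d) Z r (f : T -> loc)
    (F : {set 'I_m} -> T -> R) : measurable_fun setT f ->
  (forall A, bmfun (F A)) -> bmfun (fun w => F (freed Z r (f w)) w).
Proof.
move=> mf bF.
rewrite (_ : (fun w => _) =
   fun w => \sum_(A : {set 'I_m}) (freed Z r (f w) == A)%:R * F A w).
  apply: bmfun_sum => A; apply: bmfunM => //.
  exact: (@bmfun_graph _ _ r f (fun G => (avail (without Z G) == A)%:R)).
apply/funext => w; rewrite (bigD1 (freed Z r (f w)))//= eqxx mul1r big1 ?addr0//.
by move=> A; rewrite eq_sym => /negbTE ->; rewrite mul0r.
Qed.

Lemma freed_upds Z r z i u : i \in Z -> freed Z r (upds z i u) = freed Z r z.
Proof.
move=> iZ; apply: eq_avail => a b; rewrite /without /service_graph /=.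
case: (boolP (a \in Z)) => //= aZ; rewrite tnth_upd.
by case: eqP => // ai; rewrite ai iZ in aZ.
Qed.

Definition covers (A : {set 'I_m}) (d : m.-tuple pt) (x : R) (u : pt) : bool :=
  [exists j in A, dst u (tnth d j) <= srad n k x].

Lemma measurable_covers d (T : measurableType d) A x (f : T -> m.-tuple pt) (g : T -> pt) :
  measurable_fun setT f -> measurable_fun setT g ->
  measurable_fun setT (fun w => covers A (f w) x (g w)).
Proof.
move=> mf mg.
pose b (j : 'I_m) (w : T) := dst (g w) (tnth (f w) j) <= srad n k x.
rewrite (_ : (fun w => _) = fun w => [exists j in A, [ffun j => b j w] j]).
  apply: (@measurable_finbool _ _ R _ b (fun h => [exists j in A, h j])) => j.
  apply: measurable_fun_ler; last exact: measurable_cst.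
  apply: measurable_dist2 => //.
  exact: (measurableT_comp (measurable_tnth j) mf).
by apply/funext => w; apply: eq_existsb => j; rewrite ffunE.
Qed.

(* The probability that a new supply point of range [x] meets a demand which
   some maximum matching of the graph without [Z] leaves free. *)
Definition gain Z r (x : R) : R :=
  Ex LP (fun z => Ex P (fun u => (covers (freed Z r z) z.2 x u)%:R)).

Lemma bmfun_covers_freed Z r x :
  bmfun (fun w : loc * pt => (covers (freed Z r w.1) w.1.2 x w.2)%:R : R).
Proof.
apply: (@bmfun_freed _ _ Z r fst (fun A w => (covers A w.1.2 x w.2)%:R)) => // A.
apply: bmfun_bool; apply: measurable_covers => //.
exact: (measurableT_comp measurable_snd measurable_fst).
Qed.

Lemma bmfun_reaches Z r i :
  bmfun (fun z => (reaches Z (service_graph r z.1 z.2) i)%:R : R).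
Proof.
exact: (@bmfun_graph _ _ r id (fun G => (reaches Z G i)%:R)).
Qed.

(** The free demands depend neither on the position nor on the range of a supply in [Z], so its
    position may be redrawn with these demands fixed. *)
Lemma Ex_reaches Z r i : i \in Z ->
  Ex LP (fun z => (reaches Z (service_graph r z.1 z.2) i)%:R) = gain Z r (tnth r i).
Proof.
move=> iZ; rewrite (Ex_resample_s i); last exact: bmfun_reaches.
apply: eq_Ex => z; apply: eq_Ex => u; congr (nat_of_bool _)%:R.
have := freed_upds r z u iZ; rewrite /freed => E.
rewrite /reaches E /covers; apply: eq_existsb => j.
by rewrite /service_graph /= tnth_upd eqxx.
Qed.

Lemma bmfun_matching r :
  bmfun (fun z => (matching_number (service_graph r z.1 z.2))%:R : R).
Proof. exact: (@bmfun_graph _ _ r id (fun G => (matching_number G)%:R)). Qed.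

Definition mu r : R := Ex LP (fun z => (matching_number (service_graph r z.1 z.2))%:R).

Lemma mean_matchingE r : mean_matching k m r = (mu r)%:E.
Proof.
rewrite /mean_matching /mu EFin_Ex; last exact: bmfun_matching.
by rewrite unlock.
Qed.

Lemma mu_perm r (s : {perm 'I_n}) : mu (tperm_tuple r s) = mu r.
Proof.
rewrite /mu !(Ex_prod _ _ (bmfun_matching _)).
rewrite -[LHS](Ex_iid_perm (T := pt) P s); last first.
  exact: (bmfun_Ex (iid_prob P n) (iid_prob P m) (bmfun_matching (tperm_tuple r s))).
apply: eq_Ex => x; apply: eq_Ex => y; congr (_%:R).
rewrite -[RHS](matching_number_perm _ s); apply: eq_matching_number => i j.
by rewrite /service_graph /= !tnth_mktuple.
Qed.

Definition base Z r : R :=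
  Ex LP (fun z => (matching_number (without Z (service_graph r z.1 z.2)))%:R).

Lemma bmfun_base Z r :
  bmfun (fun z => (matching_number (without Z (service_graph r z.1 z.2)))%:R : R).
Proof. exact: (@bmfun_graph _ _ r id (fun G => (matching_number (without Z G))%:R)). Qed.

Lemma mu_single r i : mu r = base [set i]%SET r + gain [set i]%SET r (tnth r i).
Proof.
rewrite -Ex_reaches; last by rewrite finset.inE.
rewrite /mu /base -ExD; [|exact: bmfun_base|exact: bmfun_reaches].
by apply: eq_Ex => z; rewrite (matching_number_without1 _ i) natrD.
Qed.

Lemma without_graph_upd Z r i x z : i \in Z ->
  without Z (service_graph (upd r i x) z.1 z.2) = without Z (service_graph r z.1 z.2).
Proof.
move=> iZ; apply/funext => a; apply/funext => b; rewrite /without /service_graph.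
case: (boolP (a \in Z)) => //= aZ; rewrite tnth_upd.
by case: eqP => // ai; rewrite ai iZ in aZ.
Qed.

Lemma base_upd Z r i x : i \in Z -> base Z (upd r i x) = base Z r.
Proof. by move=> iZ; apply: eq_Ex => z; rewrite without_graph_upd. Qed.

Lemma gain_upd Z r i x : i \in Z -> gain Z (upd r i x) = gain Z r.
Proof.
move=> iZ; apply/funext => y; apply: eq_Ex => z; apply: eq_Ex => u.
by rewrite /freed without_graph_upd.
Qed.

Lemma mu_upd r i x : mu (upd r i x) = base [set i]%SET r + gain [set i]%SET r x.
Proof.
have iZ : i \in [set i]%SET by rewrite finset.set11.
by rewrite (mu_single (upd r i x) i) (base_upd r x iZ) (gain_upd r x iZ) tnth_upd eqxx.
Qed.

End locations.

(** * Strong concavity of the gain *)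

Section jensen_gap_theory.
Context (R : realType) (I : finType) (p x : I -> R).
Implicit Types F G : R -> R.

Lemma jensen_gap_sum (J : Type) (s : seq J) (q : pred J) (F : J -> R -> R) :
  jensen_gap p x (fun y => \sum_(j <- s | q j) F j y) =
  \sum_(j <- s | q j) jensen_gap p x (F j).
Proof.
rewrite /jensen_gap sumrB; congr (_ - _).
by rewrite exchange_big; apply: eq_bigr => i _; rewrite mulr_sumr.
Qed.

Lemma jensen_gapB F G :
  jensen_gap p x (fun y => F y - G y) = jensen_gap p x F - jensen_gap p x G.
Proof.
have E : \sum_i p i * (F (x i) - G (x i)) =
    \sum_i p i * F (x i) - \sum_i p i * G (x i).
  by rewrite -sumrB; apply: eq_bigr => i _; ring.
by rewrite /jensen_gap E; ring.
Qed.

Lemma jensen_gapZ c : jensen_gap p x ( *%R c) = 0.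
Proof.
rewrite /jensen_gap mulr_sumr -sumrB big1// => i _; ring.
Qed.

(** The variance of the law putting mass [p i] on [x i]. *)
Definition spread : R := \sum_i p i * x i ^+ 2 - (\sum_i p i * x i) ^+ 2.

Lemma jensen_gap_sqr c : jensen_gap p x (fun y => c * y ^+ 2) = - (c * spread).
Proof.
rewrite /jensen_gap /spread mulrBr mulr_sumr opprB; congr (_ - _).
by apply: eq_bigr => i _; ring.
Qed.

Lemma jensen_gap_Ex d (T : measurableType d) (P : probability T R) (F : R -> T -> R) :
  (forall y, bmfun (F y)) ->
  jensen_gap p x (fun y => Ex P (F y)) = Ex P (fun w => jensen_gap p x (F ^~ w)).
Proof.
move=> bF; rewrite /jensen_gap ExB//; last first.
  by apply: bmfun_sum => i; apply: bmfunM => //; exact: bmfun_cst.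
congr (_ - _); rewrite Ex_sum; last first.
  by move=> i; apply: bmfunM => //; exact: bmfun_cst.
by apply: eq_bigr => i _; rewrite ExZ.
Qed.

Lemma bmfun_jensen_gap d (T : measurableType d) (F : R -> T -> R) :
  (forall y, bmfun (F y)) -> bmfun (fun w => jensen_gap p x (F ^~ w)).
Proof.
move=> bF; apply: bmfunB => //.
by apply: bmfun_sum => i; apply: bmfunM => //; exact: bmfun_cst.
Qed.

Hypothesis p0 : forall i, 0 <= p i.
Hypothesis p1 : \sum_i p i = 1.
Variable c : R.
Hypothesis xc : forall i, 0 <= x i <= c.

Lemma mean_itv : 0 <= \sum_i p i * x i <= c.
Proof.
apply/andP; split.
  by apply: sumr_ge0 => i _; apply: mulr_ge0 => //; have /andP[] := xc i.
rewrite -[c]mul1r -p1 mulr_suml; apply: ler_sum => i _.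
by apply: ler_wpM2l => //; have /andP[] := xc i.
Qed.

Lemma eq_jensen_gap F G : (forall y, 0 <= y <= c -> F y = G y) ->
  jensen_gap p x F = jensen_gap p x G.
Proof.
move=> FG; rewrite /jensen_gap FG ?mean_itv//; congr (_ - _).
by apply: eq_bigr => i _; rewrite FG.
Qed.

Lemma spread_ge0 : 0 <= spread.
Proof.
set y := \sum_i p i * x i.
have -> : spread = \sum_i p i * (x i - y) ^+ 2.
  rewrite [RHS](eq_bigr (fun i => p i * x i ^+ 2 + (p i * (y ^+ 2) - 2 * y * (p i * x i)))).
    rewrite big_split/= sumrB -mulr_suml p1 -mulr_sumr -/y /spread -/y; ring.
  by move=> i _; ring.
by apply: sumr_ge0 => i _; apply: mulr_ge0 => //; exact: sqr_ge0.
Qed.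

End jensen_gap_theory.

(** * Voronoi cells of the free demands *)

Section voronoi.
Context (R : realType) (k n m : nat).
Hypothesis k0 : (0 < k)%N.
Hypothesis n0 : (0 < n)%N.
Notation pt := (k.-tuple (measurableTypeR R)).
Notation dst := (@dist2 R k).
Notation P := (uniform_cube R k).
Implicit Types (A : {set 'I_m}) (d : m.-tuple pt) (j : 'I_m) (u : pt).

(** Ties go to the smallest index, so that each point has exactly one closest demand in a nonempty
    [A] and the cells form a partition. *)
Definition closest A d j u : bool :=
  [forall j' in A, if (j' < j)%N then dst u (tnth d j) < dst u (tnth d j')
                   else dst u (tnth d j) <= dst u (tnth d j')].

(** Moving towards the site shortens the distance to it by the full displacement, and any other
    distance by at most as much. *)
Lemma closest_star A d j u (l : R) : 0 < l <= 1 ->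
  closest A d j u -> closest A d j (shrink (tnth d j) l u).
Proof.
move=> /andP[l0 l1] /forall_inP H; apply/forall_inP => j' j'A.
have := H j' j'A; rewrite dist2_shrink; last exact: ltW.
have := dist2_triangle (shrink (tnth d j) l u) u (tnth d j').
rewrite dist2_shrink_same// => h.
by case: ifP => _ h2; lra.
Qed.

Lemma measurable_closest A d j : measurable_fun setT (closest A d j).
Proof.
have md (i : 'I_m) : measurable_fun setT (fun u => dst u (tnth d i)).
  by apply: measurable_dist2; [exact: measurable_id|exact: measurable_cst].
pose b (j' : 'I_m) u := if (j' < j)%N then dst u (tnth d j) < dst u (tnth d j')
                   else dst u (tnth d j) <= dst u (tnth d j').
rewrite (_ : closest A d j = fun u => [forall j' in A, [ffun j' => b j' u] j']).
  apply: (@measurable_finbool _ _ R _ b (fun h => [forall j' in A, h j'])) => j'.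
  rewrite /b; case: (j' < j)%N; [exact: measurable_fun_ltr|exact: measurable_fun_ler].
by apply/funext => u; apply: eq_forallb => j'; rewrite ffunE.
Qed.

(** A point is covered exactly when its closest demand covers it. *)
Lemma covers_sum A d x u :
  (covers n A d x u)%:R =
  \sum_(j in A) (closest A d j u && (dst u (tnth d j) <= srad n k x))%:R :> R.
Proof.
have [->|/finset.set0Pn[j0 j0A]] := eqVneq A finset.set0.
  rewrite big1 => [|j]; last by rewrite finset.inE.
  rewrite (_ : covers _ _ _ _ _ = false)//.
  by rewrite /covers; apply/existsP => -[j /andP[]]; rewrite finset.inE.
pose f j := dst u (tnth d j).
have [j1 j1A j1m] : exists2 j1, j1 \in A & forall j, j \in A -> f j1 <= f j.
  by case: (Order.TotalTheory.arg_minP f j0A) => j1 ? ?; exists j1.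
have j1P : (j1 \in A) && (f j1 == f j1) by rewrite j1A eqxx.
have [j2 j2A [j2E j2m]] : exists2 j2, j2 \in A & f j2 = f j1 /\
    forall j, j \in A -> f j = f j1 -> (j2 <= j)%N.
  case: (arg_minnP (fun j : 'I_m => j : nat) (P := fun j => (j \in A) && (f j == f j1)) j1P).
  move=> j2 /andP[j2A /eqP j2E] j2m; exists j2 => //; split=> // j jA /eqP jE.
  by apply: j2m; rewrite jA.
have c2 : closest A d j2 u.
  apply/forall_inP => j jA; rewrite -/(f j2) -/(f j) j2E.
  case: ifP => [jj|_]; last exact: j1m.
  rewrite lt_neqAle j1m// andbT; apply: contraTneq jj => /esym/(j2m _ jA).
  by rewrite -leqNgt.
rewrite (bigD1 j2)//= c2 /= big1 ?addr0.
  congr (nat_of_bool _)%:R; rewrite /covers; apply/exists_inP/idP => [[j jA h]|h].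
    by apply: le_trans h; rewrite -/(f j2) j2E; exact: j1m.
  by exists j2.
move=> j /andP[jA jj2]; case: (boolP (closest A d j u)) => //= cj.
have h1 := forall_inP c2 j jA; have h2 := forall_inP cj j2 j2A.
move: h1 h2; have [lt|lt|E] := ltngtP j j2.
- by move=> h1 h2; move: (lt_le_trans h1 h2); rewrite ltxx.
- by move=> h1 h2; move: (le_lt_trans h1 h2); rewrite ltxx.
- by rewrite (val_inj E) eqxx in jj2.
Qed.

Definition cell A d j (x : R) : R := starvol n (tnth d j) (closest A d j) x.

Lemma Ex_covers A d x :
  Ex P (fun u => (covers n A d x u)%:R) = \sum_(j in A) cell A d j x.
Proof.
rewrite /cell /starvol -Ex_sum.
  by apply: eq_Ex => u; rewrite covers_sum.
move=> j; apply: bmfun_bool; apply: measurable_and.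
  exact: measurable_closest.
exact: measurable_ball_cond.
Qed.

Lemma cell_gap_ge0 A d j (I : finType) (p x : I -> R) :
  incube (tnth d j) ->
  (forall i, 0 <= p i) -> \sum_i p i = 1 -> (forall i, 0 <= x i) ->
  0 <= jensen_gap p x (cell A d j).
Proof.
move=> ij p0 p1 x0; apply: kneser_jensen => //.
  by apply: starvol_nondecr; exact: measurable_closest.
apply: starvol_kneser => //; first exact: measurable_closest.
by move=> u l; exact: closest_star.
Qed.

End voronoi.

(** * Isolated pairs of demands *)

Section isolated_pairs.
Context (R : realType) (k n m : nat).
Hypothesis k0 : (0 < k)%N.
Hypothesis n0 : (0 < n)%N.
Notation pt := (k.-tuple (measurableTypeR R)).
Notation dst := (@dist2 R k).
Notation P := (uniform_cube R k).
Notation loc := ((n.-tuple pt) * (m.-tuple pt))%type.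
Notation LP := (location_prob R k n m).
Variable gamma : R.
Hypothesis gamma0 : 0 <= gamma.
Notation rho := (srad n k gamma).
Hypothesis rho8 : rho <= 8^-1.
Implicit Types (z : loc) (j : 'I_m) (a b u : pt) (r : n.-tuple R) (Z : {set 'I_n}).

Definition midcube a : bool := all (fun c : R => 4^-1 <= c <= 3 / 4) a.

(** With supplies this far from [a], a demand within 2 rho of [a] has no supply within rho and so is
    free; and a demand this far cannot be closest to a point of the ball of radius rho about [a]. *)
Definition away a u : bool := 3 * rho < dst u a.

(* Seen from the demand [j1], the only other point that can be close is [j2]. *)
Definition isolated_pair z j1 j2 : bool :=
  [&& midcube (tnth z.2 j1), all (away (tnth z.2 j1)) z.1 &
      [forall j, (j != j1) && (j != j2) ==> away (tnth z.2 j1) (tnth z.2 j)]].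

(** The volume that the Voronoi cell of [b] takes from the ball of [a], ties going to [b]. *)
Definition nearer a b (x : R) : R :=
  Ex P (fun u => ((dst u b <= dst u a) && (dst u a <= srad n k x))%:R).

Lemma bmfun_nearer_cond d (T : measurableType d) (f g h : T -> pt) x :
  measurable_fun setT f -> measurable_fun setT g -> measurable_fun setT h ->
  bmfun (fun w => ((dst (h w) (g w) <= dst (h w) (f w)) &&
                   (dst (h w) (f w) <= srad n k x))%:R : R).
Proof.
move=> mf mg mh; apply: bmfun_bool; apply: measurable_and.
  by apply: measurable_fun_ler; exact: measurable_dist2.
by apply: measurable_fun_ler; [exact: measurable_dist2|exact: measurable_cst].
Qed.

Lemma midcubeP a : reflect (forall i, 4^-1 <= (tnth a i : R) <= 3 / 4) (midcube a).
Proof. by apply: (iffP all_tnthP) => H i; exact: H. Qed.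

Lemma ballvol_srad a x : midcube a -> 0 <= x <= gamma ->
  ballvol a (srad n k x) = unitball R k / n%:R * x.
Proof.
move=> /midcubeP ma /andP[x0 xg].
have s0 := srad_ge0 n k x.
have s8 : srad n k x <= 8^-1 by exact: le_trans (le_srad n k x0 xg) rho8.
rewrite ballvol_inside//; last by move=> i; have := ma i; lra.
by rewrite sradX// -mulrA; congr (_ * _); rewrite mulrC.
Qed.

Lemma nearer_far a b x : 0 <= x <= gamma -> 2 * rho < dst b a -> nearer a b x = 0.
Proof.
move=> /andP[x0 xg] ba; rewrite -[RHS](Ex_cst P); apply: eq_Ex => u.
case: (lerP (dst u a) (srad n k x)) => ua; rewrite ?andbF// andbT.
case: (lerP (dst u b) (dst u a)) => // ub.
have h := dist2_triangle u b a; rewrite (dist2C b u) in h.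
have h2 := le_srad n k x0 xg; lra.
Qed.

Lemma isolated_freed Z r z j1 j2 (hr : forall i, 0 <= tnth r i <= gamma) :
  isolated_pair z j1 j2 -> forall j, dst (tnth z.2 j) (tnth z.2 j1) <= 2 * rho ->
  j \in freed Z r z.
Proof.
move=> /and3P[_ /all_tnthP sa _] j jj; apply: avail_isolated => i.
rewrite /without negb_and /service_graph; apply/orP; right.
rewrite -ltNge; have /andP[r0 rg] := hr i.
have := le_srad n k r0 rg.
have := sa i; rewrite /away => h1 h2.
have := dist2_triangle (tnth z.2 j) (tnth z.1 i) (tnth z.2 j1).
rewrite -[X in X < _]/(srad n k (tnth r i)); lra.
Qed.

(** Within rho of [j1] only [j1] and [j2] compete, and j2 < j1 gives ties to [j2]. A [j2] farther
    than 2 rho may fail to be free, but then it takes nothing from the ball. *)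
Lemma cell_isolated Z r z j1 j2 x (hr : forall i, 0 <= tnth r i <= gamma) :
  (j2 < j1)%N -> isolated_pair z j1 j2 -> 0 <= x <= gamma ->
  cell n (freed Z r z) z.2 j1 x =
  unitball R k / n%:R * x - nearer (tnth z.2 j1) (tnth z.2 j2) x.
Proof.
move=> j21 iso xg; have /and3P[ma _ /forallP da] := iso.
have fr := isolated_freed Z hr iso.
have rho0 := srad_ge0 n k gamma.
rewrite -(ballvol_srad ma xg) /ballvol /nearer -ExB; last 2 first.
- by apply: bmfun_bool; exact: measurable_ball_cond.
- by apply: bmfun_nearer_cond; [exact: measurable_cst|exact: measurable_cst|exact: measurable_id].
apply: eq_Ex => u; case: (lerP (dst u _) (srad n k x)) => ua; last by rewrite !andbF subrr.
rewrite !andbT.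
have {}ua : dst u (tnth z.2 j1) <= rho.
  by have /andP[x0 xg'] := xg; exact: le_trans ua (le_srad n k x0 xg').
suff -> : closest (freed Z r z) z.2 j1 u =
    ~~ (dst u (tnth z.2 j2) <= dst u (tnth z.2 j1)).
  by case: (_ <= _); rewrite ?subrr ?subr0.
rewrite -ltNge; apply/forall_inP/idP => [H|lt12].
  have [far|close] := ltP (2 * rho) (dst (tnth z.2 j2) (tnth z.2 j1)); last first.
    by have := H j2 (fr _ close); rewrite j21.
  have := dist2_triangle u (tnth z.2 j2) (tnth z.2 j1).
  rewrite [dst (tnth z.2 j2) u]dist2C; lra.
move=> j jA; have [->|jj1] := eqVneq j j1; first by rewrite ltnn.
have [->|jj2] := eqVneq j j2; first by rewrite j21.
have := da j; rewrite jj1 jj2 /= /away => far.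
have := dist2_triangle u (tnth z.2 j) (tnth z.2 j1).
rewrite [dst (tnth z.2 j) u]dist2C => h.
by case: ifP => _; lra.
Qed.

Section with_points.
Context (I : finType) (p x : I -> R).
Hypothesis p0 : forall i, 0 <= p i.
Hypothesis p1 : \sum_i p i = 1.
Hypothesis xg : forall i, 0 <= x i <= gamma.

(** At most one term of the sum is nonzero: a [j2] within 2 rho of [j1] prevents any other pair with
    [j1] from being isolated, and a farther one contributes 0. If no term remains, concavity of the
    cell volume suffices. *)
Lemma isolated_le_gap Z r z j1 (hr : forall i, 0 <= tnth r i <= gamma) :
  incube (tnth z.2 j1) ->
  \sum_(j2 : 'I_m | (j2 < j1)%N) (isolated_pair z j1 j2)%:R *
     - jensen_gap p x (nearer (tnth z.2 j1) (tnth z.2 j2)) <=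
  (j1 \in freed Z r z)%:R * jensen_gap p x (cell n (freed Z r z) z.2 j1).
Proof.
move=> ij; have rho0 := srad_ge0 n k gamma.
have gap0 : 0 <= jensen_gap p x (cell n (freed Z r z) z.2 j1).
  by apply: cell_gap_ge0 => // i; have /andP[] := xg i.
have far0 j2 : 2 * rho < dst (tnth z.2 j2) (tnth z.2 j1) ->
    jensen_gap p x (nearer (tnth z.2 j1) (tnth z.2 j2)) = 0.
  move=> far; rewrite (eq_jensen_gap p0 p1 xg (G := *%R 0)); first exact: jensen_gapZ.
  by move=> y yg; rewrite mul0r nearer_far.
have [/existsP[j2 /and3P[j21 iso close]]|/existsPn none] :=
    boolP [exists j2 : 'I_m, [&& (j2 < j1)%N, isolated_pair z j1 j2 &
      dst (tnth z.2 j2) (tnth z.2 j1) <= 2 * rho]]; last first.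
  rewrite big1 ?mulr_ge0// => j2 j21.
  case: (boolP (isolated_pair z j1 j2)) => iso; last by rewrite mul0r.
  by have := none j2; rewrite j21 iso /= -ltNge => /far0 ->; rewrite oppr0 mulr0.
have j1A : j1 \in freed Z r z.
  by apply: (isolated_freed Z hr iso); rewrite dist2xx mulr_ge0.
rewrite j1A mul1r (bigD1 j2)//= iso mul1r big1 ?addr0; last first.
  move=> j3 /andP[j31 j32]; rewrite (_ : isolated_pair z j1 j3 = false) ?mul0r//.
  apply/negP => /and3P[_ _ /forallP/(_ j2)].
  rewrite eq_sym in j32; rewrite j32 andbT neq_ltn j21 /= /away => far.
  by have := lt_le_trans far close; rewrite ltNge ler_wpM2r// ler_nat.
rewrite (eq_jensen_gap p0 p1 xg
  (F := cell n (freed Z r z) z.2 j1)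
  (G := fun y => unitball R k / n%:R * y - nearer (tnth z.2 j1) (tnth z.2 j2) y)).
  by rewrite jensen_gapB jensen_gapZ sub0r.
by move=> y yg; exact: cell_isolated.
Qed.

(** Averaging over [b] makes the lost volume a multiple of y^2, whose Jensen gap is minus that
    multiple of the variance. *)
Lemma Ex_nearer_gap a : midcube a ->
  Ex P (fun b => - jensen_gap p x (nearer a b)) =
  (unitball R k / n%:R) ^+ 2 / 2 * spread p x.
Proof.
move=> ma.
have bn y : bmfun (fun b => nearer a b y).
  apply: (@bmfun_Ex _ _ _ _ _ P P (fun w => ((dst w.2 w.1 <= dst w.2 a) &&
     (dst w.2 a <= srad n k y))%:R)).
  apply: (@bmfun_nearer_cond _ _ (cst a) fst snd) => //; exact: measurable_cst.
have -> : Ex P (fun b => - jensen_gap p x (nearer a b)) =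
    - jensen_gap p x (fun y => Ex P (fun b => nearer a b y)).
  rewrite jensen_gap_Ex// -[RHS]mulN1r -ExZ; last exact: bmfun_jensen_gap.
  by apply: eq_Ex => b; rewrite mulN1r.
rewrite (eq_jensen_gap p0 p1 xg
   (G := fun y => (unitball R k / n%:R) ^+ 2 / 2 * y ^+ 2)).
  by rewrite jensen_gap_sqr opprK.
move=> y /andP[y0 yg]; rewrite /nearer Ex_swap; last first.
  apply: (@bmfun_nearer_cond _ _ (cst a) fst snd) => //; exact: measurable_cst.
have s8 : srad n k y <= 8^-1 by exact: le_trans (le_srad n k y0 yg) rho8.
rewrite Ex_nearer ?srad_ge0//; last exact/midcubeP.
by rewrite sradX//; ring.
Qed.

End with_points.

End isolated_pairs.

Section gain_gap.
Context (R : realType) (k n m : nat).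
Hypothesis k0 : (0 < k)%N.
Notation pt := (k.-tuple (measurableTypeR R)).
Notation dst := (@dist2 R k).
Notation P := (uniform_cube R k).
Notation loc := ((n.-tuple pt) * (m.-tuple pt))%type.
Notation LP := (location_prob R k n m).
Variable gamma : R.
Notation rho := (srad n k gamma).
Hypothesis rho8 : rho <= 8^-1.
Hypothesis rho_gt0 : 0 < rho.
Hypothesis rho6 : (6 * rho) ^+ k <= 1.
Implicit Types (z : loc) (j : 'I_m) (a b u : pt) (r : n.-tuple R) (Z : {set 'I_n}).

Lemma measurable_midcube : measurable_fun setT (@midcube R k).
Proof.
apply: measurable_all.
by apply: measurable_and; apply: measurable_fun_ler.
Qed.

Lemma measurable_away d (T : measurableType d) (f g : T -> pt) :
  measurable_fun setT f -> measurable_fun setT g ->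
  measurable_fun setT (fun w => away n gamma (f w) (g w)).
Proof.
move=> mf mg; apply: measurable_fun_ltr; first exact: measurable_cst.
exact: measurable_dist2.
Qed.

Lemma measurable_forall d (T : measurableType d) (I : finType) (b : I -> T -> bool) :
  (forall i, measurable_fun setT (b i)) ->
  measurable_fun setT (fun w => [forall i, b i w]).
Proof.
move=> mb; rewrite (_ : (fun w => _) = fun w => [forall i, [ffun i => b i w] i]).
  exact: (@measurable_finbool _ _ R _ b (fun h => [forall i, h i])).
by apply/funext => w; apply: eq_forallb => i; rewrite ffunE.
Qed.

Lemma measurable_all_dep d (T : measurableType d) l (c : T -> pt -> bool)
    (t : T -> l.-tuple pt) :
  (forall i, measurable_fun setT (fun w => c w (tnth (t w) i))) ->
  measurable_fun setT (fun w => all (c w) (t w)).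
Proof.
move=> mc; rewrite (_ : (fun w => _) = fun w => [forall i, c w (tnth (t w) i)]).
  exact: measurable_forall.
apply/funext => w; apply/all_tnthP/forallP => H i; exact: H.
Qed.

(* [isolated_pair] where the demand [j1] is relocated to [a] *)
Definition isolated_at j1 j2 z a : bool :=
  [&& midcube a, all (away n gamma a) z.1 &
      [forall j, (j != j1) && (j != j2) ==> away n gamma a (tnth z.2 j)]].

Lemma measurable_isolated_at d (T : measurableType d) j1 j2 (f : T -> loc) (g : T -> pt) :
  measurable_fun setT f -> measurable_fun setT g ->
  measurable_fun setT (fun w => isolated_at j1 j2 (f w) (g w)).
Proof.
move=> mf mg; apply: measurable_and.
  exact: (measurableT_comp measurable_midcube mg).
apply: measurable_and.
  apply: measurable_all_dep => i; apply: measurable_away => //.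
  exact: (measurableT_comp (measurable_sup i) mf).
apply: measurable_forall => j; case: (_ && _) => /=; last exact: measurable_cst.
apply: measurable_away => //.
exact: (measurableT_comp (measurable_dem j) mf).
Qed.

Lemma Ex_all_away a :
  Ex LP (fun z => (all (away n gamma a) z.1 && all (away n gamma a) z.2)%:R) =
  (1 - ballvol a (3 * rho)) ^+ (n + m).
Proof.
have ma : measurable_fun setT (away n gamma a).
  by apply: measurable_away; [exact: measurable_cst|exact: measurable_id].
have E : Ex P (fun u => (away n gamma a u)%:R) = 1 - ballvol a (3 * rho).
  rewrite /ballvol -[X in _ = X - _](Ex_cst P) -ExB; last 2 first.
  - exact: bmfun_cst.
  - by apply: bmfun_bool; exact: measurable_ball_cond.
  by apply: eq_Ex => u; rewrite /away; case: ltP; rewrite ?subrr ?subr0.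
rewrite Ex_prod; last first.
  apply: bmfun_bool; apply: measurable_and.
    exact: (measurableT_comp (measurable_all ma) measurable_fst).
  exact: (measurableT_comp (measurable_all ma) measurable_snd).
rewrite exprD -E -!Ex_iid_all// mulrC -ExZ; last first.
  by apply: bmfun_bool; exact: measurable_all.
apply: eq_Ex => s /=; rewrite mulrC -ExZ; last first.
  by apply: bmfun_bool; exact: measurable_all.
by apply: eq_Ex => d; rewrite -natrM mulnb.
Qed.

Lemma Ex_midcube : (2 ^+ k)^-1 <= Ex P (fun a => (midcube a)%:R).
Proof.
pose v : pt := [tuple 4^-1 : R | i < k].
have h : 0 < 2^-1 :> R by rewrite invr_gt0.
have bm : bmfun (fun a : pt => (midcube a)%:R : R) by apply: bmfun_bool; exact: measurable_midcube.
have := @affine_cube_le R k v 2^-1 _ h bm (fun=> ler0n _ _).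
apply: le_trans; rewrite exprVn -[leLHS]mulr1; apply: ler_wpM2l.
  by rewrite invr_ge0 exprn_ge0.
rewrite -[leLHS](Ex_incube R k); apply: (le_Ex_as (C := @incube R k)) => //.
- exact: measurable_incube.
- exact: Ex_incube.
- by apply: bmfun_bool; exact: measurable_incube.
- apply: bmfunM; first exact: (bmfun_comp bm (measurable_affinek _ _)).
  exact: bmfun_bool (measurableT_comp (@measurable_incube R k) (measurable_affinek _ _)).
move=> u /[dup] iu /incubeP ui; rewrite iu -natrM ler_nat.
have -> : midcube (affine v 2^-1 u).
  apply/midcubeP => i; rewrite !tnth_mktuple; have /andP[u0 u1] := ui i.
  by apply/andP; split; lra.
have -> // : incube (affine v 2^-1 u).
apply/incubeP => i; rewrite !tnth_mktuple; have /andP[u0 u1] := ui i.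
by apply/andP; split; lra.
Qed.

Lemma Ex_isolated_at j1 j2 :
  (2 ^+ k)^-1 * (1 - (6 * rho) ^+ k) ^+ (n + m) <=
  Ex LP (fun z => Ex P (fun a => (isolated_at j1 j2 z a)%:R)).
Proof.
(* Asking all n + m points to be away, the old positions of [j1] and [j2] included, costs only a
   constant and makes the event a product for fixed [a]. *)
pose J z a : R := (midcube a && (all (away n gamma a) z.1 && all (away n gamma a) z.2))%:R.
have bJ : bmfun (fun w : loc * pt => J w.1 w.2).
  apply: bmfun_bool; apply: measurable_and.
    exact: (measurableT_comp measurable_midcube measurable_snd).
  apply: measurable_and; apply: measurable_all_dep => i; apply: measurable_away => //.
    exact: (measurableT_comp (measurable_sup i) measurable_fst).
  exact: (measurableT_comp (measurable_dem i) measurable_fst).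
have bI : bmfun (fun w : loc * pt => (isolated_at j1 j2 w.1 w.2)%:R : R).
  by apply: bmfun_bool; exact: measurable_isolated_at.
apply: (@le_trans _ _ (Ex LP (fun z => Ex P (J z)))); last first.
  apply: le_Ex.
  - exact: (bmfun_Ex LP P bJ).
  - exact: (bmfun_Ex LP P bI).
  move=> z; apply: le_Ex.
  - apply: (bmfun_comp bJ (g := fun a => (z, a))); exact: measurable_pair1.
  - apply: (bmfun_comp bI (g := fun a => (z, a))); exact: measurable_pair1.
  move=> a; rewrite /J ler_nat /isolated_at; case: (midcube a) => //=.
  case: (all _ z.1) => //=; case: (boolP (all _ z.2)) => // /all_tnthP H.
  rewrite (_ : [forall j, _] = true)//.
  by apply/forallP => j; apply/implyP => _; exact: H.
rewrite Ex_swap//.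
have -> : Ex P (fun a => Ex LP (J ^~ a)) =
   Ex P (fun a => (midcube a)%:R * (1 - ballvol a (3 * rho)) ^+ (n + m)).
  apply: eq_Ex => a; rewrite -Ex_all_away -ExZ; last first.
    apply: bmfun_bool; apply: measurable_and; apply: measurable_all_dep => i;
      apply: measurable_away; try exact: measurable_cst.
      exact: measurable_sup.
    exact: measurable_dem.
  by apply: eq_Ex => z; rewrite -natrM mulnb.
apply: (@le_trans _ _ (Ex P (fun a => (1 - (6 * rho) ^+ k) ^+ (n + m) * (midcube a)%:R))).
  rewrite ExZ; last by apply: bmfun_bool; exact: measurable_midcube.
  rewrite mulrC; apply: ler_wpM2l; last exact: Ex_midcube.
  by rewrite exprn_ge0// subr_ge0.
have E3 : 6 * rho = 2 * (3 * rho) by ring.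
apply: le_Ex.
- apply: bmfunM; first exact: bmfun_cst.
  by apply: bmfun_bool; exact: measurable_midcube.
- apply: bmfunM; first by apply: bmfun_bool; exact: measurable_midcube.
  under eq_fun do rewrite -Ex_all_away.
  apply: (@bmfun_Ex _ _ _ _ _ P LP (fun w =>
     (all (away n gamma w.1) w.2.1 && all (away n gamma w.1) w.2.2)%:R)).
  apply: bmfun_bool; apply: measurable_and; apply: measurable_all_dep => i; apply: measurable_away => //.
    exact: (measurableT_comp (measurable_sup i) measurable_snd).
  exact: (measurableT_comp (measurable_dem i) measurable_snd).
move=> a; rewrite mulrC; apply: ler_wpM2l => //.
have ub : ballvol a (3 * rho) <= (6 * rho) ^+ k.
  by rewrite E3; apply: ballvol_ub; rewrite mulr_gt0.
apply: lerXn2r; rewrite ?nnegrE ?subr_ge0//; first exact: le_trans ub rho6.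
by rewrite lerD2l lerN2.
Qed.

Section with_points.
Context (I : finType) (p x : I -> R).
Hypothesis p0 : forall i, 0 <= p i.
Hypothesis p1 : \sum_i p i = 1.
Hypothesis xg : forall i, 0 <= x i <= gamma.

Let V : R := (unitball R k / n%:R) ^+ 2 / 2 * spread p x.

Lemma bmfun_nearer d (T : measurableType d) (f g : T -> pt) y :
  measurable_fun setT f -> measurable_fun setT g ->
  bmfun (fun w => nearer n (f w) (g w) y).
Proof.
move=> mf mg.
apply: (@bmfun_comp _ _ _ _ _ (fun ab : pt * pt => nearer n ab.1 ab.2 y)
   (fun w => (f w, g w))); last exact: measurable_fun_pair.
apply: (@bmfun_Ex _ _ _ _ _ (P \x P)%E P (fun w => ((dst w.2 w.1.2 <= dst w.2 w.1.1) &&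
     (dst w.2 w.1.1 <= srad n k y))%:R)).
apply: (@bmfun_nearer_cond _ _ _ _ _ (fun w : (pt * pt) * pt => w.1.1)
  (fun w => w.1.2) snd) => //.
  exact: (measurableT_comp measurable_fst measurable_fst).
exact: (measurableT_comp measurable_snd measurable_fst).
Qed.

(** Isolation does not involve the position of [j2]; once both demands are redrawn, integrating that
    position first gives the factor [V]. *)
Lemma Ex_isolated_gap j1 j2 : (j2 < j1)%N ->
  V * ((2 ^+ k)^-1 * (1 - (6 * rho) ^+ k) ^+ (n + m)) <=
  Ex LP (fun z => (isolated_pair gamma z j1 j2)%:R *
     - jensen_gap p x (nearer n (tnth z.2 j1) (tnth z.2 j2))).
Proof.
move=> j21; set f := (X in _ <= Ex _ X).
have bf : bmfun f.
  apply: bmfunM.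
    apply: bmfun_bool.
    apply: (@measurable_isolated_at _ _ j1 j2 id (fun z => tnth z.2 j1)) => //.
    exact: measurable_dem.
  apply: bmfunN; apply: bmfun_jensen_gap => y; apply: bmfun_nearer; exact: measurable_dem.
have bh : bmfun (fun z => Ex P (fun b => f (updd z j2 b))) := bmfun_Ex LP P (bmfun_updd j2 bf).
rewrite (Ex_resample_d j2)// (Ex_resample_d j1)//.
have V0 : 0 <= V.
  apply: mulr_ge0; first by rewrite divr_ge0// sqr_ge0.
  exact: spread_ge0.
have -> : Ex LP (fun z => Ex P (fun a => Ex P (fun b => f (updd (updd z j1 a) j2 b)))) =
  Ex LP (fun z => V * Ex P (fun a => (isolated_at j1 j2 z a)%:R)).
  apply: eq_Ex => z; rewrite -ExZ; last first.
    by apply: bmfun_bool; apply: measurable_isolated_at; [exact: measurable_cst|exact: measurable_id].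
  apply: eq_Ex => a.
  have jj : j1 != j2 by rewrite neq_ltn j21 orbT.
  have d1 b : tnth (updd (updd z j1 a) j2 b).2 j1 = a.
    by rewrite !tnth_upd (negbTE jj) eqxx.
  have d2 b : tnth (updd (updd z j1 a) j2 b).2 j2 = b.
    by rewrite !tnth_upd eqxx.
  transitivity (Ex P (fun b => (isolated_at j1 j2 z a)%:R * - jensen_gap p x (nearer n a b))).
    apply: eq_Ex => b; rewrite /f d1 d2; congr ((nat_of_bool _)%:R * _).
    rewrite /isolated_pair d1 /isolated_at /=; congr [&& _, _ & _].
    apply: eq_forallb => j; rewrite !tnth_upd.
    by case: eqP => [->|_] //=; case: eqP => [->|_]; rewrite ?andbF.
  rewrite ExZ; last first.
    apply: bmfunN; apply: bmfun_jensen_gap => y; apply: bmfun_nearer.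
      exact: measurable_cst.
    exact: measurable_id.
  rewrite mulrC /isolated_at; case: (boolP (midcube a)) => ma; last by rewrite !mulr0.
  by congr (_ * _); exact: (Ex_nearer_gap k0 rho8 p0 p1 xg ma).
rewrite ExZ; last first.
  apply: (@bmfun_Ex _ _ _ _ _ LP P (fun w => (isolated_at j1 j2 w.1 w.2)%:R)).
  by apply: bmfun_bool; exact: measurable_isolated_at.
by apply: ler_wpM2l => //; exact: Ex_isolated_at.
Qed.

Lemma jensen_gap_gain_ge Z r (hr : forall i, 0 <= tnth r i <= gamma) :
  \sum_(j1 : 'I_m) \sum_(j2 : 'I_m | (j2 < j1)%N)
     V * ((2 ^+ k)^-1 * (1 - (6 * rho) ^+ k) ^+ (n + m)) <=
  jensen_gap p x (gain k m Z r).
Proof.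
pose F y z := Ex P (fun u => (covers n (freed Z r z) z.2 y u)%:R : R).
have bF y : bmfun (F y).
  refine (@bmfun_Ex _ _ _ _ _ LP P (fun w => (covers n (freed Z r w.1) w.1.2 y w.2)%:R) _).
    exact: (@bmfun_covers_freed R k n m Z r y).
have -> : jensen_gap p x (gain k m Z r) = Ex LP (fun z => jensen_gap p x (F ^~ z)).
  by rewrite -jensen_gap_Ex.
pose Psi z : R := \sum_(j1 : 'I_m) \sum_(j2 : 'I_m | (j2 < j1)%N) (isolated_pair gamma z j1 j2)%:R *
     - jensen_gap p x (nearer n (tnth z.2 j1) (tnth z.2 j2)).
have bG j1 j2 : bmfun (fun z => (isolated_pair gamma z j1 j2)%:R *
     - jensen_gap p x (nearer n (tnth z.2 j1) (tnth z.2 j2))).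
  apply: bmfunM.
    apply: bmfun_bool.
    apply: (@measurable_isolated_at _ _ j1 j2 id (fun z => tnth z.2 j1)) => //.
    exact: measurable_dem.
  apply: bmfunN; apply: bmfun_jensen_gap => y; apply: bmfun_nearer; exact: measurable_dem.
have bPsi : bmfun Psi by apply: bmfun_sum => j1; apply: bmfun_sum => j2; exact: bG.
apply: (@le_trans _ _ (Ex LP Psi)).
  rewrite Ex_sum; last by move=> j1; apply: bmfun_sum => j2; exact: bG.
  apply: ler_sum => j1 _; rewrite Ex_sum; last by move=> j2; exact: bG.
  by apply: ler_sum => j2 j21; exact: Ex_isolated_gap.
have mC : measurable_fun setT (fun z : loc => all (@incube R k) z.2).
  exact: (measurableT_comp (measurable_all (@measurable_incube R k)) measurable_snd).
(* Kneser's inequality for a cell requires its site to lie in the cube. *)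
apply: (le_Ex_as (C := fun z : loc => all (@incube R k) z.2)) => //.
- rewrite Ex_prod; last exact: bmfun_bool.
  rewrite -[RHS](Ex_cst (iid_prob P n)); apply: eq_Ex => s /=.
  by rewrite (Ex_iid_all P m (@measurable_incube R k)) Ex_incube expr1n.
- exact: bmfun_jensen_gap.
move=> z /all_tnthP iz.
have -> : jensen_gap p x (F ^~ z) =
   \sum_(j in freed Z r z) jensen_gap p x (cell n (freed Z r z) z.2 j).
  rewrite -jensen_gap_sum; congr jensen_gap; apply/funext => y.
  exact: Ex_covers.
rewrite [leRHS]big_mkcond /=; apply: ler_sum => j1 _.
have := isolated_le_gap k0 rho8 p0 p1 xg Z hr (iz j1).
by case: (j1 \in freed Z r z); rewrite ?mul1r ?mul0r.
Qed.

End with_points.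

Lemma gain_le Z r y : 0 < y -> (0 < n)%N -> gain k m Z r y <= 2 ^+ k * m%:R * y / n%:R.
Proof.
move=> y0 n0.
have sy : 0 < srad n k y by rewrite /srad powR_gt0// divr_gt0// ltr0n.
rewrite -[leRHS](Ex_cst LP); apply: le_Ex.
- refine (@bmfun_Ex _ _ _ _ _ LP P (fun w => (covers n (freed Z r w.1) w.1.2 y w.2)%:R) _).
  exact: (@bmfun_covers_freed R k n m Z r y).
- exact: bmfun_cst.
move=> z; rewrite (Ex_covers n (freed Z r z) z.2 y).
apply: (@le_trans _ _ (\sum_(j : 'I_m) 2 ^+ k * y / n%:R)); last first.
  by rewrite sumr_const card_ord -[leLHS]mulr_natl le_eqVlt; apply/orP; left; apply/eqP; ring.
rewrite big_mkcond /=; apply: ler_sum => j _.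
have : 2 ^+ k * y / n%:R = (2 * srad n k y) ^+ k.
  by rewrite exprMn sradX ?(ltW y0)// mulrA.
move=> ->; case: ifP => _; last by apply: exprn_ge0; apply: mulr_ge0; [|exact: ltW].
apply: le_trans (ballvol_ub (tnth z.2 j) sy); apply: le_Ex.
- apply: bmfun_bool; apply: measurable_and; first exact: measurable_closest.
  exact: measurable_ball_cond.
- by apply: bmfun_bool; exact: measurable_ball_cond.
by move=> u; rewrite ler_nat; case: (closest _ _ _ _).
Qed.

Lemma gain_ge0 Z r y : 0 <= gain k m Z r y.
Proof. by apply: Ex_ge0 => z; apply: Ex_ge0. Qed.

End gain_gap.

Lemma expR_le_onem (R : realType) (y : R) : 0 <= y <= 2^-1 -> expR (- (2 * y)) <= 1 - y.
Proof.
move=> /andP[y0 y1]; have h := expR_ge1Dx (2 * y).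
rewrite expRN -[leLHS]mul1r ler_pdivrMr ?expR_gt0//.
apply: (@le_trans _ _ ((1 - y) * (1 + 2 * y))); first by nra.
by apply: ler_wpM2l => //; lra.
Qed.

Lemma sum_lt_ord (R : realType) m (c : R) :
  \sum_(j1 : 'I_m) \sum_(j2 : 'I_m | (j2 < j1)%N) c = c * (m%:R * (m%:R - 1) / 2).
Proof.
transitivity (\sum_(j1 : 'I_m) c * j1%:R).
  apply: eq_bigr => j1 _.
  by rewrite (big_ord_narrow (ltnW (ltn_ord j1))) sumr_const card_ord mulr_natr.
rewrite -mulr_sumr; congr (_ * _).
elim: m => [|m IH]; first by rewrite big_ord0; ring.
by rewrite big_ord_recr /= IH -natr1; field.
Qed.

Lemma two_point_mean (R : realType) (lam x y : R) (F : R -> R) :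
  let p := fun b : bool => if b then lam else 1 - lam in
  let q := fun b : bool => if b then x else y in
  jensen_gap p q F = F (lam * x + (1 - lam) * y) - (lam * F x + (1 - lam) * F y) /\
  spread p q = lam * (1 - lam) * (x - y) ^+ 2.
Proof.
move=> p q; rewrite /jensen_gap /spread !big_bool /p /q /=; split=> //; ring.
Qed.

(** * The modulus of concavity *)

Section strong_concavity.
Context (R : realType) (k : nat) (xi gamma : R).
Hypothesis k0 : (0 < k)%N.
Hypothesis xi0 : 0 < xi.
Hypothesis gamma0 : 0 < gamma.

(** Collects the m (m - 1) / 2 >= xi^2 n^2 / 4 pairs, the loss unitball^2 / (2 n^2) per pair, the
    volume 2^-k of the middle cube, and a lower bound for (1 - q)^(n + m), where q = 6^k gamma / n
    bounds the volume of a ball of radius 3 rho. *)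
Definition curvature : R :=
  xi ^+ 2 / 8 * unitball R k ^+ 2 * (2 ^+ k)^-1 *
  expR (- (2 * (6 ^+ k * gamma) * (1 + xi))).

Lemma curvature_gt0 : 0 < curvature.
Proof.
apply: mulr_gt0; last exact: expR_gt0.
apply: mulr_gt0; last by rewrite invr_gt0 exprn_gt0.
apply: mulr_gt0; first by rewrite divr_gt0// exprn_gt0.
exact/exprn_gt0/unitball_gt0.
Qed.

(** The last three bounds give rho <= 1/8, the estimate q <= 1/2 used to compare 1 - q with an
    exponential, and at least two demands. *)
Definition large n : Prop :=
  [/\ (0 < n)%N, 8 ^+ k * gamma <= n%:R, 2 * 6 ^+ k * gamma <= n%:R & 2 <= xi * n%:R].

Lemma eventually_large : exists N, forall n, (N <= n)%N -> large n.
Proof.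
pose B : R := 8 ^+ k * gamma + 2 * 6 ^+ k * gamma + 2 / xi.
have h1 : 0 <= 8 ^+ k * gamma by rewrite mulr_ge0 ?exprn_ge0// ltW.
have h2 : 0 <= 2 * 6 ^+ k * gamma by rewrite !mulr_ge0 ?exprn_ge0// ltW.
have h3 : 0 <= 2 / xi by rewrite divr_ge0// ltW.
exists (Num.truncn B).+1 => n Nn.
have Bn : B <= n%:R.
  by apply: le_trans (ltW (truncnS_gt B)) _; rewrite ler_nat.
split.
- exact: leq_trans Nn.
- by apply: le_trans Bn; rewrite /B; lra.
- by apply: le_trans Bn; rewrite /B; lra.
- by rewrite mulrC -ler_pdivrMr//; apply: le_trans Bn; rewrite /B; lra.
Qed.

Context (n m : nat).
Hypothesis hl : large n.
Hypothesis mn : m%:R = xi * n%:R.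
Context (Z : {set 'I_n}) (r : n.-tuple R).
Hypothesis hr : forall i, 0 <= tnth r i <= gamma.

Lemma gain_strongly_concave (I : finType) (p x : I -> R) :
  (forall i, 0 <= p i) -> \sum_i p i = 1 -> (forall i, 0 <= x i <= gamma) ->
  curvature * spread p x <= jensen_gap p x (gain k m Z r).
Proof.
move=> p0 p1 xg; have [n0 n8 n6 n2] := hl.
have nR : 0 < n%:R :> R by rewrite ltr0n.
have rhok : srad n k gamma ^+ k = gamma / n%:R by rewrite sradX// ltW.
have rho0 := srad_ge0 n k gamma.
have rho_gt0 : 0 < srad n k gamma by rewrite powR_gt0// divr_gt0.
have rho8 : srad n k gamma <= 8^-1.
  rewrite -(@ler_pXn2r _ k) ?nnegrE ?invr_ge0// rhok exprVn ler_pdivrMr//.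
  by rewrite ler_pdivlMl// exprn_gt0.
have rho6 : (6 * srad n k gamma) ^+ k <= 1.
  apply: exprn_ile1; first by rewrite mulr_ge0.
  by rewrite mulrC -ler_pdivlMr// (le_trans rho8)// div1r lef_pV2 ?posrE// ler_nat.
apply: le_trans _ (jensen_gap_gain_ge m k0 rho8 rho_gt0 rho6 p0 p1 xg Z hr).
rewrite sum_lt_ord.
set q := (6 * _) ^+ k.
have qE : q = 6 ^+ k * gamma / n%:R by rewrite /q exprMn rhok mulrA.
have q2 : 0 <= q <= 2^-1.
  rewrite qE; apply/andP; split.
    by rewrite divr_ge0 ?mulr_ge0 ?exprn_ge0// ltW.
  by rewrite ler_pdivrMr// ler_pdivlMl//; lra.
have e1 : expR (- (2 * (6 ^+ k * gamma) * (1 + xi))) <= (1 - q) ^+ (n + m).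
  have -> : - (2 * (6 ^+ k * gamma) * (1 + xi)) = (n + m)%:R * - (2 * q).
    rewrite natrD mn qE; field; exact: lt0r_neq0.
  rewrite expRM_natl; apply: lerXn2r; rewrite ?nnegrE ?expR_ge0//; last exact: expR_le_onem.
  by case/andP: q2 => _ q2; rewrite subr_ge0 (le_trans q2)// invf_le1// ler1n.
have s0 := spread_ge0 x p0 p1.
have mm : xi ^+ 2 * n%:R ^+ 2 / 4 <= m%:R * (m%:R - 1) / 2 by rewrite mn; nra.
set E := expR _ in e1 *.
rewrite /curvature -/E.
set W := (2 ^+ k)^-1; have W0 : 0 <= W by rewrite invr_ge0 exprn_ge0.
set U := unitball R k.
have E0 : 0 <= E by exact: expR_ge0.
apply: (@le_trans _ _ ((U / n%:R) ^+ 2 / 2 * spread p x * (W * E) * (xi ^+ 2 * n%:R ^+ 2 / 4))).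
  rewrite le_eqVlt; apply/orP; left; apply/eqP; field; exact: lt0r_neq0.
have V0 : 0 <= (U / n%:R) ^+ 2 / 2 * spread p x.
  by apply: mulr_ge0 => //; rewrite divr_ge0// sqr_ge0.
apply: ler_pM => //.
- by apply: mulr_ge0 => //; apply: mulr_ge0.
- by rewrite divr_ge0// mulr_ge0// sqr_ge0.
- by apply: ler_wpM2l => //; apply: ler_wpM2l.
Qed.

(** By concavity and nonnegativity at 0, the slope over [y, x] is at most gain(x) / x, which the
    union bound over the m balls controls. *)
Lemma gain_lipschitz y x : 0 <= y -> y <= x -> x <= gamma ->
  gain k m Z r x - gain k m Z r y <= 2 ^+ k * xi * (x - y).
Proof.
move=> y0; rewrite le_eqVlt => /predU1P[->|yx] xg; first by rewrite !subrr mulr0.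
have [n0 _ _ _] := hl; have nR : 0 < n%:R :> R by rewrite ltr0n.
have x0 : 0 < x by exact: le_lt_trans yx.
pose lam := y / x.
have l0 : 0 <= lam by rewrite divr_ge0// ltW.
have l1 : lam <= 1 by rewrite ler_pdivrMr// mul1r ltW.
have [gE sE] := two_point_mean lam x 0 (gain k m Z r).
have := @gain_strongly_concave bool (fun b => if b then lam else 1 - lam)
  (fun b => if b then x else 0).
rewrite gE sE => H.
have : curvature * (lam * (1 - lam) * (x - 0) ^+ 2) <=
  gain k m Z r (lam * x + (1 - lam) * 0) - (lam * gain k m Z r x + (1 - lam) * gain k m Z r 0).
  apply: H; [by case=> //; rewrite subr_ge0|by rewrite big_bool /=; ring|].
  by case; [rewrite xg ltW|rewrite lexx ltW].
rewrite mulr0 addr0 (_ : lam * x = y); last by rewrite /lam divfK// gt_eqF.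
have : 0 <= curvature * (lam * (1 - lam) * (x - 0) ^+ 2).
  apply: mulr_ge0; first exact: (ltW curvature_gt0).
  apply: mulr_ge0; last exact: sqr_ge0.
  by apply: mulr_ge0 => //; rewrite subr_ge0.
have := gain_ge0 k m Z r 0; have := gain_le m k0 Z r x0 n0.
have -> : 2 ^+ k * m%:R * x / n%:R = 2 ^+ k * xi * x.
  by rewrite mn; field; exact: lt0r_neq0.
move=> a1 a2 a3 a4.
have : (1 - lam) * gain k m Z r x <= (1 - lam) * (2 ^+ k * xi * x).
  by apply: ler_wpM2l => //; rewrite subr_ge0.
have -> : (1 - lam) * (2 ^+ k * xi * x) = 2 ^+ k * xi * (x - y).
  by rewrite /lam; field; exact: lt0r_neq0.
have h2 : 0 <= (1 - lam) * gain k m Z r 0 by apply: mulr_ge0 => //; rewrite subr_ge0.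
have a5 := le_trans a3 a4; rewrite subr_ge0 in a5.
have hx : gain k m Z r x = lam * gain k m Z r x + (1 - lam) * gain k m Z r x by ring.
move=> hT; rewrite lerBlDl hx; apply: lerD; last exact: hT.
by apply: le_trans a5; rewrite lerDl; exact: h2.
Qed.

End strong_concavity.

(** * Majorization *)

Section transfers.
Context (R : realType) (n : nat).
Implicit Types (x y : n.-tuple R) (i j l : 'I_n) (e : R).

Definition psum x (q : nat) : R := \sum_(i < n | (i < q)%N) tnth x i.

(** Prefixes are taken by position, without sorting: a transfer may destroy the order of [x], while
    [y] never changes. *)
Definition dominates_prefix x y : Prop :=
  (forall q, psum y q <= psum x q) /\ psum x n = psum y n.

Definition nonincr y : Prop := forall i j, (i <= j)%N -> tnth y j <= tnth y i.

Definition transfer x j l e : n.-tuple R :=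
  upd (upd x j (tnth x j - e)) l (tnth x l + e).

Lemma tnth_transfer x j l e i : j != l ->
  tnth (transfer x j l e) i = tnth x i - (i == j)%:R * e + (i == l)%:R * e.
Proof.
move=> jl; rewrite !tnth_upd; case: (eqVneq i l) => [->|il].
  by rewrite eq_sym (negbTE jl) mul0r mul1r subr0.
case: (eqVneq i j) => [->|ij]; first by rewrite mul1r mul0r addr0.
by rewrite !mul0r subr0 addr0.
Qed.

Lemma sum_delta (q : pred 'I_n) j e :
  \sum_(i | q i) (i == j)%:R * e = (q j)%:R * e.
Proof.
rewrite -mulr_suml; congr (_ * _); case: (boolP (q j)) => qj.
  rewrite (bigD1 j)//= eqxx big1 ?addr0// => i /andP[_ /negbTE ->].
  by [].
by rewrite big1// => i qi; case: eqP => // ij; rewrite -ij qi in qj.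
Qed.

Lemma psum_transfer x j l e q : j != l ->
  psum (transfer x j l e) q = psum x q - (j < q)%:R * e + (l < q)%:R * e.
Proof.
move=> jl; rewrite /psum; under eq_bigr do rewrite tnth_transfer//.
by rewrite big_split/= sumrB !sum_delta.
Qed.

Definition diffs x y : nat := #|[set i | tnth x i != tnth y i]%SET|.

(** Let l be the first index where x is below y; prefix dominance forces some j < l with x above y.
    The smaller of the two discrepancies is moved, so one coordinate becomes equal. As y is sorted,
    x_l + e <= y_l <= y_j <= x_j - e; prefixes between j and l stay dominant because x >= y before
    l. *)
Lemma transfer_step x y : nonincr y -> dominates_prefix x y -> x != y ->
  exists j l e, [/\ j != l, 0 < e, tnth x l + e <= tnth x j - e,
    dominates_prefix (transfer x j l e) y &
    (diffs (transfer x j l e) y < diffs x y)%N].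
Proof.
move=> ny [dxy txy] xy.
have psumn z : psum z n = \sum_i tnth z i by apply: eq_bigl => i; rewrite ltn_ord.
have [l0 l0P] : exists l, tnth x l < tnth y l.
  apply/existsP; apply: contraNT xy => /existsPn H; apply/eqP/eq_from_tnth.
  have xgey i : 0 <= tnth x i - tnth y i by rewrite subr_ge0 leNgt; exact: H.
  have := txy; rewrite !psumn => /eqP; rewrite -subr_eq0 -sumrB psumr_eq0 //.
  move=> /allP Z i; apply/eqP; rewrite -subr_eq0.
  by have := Z i (mem_index_enum i).
case: (arg_minnP (fun i : 'I_n => i : nat) (P := fun l => tnth x l < tnth y l) l0P).
move=> l xl lmin {l0 l0P}.
have ge_before i : (i < l)%N -> tnth y i <= tnth x i.
  by move=> il; rewrite leNgt; apply/negP => /lmin; rewrite leqNgt il.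
have [j /andP[jl yj]] : exists j, (j < l)%N && (tnth y j < tnth x j).
  apply/existsP; apply: contraT => /existsPn H; exfalso.
  have := dxy l.+1; apply/negP; rewrite -ltNge.
  rewrite /psum (bigD1 l)//= [ltRHS](bigD1 l)//=; apply: ltr_leD => //.
  apply: ler_sum => i /andP[il nil].
  have {il nil} il : (i < l)%N by rewrite ltn_neqAle -ltnS il andbT.
  by have := H i; rewrite il /= -leNgt.
have jnl : j != l by rewrite neq_ltn jl.
pose e := Num.min (tnth x j - tnth y j) (tnth y l - tnth x l).
have e1 : e <= tnth x j - tnth y j by rewrite ge_min lexx.
have e2 : e <= tnth y l - tnth x l by rewrite ge_min lexx orbT.
have e0 : 0 < e by rewrite lt_min !subr_gt0 yj.
have yjl : tnth y l <= tnth y j by apply: ny; exact: ltnW.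
exists j, l, e; split=> //; first by lra.
- split=> [q|]; rewrite psum_transfer//; last by rewrite !ltn_ord -txy; ring.
  have := dxy q; case: (ltnP l q) => lq; first by rewrite (ltn_trans jl lq); lra.
  case: (ltnP j q) => jq; last by lra.
  move=> _; rewrite mul1r mul0r addr0 lerBrDr -lerBrDl -sumrB.
  rewrite (bigD1 j)//=; apply: (le_trans e1); rewrite lerDl.
  by apply: sumr_ge0 => i /andP[iq _]; rewrite subr_ge0 ge_before// (leq_trans iq).
- apply: proper_card; apply/properP; split.
    apply/fintype.subsetP => i; rewrite !finset.inE tnth_transfer//.
    have [->|ij] := eqVneq i j; first by move=> _; rewrite gt_eqF.
    have [->|il] := eqVneq i l; first by move=> _; rewrite lt_eqF.
    by rewrite !mul0r subr0 addr0.
  have [h|h] := leP (tnth x j - tnth y j) (tnth y l - tnth x l).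
    exists j; first by rewrite finset.inE gt_eqF.
    rewrite finset.inE tnth_transfer// eqxx (negbTE jnl) mul1r mul0r addr0 negbK.
    by apply/eqP; rewrite /e (min_idPl h); ring.
  exists l; first by rewrite finset.inE lt_eqF.
  rewrite finset.inE tnth_transfer// eqxx [l == j]eq_sym (negbTE jnl) mul0r mul1r subr0 negbK.
  by apply/eqP; rewrite /e (min_idPr (ltW h)); ring.
Qed.

(** The counter records transfers, so that an error made at each of them is paid at most n times. *)
Lemma transfer_ind (Q : n.-tuple R -> nat -> Prop) y : nonincr y -> Q y 0%N ->
  (forall x N j l e, j != l -> 0 < e -> tnth x l + e <= tnth x j - e ->
     Q (transfer x j l e) N -> Q x N.+1) ->
  forall x, dominates_prefix x y -> exists2 N, (N <= n)%N & Q x N.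
Proof.
move=> ny Qy Qstep x dxy.
suff [N Nd QN] : exists2 N, (N <= diffs x y)%N & Q x N.
  exists N => //; apply: leq_trans Nd _.
  by rewrite -[leqRHS]card_ord max_card.
have [D] := ubnP (diffs x y); elim: D x dxy => // D IH x dxy; rewrite ltnS => dD.
have [->|xy] := eqVneq x y; first by exists 0%N.
have [j [l [e [jl e0 xe dt dd]]]] := transfer_step ny dxy xy.
have [N Nd QN] := IH _ dt (leq_trans dd dD).
exists N.+1; first exact: leq_ltn_trans Nd dd.
exact: (Qstep x N j l e).
Qed.

Definition doubly_stochastic (D : 'I_n -> 'I_n -> R) : Prop :=
  [/\ forall i l, 0 <= D i l, forall i, \sum_l D i l = 1 & forall l, \sum_i D i l = 1].

(** Hardy, Littlewood and Polya: a transfer is the mixture, with weight lam = e / (x_j - x_l), of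
    the identity and the transposition of j and l, and such mixtures compose to a doubly stochastic
    matrix. *)
Lemma dominates_stochastic x y : nonincr y -> dominates_prefix x y ->
  exists2 D, doubly_stochastic D & forall i, tnth y i = \sum_l D i l * tnth x l.
Proof.
move=> ny dxy.
pose Q x (N : nat) := exists2 D, doubly_stochastic D &
  forall i, tnth y i = \sum_l D i l * tnth x l.
have [||N _ //] := @transfer_ind Q y ny _ _ x dxy.
  exists (fun i l => (i == l)%:R).
    split=> [i l|i|l]; first by rewrite ler0n.
      by rewrite (bigD1 i)//= eqxx big1 ?addr0// => l; rewrite eq_sym => /negbTE ->.
    by rewrite (bigD1 l)//= eqxx big1 ?addr0// => i /negbTE ->.
  move=> i; rewrite (bigD1 i)//= eqxx mul1r big1 ?addr0// => l.
  by rewrite eq_sym => /negbTE ->; rewrite mul0r.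
clear x dxy; move=> x N j l e jl e0 xe [D [D0 D1 D2] yD].
pose lam := e / (tnth x j - tnth x l).
have g0 : 0 < tnth x j - tnth x l by lra.
have l0 : 0 <= lam by rewrite divr_ge0// ltW.
have l1 : lam <= 1 by rewrite ler_pdivrMr// mul1r; lra.
have lE : lam * (tnth x j - tnth x l) = e by rewrite /lam divfK// gt_eqF.
pose s := tperm j l.
have sI : injective s by exact: perm_inj.
exists (fun i a => (1 - lam) * D i a + lam * D i (s a)).
  split=> [i a|i|a].
  - by rewrite addr_ge0// mulr_ge0// subr_ge0.
  - by rewrite big_split/= -!mulr_sumr -(reindex_inj (P := xpredT) (F := D i) sI)/= D1; ring.
  - by rewrite big_split/= -!mulr_sumr !D2; ring.
move=> i; rewrite yD.
rewrite [RHS](eq_bigr (fun a => (1 - lam) * (D i a * tnth x a) + lam * (D i (s a) * tnth x a))); last first.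
  by move=> a _; ring.
rewrite big_split/= -!mulr_sumr [X in _ + lam * X](reindex_inj sI)/=.
rewrite !mulr_sumr -big_split/=; apply: eq_bigr => a _.
rewrite /s tpermK tnth_transfer//.
case: tpermP => [->|->|/eqP aj /eqP al].
- by rewrite eqxx (negbTE jl) mul1r mul0r addr0 -lE; ring.
- by rewrite eqxx [l == j]eq_sym (negbTE jl) mul0r mul1r subr0 -lE; ring.
- by rewrite (negbTE aj) (negbTE al) !mul0r subr0 addr0; ring.
Qed.

End transfers.

(** The difference of the two sides is 2 sum_i y_i (x_i - y_i). Abel summation makes it nonnegative:
    y decreases, the partial sums of x - y are nonnegative and the total is 0. *)
Lemma sumsq_gap (R : realType) n (x y : n.-tuple R) : nonincr y -> dominates_prefix x y ->
  \sum_i (tnth x i - tnth y i) ^+ 2 <= \sum_i tnth x i ^+ 2 - \sum_i tnth y i ^+ 2.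
Proof.
move=> ny [dxy txy].
rewrite -sumrB -subr_ge0 -sumrB.
rewrite (eq_bigr (fun i => 2 * (tnth y i * (tnth x i - tnth y i)))); last first.
  by move=> i _; ring.
rewrite -mulr_sumr mulr_ge0//.
case: n x y ny dxy txy => [|n'] x y ny dxy txy; first by rewrite big_ord0.
pose yy (q : nat) : R := tnth y (inord q).
suff H q : (q < n'.+1)%N -> yy q * (\sum_(i < n'.+1 | (i < q.+1)%N) (tnth x i - tnth y i)) <=
    \sum_(i < n'.+1 | (i < q.+1)%N) tnth y i * (tnth x i - tnth y i).
  have := H n' (ltnSn n'); rewrite sumrB -/(psum x n'.+1) -/(psum y n'.+1) txy subrr mulr0.
  by move=> h; apply: (le_trans h); rewrite le_eqVlt; apply/orP; left; apply/eqP; apply: eq_bigl => i; rewrite ltn_ord.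
have psplit (F : 'I_n'.+1 -> R) (q0 : nat) : (q0 < n'.+1)%N ->
    \sum_(i < n'.+1 | (i < q0.+1)%N) F i = \sum_(i < n'.+1 | (i < q0)%N) F i + F (inord q0).
  move=> qn; rewrite (bigD1 (inord q0)) /= ?inordK// addrC; congr (_ + _).
  apply: eq_bigl => i; rewrite ltnS [in RHS]ltn_neqAle andbC; congr (_ && _).
  by rewrite -val_eqE /= inordK.
elim: q => [|q IH] qn; rewrite psplit//.
  by rewrite [in leRHS]psplit// !big_pred0// !add0r.
rewrite [leRHS]psplit// mulrDr; apply: lerD => //.
apply: le_trans (IH (ltnW qn)); apply: ler_wpM2r.
  by rewrite sumrB subr_ge0; exact: dxy.
by apply: ny; rewrite !inordK// ltnW.
Qed.

Section sorting.
Context (R : realType) (n : nat).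
Implicit Types (r : n.-tuple R).

Definition decr_tuple r : n.-tuple R := [tuple (decr r)`_i | i < n].

Lemma decr_tupleE r : decr_tuple r = decr r :> seq R.
Proof.
rewrite /decr_tuple /= -{2}[decr r](mkseq_nth 0) size_sort size_tuple.
by rewrite /mkseq -val_enum_ord -map_comp.
Qed.

Lemma decr_tuple_perm r : exists s : {perm 'I_n}, decr_tuple r = tperm_tuple r s.
Proof.
have /tuple_permP[s E] : perm_eq (decr_tuple r) r by rewrite decr_tupleE perm_sort.
by exists s; apply: val_inj; rewrite /= E.
Qed.

Lemma nonincr_decr r : nonincr (decr_tuple r).
Proof.
move=> i j ij; rewrite !tnth_mktuple.
have st : sorted (>=%R : rel R) (decr r).
  by apply: sort_sorted => a b; exact: le_total.
have tr : transitive (>=%R : rel R) by move=> a b c; rewrite /= => h1 h2; exact: le_trans h2 h1.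
have rf : reflexive (>=%R : rel R) by move=> a /=.
by have := sorted_leq_nth tr rf 0 st; apply; rewrite ?inE ?size_sort ?size_tuple.
Qed.

Lemma psum_decr r q : (q <= n)%N -> psum (decr_tuple r) q = \sum_(i < q) (decr r)`_i.
Proof.
move=> qn; rewrite /psum (big_ord_narrow qn); apply: eq_bigr => i _.
by rewrite tnth_mktuple.
Qed.

Lemma majorizes_dominates r r' : majorizes r r' ->
  dominates_prefix (decr_tuple r) (decr_tuple r').
Proof.
move=> [H T]; split; last by rewrite !psum_decr.
have Hn : psum (decr_tuple r') n <= psum (decr_tuple r) n by rewrite !psum_decr// T.
move=> q; have [nq|qn] := leqP n q.
  have E (x : n.-tuple R) : psum x q = psum x n.
    by apply: eq_bigl => i; rewrite (ltn_ord i) (leq_trans (ltn_ord i) nq).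
  by rewrite !E.
rewrite !psum_decr ?(ltnW qn)//; case: q qn => [|q] qn; first by rewrite !big_ord0.
exact: H.
Qed.

Lemma decr_dist1_sumsq r r' : majorizes r r' ->
  decr_dist1 r r' ^+ 2 <=
  n%:R * (\sum_i tnth (decr_tuple r) i ^+ 2 - \sum_i tnth (decr_tuple r') i ^+ 2).
Proof.
move=> /majorizes_dominates/(sumsq_gap (@nonincr_decr r')) h.
apply: (@le_trans _ _ (n%:R * \sum_(i < n) ((decr r)`_i - (decr r')`_i) ^+ 2)).
  have := @cauchy_schwarz R _ (fun _ : 'I_n => 1) (fun i => `|(decr r)`_i - (decr r')`_i|).
  rewrite /decr_dist1; under eq_bigr do rewrite mul1r.
  move=> h1; apply: (le_trans h1); rewrite expr1n sumr_const card_ord.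
  by under eq_bigr do rewrite real_normK ?num_real//.
apply: ler_wpM2l => //; apply: le_trans h.
by apply: ler_sum => i _; rewrite !tnth_mktuple.
Qed.

End sorting.

(** * Random selections from a doubly stochastic matrix *)

Section product_weights.
Context (R : realType) (n : nat) (D : 'I_n -> 'I_n -> R).
Hypothesis DS : doubly_stochastic D.
Implicit Types (f : {ffun 'I_n -> 'I_n}) (i j l : 'I_n) (Phi : {ffun 'I_n -> 'I_n} -> R).

(** The probability of [f] when the values [f i] are independent with laws [D i]. *)
Definition weight f : R := \prod_i D i (f i).

Definition Ew Phi : R := \sum_f weight f * Phi f.

Definition updf f j l : {ffun 'I_n -> 'I_n} := [ffun i => if i == j then l else f i].

Lemma weight_ge0 f : 0 <= weight f.
Proof. by case: DS => D0 _ _; apply: prodr_ge0. Qed.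

Lemma eq_Ew Phi Psi : Phi =1 Psi -> Ew Phi = Ew Psi.
Proof. by move=> E; apply: eq_bigr => f _; rewrite E. Qed.

Lemma Ew_cst c : Ew (fun=> c) = c.
Proof.
rewrite /Ew -mulr_suml /weight -(bigA_distr_bigA (fun i l => D i l)) big1 ?mul1r//.
by case: DS.
Qed.

Lemma EwD Phi Psi : Ew (fun f => Phi f + Psi f) = Ew Phi + Ew Psi.
Proof. by rewrite /Ew -big_split; apply: eq_bigr => f _; rewrite mulrDr. Qed.

Lemma EwZ c Phi : Ew (fun f => c * Phi f) = c * Ew Phi.
Proof. by rewrite /Ew mulr_sumr; apply: eq_bigr => f _; rewrite mulrCA. Qed.

Lemma le_Ew Phi Psi : (forall f, Phi f <= Psi f) -> Ew Phi <= Ew Psi.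
Proof.
by move=> h; apply: ler_sum => f _; apply: ler_wpM2l => //; exact: weight_ge0.
Qed.

Lemma Ew_sum (I : finType) (F : I -> {ffun 'I_n -> 'I_n} -> R) :
  Ew (fun f => \sum_i F i f) = \sum_i Ew (F i).
Proof.
rewrite /Ew exchange_big; apply: eq_bigr => f _; rewrite mulr_sumr//.
Qed.

Lemma Ew_resample j Phi : Ew Phi = Ew (fun f => \sum_l D j l * Phi (updf f j l)).
Proof.
transitivity (\sum_f \sum_l weight f * D j l * Phi f).
  apply: eq_bigr => f _; rewrite -mulr_suml -mulr_sumr.
  by case: DS => _ -> _; rewrite mulr1.
rewrite /Ew pair_big /=.
under [RHS]eq_bigr do rewrite mulr_sumr.
rewrite pair_big /=.
(* An involution exchanging the value at [j] with a fresh draw; it preserves the product weight. *)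
pose h (q : {ffun 'I_n -> 'I_n} * 'I_n) := (updf q.1 j q.2, q.1 j).
have hK : cancel h h.
  move=> [f l]; rewrite /h /=; congr (_, _); last by rewrite ffunE eqxx.
  by apply/ffunP => i; rewrite !ffunE; case: eqP => // ->.
rewrite (reindex_inj (can_inj hK)) /=; apply: eq_bigr => -[f l] _ /=.
rewrite mulrA; congr (_ * _).
rewrite /weight (bigD1 j)//= [in RHS](bigD1 j)//= ffunE eqxx.
rewrite (eq_bigr (fun i => D i (f i))); last by move=> i /negbTE ij; rewrite ffunE ij.
by rewrite mulrAC [RHS]mulrAC; congr (_ * _); rewrite mulrC.
Qed.

Definition cnt f (q : nat) : R := \sum_i (f i <= q)%N%:R.

Lemma Ew_cnt_sq (q : nat) : (q < n)%N -> Ew (fun f => (cnt f q - q.+1%:R) ^+ 2) <= n%:R.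
Proof.
move=> qn; have [D0 D1 D2] := DS.
pose p i := \sum_l D i l * (l <= q)%N%:R.
pose Y i f : R := (f i <= q)%N%:R - p i.
have p01 i : 0 <= p i <= 1.
  apply/andP; split; first by apply: sumr_ge0 => l _; rewrite mulr_ge0.
  rewrite -(D1 i); apply: ler_sum => l _; rewrite ler_piMr//.
  by rewrite lern1 leq_b1.
(* The column sums enter here: the q + 1 columns up to [q] have total mass q + 1. *)
have sump : \sum_i p i = q.+1%:R.
  rewrite exchange_big /= (eq_bigr (fun l : 'I_n => (l <= q)%N%:R)); last first.
    by move=> l _; rewrite -mulr_suml D2 mul1r.
  rewrite -natr_sum; congr (_%:R).
  rewrite (eq_bigr (fun i : 'I_n => if (i < q.+1)%N then 1%N else 0%N)); last first.
    by move=> i _; rewrite ltnS; case: (i <= q)%N.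
  by rewrite -big_mkcond /= (big_ord_narrow qn) sum_nat_const card_ord muln1.
have XE f : cnt f q - q.+1%:R = \sum_i Y i f.
  by rewrite /cnt -sump -sumrB.
have E0 i : \sum_l D i l * ((l <= q)%N%:R - p i) = 0.
  under eq_bigr do rewrite mulrBr.
  by rewrite sumrB -mulr_suml D1 mul1r /p subrr.
have cross i j : i != j -> Ew (fun f => Y i f * Y j f) = 0.
  move=> ij; rewrite (Ew_resample i) -[RHS]Ew_cst; congr Ew; apply/funext => f.
  rewrite (eq_bigr (fun l => D i l * ((l <= q)%N%:R - p i) * Y j f)); last first.
    by move=> l _; rewrite /Y !ffunE eqxx eq_sym (negbTE ij) mulrA.
  by rewrite -mulr_suml E0 mul0r.
have diag i : Ew (fun f => Y i f * Y i f) <= 1.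
  rewrite -[leRHS]Ew_cst; apply: le_Ew => f; rewrite /Y.
  by have /andP[] := p01 i; case: (f i <= q)%N => /=; nra.
have -> : Ew (fun f => (cnt f q - q.+1%:R) ^+ 2) = \sum_i \sum_j Ew (fun f => Y i f * Y j f).
  under [RHS]eq_bigr do rewrite -Ew_sum.
  rewrite -Ew_sum; congr Ew; apply/funext => f.
  rewrite XE expr2 mulr_suml; apply: eq_bigr => i _.
  by rewrite mulr_sumr.
apply: (@le_trans _ _ (\sum_(i < n) 1)); last by rewrite sumr_const card_ord.
apply: ler_sum => i _; rewrite (bigD1 i)//= big1 ?addr0// => j ji.
by apply: cross; rewrite eq_sym.
Qed.

Lemma Ew_cnt_abs (q : nat) : (q < n)%N ->
  Ew (fun f => `|cnt f q - q.+1%:R|) <= Num.sqrt n%:R.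
Proof.
move=> qn; set s := Num.sqrt n%:R.
have n0 : 0 < n%:R :> R by rewrite ltr0n (leq_ltn_trans _ qn).
have s0 : 0 < s by rewrite sqrtr_gt0.
have s2 : s ^+ 2 = n%:R by rewrite sqr_sqrtr// ltW.
apply: (@le_trans _ _ (Ew (fun f => s / 2 + (2 * s)^-1 * (cnt f q - q.+1%:R) ^+ 2))).
  apply: le_Ew => f; set X := cnt f q - _.
  rewrite -[X ^+ 2](real_normK (num_real X)); move: (`|X|) => a.
  have -> : s / 2 + (2 * s)^-1 * a ^+ 2 = a + (2 * s)^-1 * (s - a) ^+ 2.
    by field; exact: lt0r_neq0.
  by rewrite lerDl mulr_ge0 ?sqr_ge0// invr_ge0 mulr_ge0// ltW.
rewrite EwD Ew_cst EwZ.
rewrite [leRHS](_ : s = s / 2 + (2 * s)^-1 * n%:R); last first.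
  by rewrite -s2; field; exact: lt0r_neq0.
rewrite lerD2l; apply: ler_wpM2l; last exact: Ew_cnt_sq.
by rewrite invr_ge0 mulr_ge0// ltW.
Qed.

End product_weights.

Section rearrangement.
Context (R : realType) (n : nat) (x : n.-tuple R).
Hypothesis nx : nonincr x.
Hypothesis x0 : forall i, 0 <= tnth x i.

Definition pick_tuple f : n.-tuple R := [tuple tnth x (f i) | i < n].

(** The default 0 past the end makes the last level the smallest entry, so the levels sum to the
    largest one. *)
Let xx (q : nat) : R := nth 0 x q.

Lemma level_sum (a : 'I_n) :
  tnth x a = \sum_(q < n) (xx q - xx q.+1) * (a <= q)%N%:R.
Proof.
have H p : (a <= p)%N -> \sum_(q < p) (xx q - xx q.+1) * (a <= q)%N%:R = xx a - xx p.
  elim: p => [|p IH].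
    by rewrite leqn0 big_ord0 => /eqP ->; rewrite subrr.
  rewrite big_ord_recr /=; case: (ltngtP a p) => // [ap _|pa ap|->].
  - by rewrite IH ?(ltnW ap)// mulr1; ring.
  - have -> : (a : nat) = p.+1 by apply/eqP; rewrite eqn_leq ap.
    rewrite subrr mulr0 addr0 big1// => q _.
    by rewrite leqNgt ltnS (ltnW (ltn_ord q)) mulr0.
  - rewrite mulr1 big1 ?add0r// => q _.
    by rewrite leqNgt ltn_ord mulr0.
rewrite H ?(ltnW (ltn_ord a))// /xx [X in _ - X]nth_default ?size_tuple// subr0.
exact: tnth_nth.
Qed.

Lemma level_ge0 (q : 'I_n) : 0 <= xx q - xx q.+1.
Proof.
rewrite subr_ge0 /xx; have [nq|qn] := leqP n q.+1.
  by rewrite nth_default ?size_tuple// -tnth_nth.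
by rewrite -(tnth_nth 0 x (Ordinal qn)) -tnth_nth; apply: nx => /=.
Qed.

Lemma nondecr_level (g : 'I_n -> 'I_n) (q : nat) (c := (\sum_(j < n) (g j <= q))%N) :
  (forall i j : 'I_n, (i <= j)%N -> (g i <= g j)%N) ->
  forall i : 'I_n, (g i <= q)%N = (i < c)%N.
Proof.
move=> ng i; rewrite /c; apply/idP/idP => [gq|].
  rewrite (_ : i.+1 = \sum_(j < n | (j < i.+1)%N) 1)%N; last first.
    by rewrite (big_ord_narrow (ltn_ord i)) sum_nat_const card_ord muln1.
  rewrite big_mkcond /=; apply: leq_sum => j _.
  case: ifP => // ji; rewrite lt0b; apply: leq_trans gq.
  exact: ng.
apply: contraTT; rewrite -ltnNge -leqNgt => qg.
rewrite (@leq_trans (\sum_(j < n | (j < i)%N) 1))//; last first.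
  by rewrite (big_ord_narrow (ltnW (ltn_ord i))) sum_nat_const card_ord muln1.
rewrite [leqRHS]big_mkcond /=; apply: leq_sum => j _.
case: ltnP => ij; first exact: leq_b1.
by rewrite leqn0 eqb0 -ltnNge (leq_trans qg)// ng.
Qed.

Lemma sum_initial_dist (c d : nat) : (c <= n)%N -> (d <= n)%N ->
  \sum_(i < n) `|(i < c)%N%:R - (i < d)%N%:R| = `|c%:R - d%:R| :> R.
Proof.
wlog cd : c d / (c <= d)%N.
  move=> H cn dn; have [cd|/ltnW dc] := leqP c d; first exact: H.
  by rewrite distrC -H//; apply: eq_bigr => i _; rewrite distrC.
move=> cn dn.
have sumlt e : (e <= n)%N -> \sum_(i < n) (i < e)%N%:R = e%:R :> R.
  move=> en; rewrite -natr_sum; congr (_%:R).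
  rewrite (eq_bigr (fun i : 'I_n => if (i < e)%N then 1%N else 0%N)); last first.
    by move=> i _; case: (i < e)%N.
  by rewrite -big_mkcond /= (big_ord_narrow en) sum_nat_const card_ord muln1.
rewrite distrC ger0_norm ?subr_ge0 ?ler_nat// -(sumlt c cn) -(sumlt d dn) -sumrB.
apply: eq_bigr => i _; rewrite distrC ger0_norm// subr_ge0 ler_nat.
by case: (ltnP i c) => // ic; rewrite (leq_trans ic cd).
Qed.

(** Sorting the indices f i sorts the selected entries. At each level both vectors are then
    indicators of initial segments, of lengths q + 1 and [cnt R f q], whose l^1 distance is the
    difference of the lengths. *)
Lemma sorted_pick_dist (f : {ffun 'I_n -> 'I_n}) :
  exists s : {perm 'I_n},
  \sum_i `|tnth x i - tnth (tperm_tuple (pick_tuple f) s) i| <=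
  \sum_(q < n) (xx q - xx q.+1) * `|cnt R f q - q.+1%:R|.
Proof.
pose t := [tuple f i | i < n].
pose le_val (a b : 'I_n) := (a <= b)%N.
have tot : total le_val by move=> a b; exact: leq_total.
pose st := sort_tuple le_val t.
have /tuple_permP[s sE] : perm_eq st t by rewrite perm_sort.
exists s; pose g (i : 'I_n) := f (s i).
have stE i : tnth st i = g i.
  have -> : st = [tuple tnth t (s j) | j < n] by apply: val_inj; exact: sE.
  by rewrite !tnth_mktuple.
have ng (i j : 'I_n) : (i <= j)%N -> (g i <= g j)%N.
  move=> ij; rewrite -!stE !(tnth_nth i).
  have tr : transitive le_val by move=> a b c; exact: leq_trans.
  have rf : reflexive le_val by move=> a; exact: leqnn.
  apply: (sorted_leq_nth tr rf i (sort_sorted tot t)) => //;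
    by rewrite inE size_sort size_tuple.
have cE q : cnt R f q = (\sum_(i < n) (g i <= q))%N%:R.
  by rewrite /cnt natr_sum /g (reindex_inj (@perm_inj _ s)).
have cn q : ((\sum_(i < n) (g i <= q)) <= n)%N.
  rewrite -[leqRHS]card_ord -sum1_card; apply: leq_sum => i _; exact: leq_b1.
pose B : R := \sum_(i < n) \sum_(q < n) (xx q - xx q.+1) *
    `|(i < q.+1)%N%:R - (g i <= q)%N%:R|.
apply: (@le_trans _ _ B).
  apply: ler_sum => i _; rewrite !tnth_mktuple -/(g i) (level_sum i) (level_sum (g i)) -sumrB.
  apply: le_trans (ler_norm_sum _ _ _) _; apply: ler_sum => q _.
  by rewrite -mulrBr normrM ger0_norm ?level_ge0// ltnS.
rewrite /B exchange_big /=; apply: ler_sum => q _; rewrite -mulr_sumr.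
apply: ler_wpM2l; first exact: level_ge0.
rewrite cE -(sum_initial_dist (cn q) (ltn_ord q)).
by apply: ler_sum => i _; rewrite (nondecr_level q ng i) distrC.
Qed.

End rearrangement.

Section hybrid.
Context (R : realType) (n : nat).
Implicit Types (u v : n.-tuple R) (j : 'I_n).

(** Interpolation as in Lindeberg's method: consecutive hybrids differ in one coordinate. *)
Definition hybrid u v (q : nat) : n.-tuple R :=
  [tuple if (i < q)%N then tnth u i else tnth v i | i < n].

Lemma hybrid0 u v : hybrid u v 0 = v.
Proof. by apply: eq_from_tnth => i; rewrite tnth_mktuple. Qed.

Lemma hybridn u v : hybrid u v n = u.
Proof. by apply: eq_from_tnth => i; rewrite tnth_mktuple ltn_ord. Qed.

Lemma hybrid_upd u v j : hybrid u v j = upd (hybrid u v j) j (tnth v j).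
Proof.
apply: eq_from_tnth => i; rewrite tnth_upd; case: eqP => // ->.
by rewrite tnth_mktuple ltnn.
Qed.

Lemma hybridS u v j : hybrid u v j.+1 = upd (hybrid u v j) j (tnth u j).
Proof.
apply: eq_from_tnth => i; rewrite tnth_upd !tnth_mktuple; case: eqP => [->|/eqP ij].
  by rewrite ltnSn.
by rewrite ltnS leq_eqVlt val_eqE (negbTE ij).
Qed.

Lemma hybrid_itv u v q (c : R) : (forall i, 0 <= tnth u i <= c) ->
  (forall i, 0 <= tnth v i <= c) -> forall i, 0 <= tnth (hybrid u v q) i <= c.
Proof. by move=> hu hv i; rewrite tnth_mktuple; case: ifP. Qed.

End hybrid.

(** * Comparison by resampling *)

Section resampling.
Context (R : realType) (k : nat) (xi gamma : R).
Hypothesis k0 : (0 < k)%N.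
Hypothesis xi0 : 0 < xi.
Hypothesis gamma0 : 0 < gamma.
Context (n m : nat).
Hypothesis hl : large k xi gamma n.
Hypothesis mn : m%:R = xi * n%:R.
Implicit Types (u v x y : n.-tuple R).

Lemma gain_nondecr Z u : nondecr_ge0 (gain k m Z u).
Proof.
move=> a b a0 ab; apply: le_Ex.
- refine (@bmfun_Ex _ _ _ _ _ (location_prob R k n m) (uniform_cube R k) (fun w => (covers n (freed Z u w.1) w.1.2 a w.2)%:R) _).
  exact: (@bmfun_covers_freed R k n m Z u a).
- refine (@bmfun_Ex _ _ _ _ _ (location_prob R k n m) (uniform_cube R k) (fun w => (covers n (freed Z u w.1) w.1.2 b w.2)%:R) _).
  exact: (@bmfun_covers_freed R k n m Z u b).
move=> z; have bc c : bmfun (fun w => (covers n (freed Z u z) z.2 c w)%:R : R).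
  apply: bmfun_bool; apply: measurable_covers; first exact: measurable_cst.
  exact: measurable_id.
apply: le_Ex => // w; rewrite ler_nat; case: (boolP (covers _ _ _ a _)) => // /exists_inP[j jA h].
have -> // : covers n (freed Z u z) z.2 b w.
by apply/exists_inP; exists j => //; apply: le_trans h _; exact: le_srad.
Qed.

Lemma mu_lipschitz u v : (forall i, 0 <= tnth u i <= gamma) ->
  (forall i, 0 <= tnth v i <= gamma) ->
  mu k m u - mu k m v <= 2 ^+ k * xi * \sum_i `|tnth u i - tnth v i|.
Proof.
move=> hu hv.
have L0 : 0 <= 2 ^+ k * xi by rewrite mulr_ge0 ?exprn_ge0// ltW.
have step (j : 'I_n) : mu k m (hybrid u v j.+1) - mu k m (hybrid u v j) <=
    2 ^+ k * xi * `|tnth u j - tnth v j|.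
  rewrite hybridS [X in _ - mu _ _ X]hybrid_upd !mu_upd opprD addrACA subrr add0r.
  have hh := hybrid_itv j hu hv.
  have /andP[u0 ug] := hu j; have /andP[v0 vg] := hv j.
  have [vu|/ltW uv] := leP (tnth v j) (tnth u j).
    rewrite ger0_norm ?subr_ge0//.
    exact: (gain_lipschitz k0 xi0 gamma0 hl mn _ hh).
  apply: (@le_trans _ _ 0); last by rewrite mulr_ge0.
  by rewrite subr_le0; exact: gain_nondecr.
rewrite -{1}(hybridn u v) -{2}(hybrid0 u v) mulr_sumr.
have -> : mu k m (hybrid u v n) - mu k m (hybrid u v 0) =
   \sum_(j < n) (mu k m (hybrid u v j.+1) - mu k m (hybrid u v j)).
  have T := telescope_sumr (fun q => mu k m (hybrid u v q)) (leq0n n).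
  rewrite big_mkord in T; exact: (esym T).
by apply: ler_sum => j _; exact: step.
Qed.

(** Coordinates of y are replaced one by one by random entries of x. With the others fixed, the mean
    of coordinate j is y_j and mu is a constant plus the gain, so each replacement loses at least
    the curvature times the variance of [D j]. *)
Lemma mu_resample D x y : doubly_stochastic D ->
  (forall i, tnth y i = \sum_l D i l * tnth x l) ->
  (forall i, 0 <= tnth x i <= gamma) ->
  Ew D (fun f => mu k m (pick_tuple x f)) +
    curvature k xi gamma * (\sum_i tnth x i ^+ 2 - \sum_i tnth y i ^+ 2) <= mu k m y.
Proof.
move=> DS yD hx; have [D0 D1 D2] := DS.
have hy i : 0 <= tnth y i <= gamma by rewrite yD; exact: mean_itv.
have hp f i : 0 <= tnth (pick_tuple x f) i <= gamma by rewrite tnth_mktuple.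
pose c := curvature k xi gamma.
pose V q f := hybrid (pick_tuple x f) y q.
have [W WE] : exists W : nat -> R, forall q, W q = Ew D (fun f => mu k m (V q f)).
  by exists (fun q => Ew D (fun f => mu k m (V q f))).
have step (j : 'I_n) : W j.+1 + c * spread (D j) (tnth x) <= W j.
  rewrite !WE.
  rewrite [X in X + _](Ew_resample DS j) -[X in _ + X](Ew_cst DS) -EwD.
  apply: (le_Ew DS) => f.
  have E l : V j.+1 (updf f j l) = upd (V j f) j (tnth x l).
    apply: eq_from_tnth => i; rewrite tnth_upd !tnth_mktuple ffunE; case: eqP => [->|/eqP ij].
      by rewrite ltnSn.
    by rewrite ltnS leq_eqVlt val_eqE (negbTE ij).
  under eq_bigr do rewrite E mu_upd mulrDr.
  rewrite big_split/= -mulr_suml D1 mul1r.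
  rewrite [leRHS](_ : _ = base k m [set j]%SET (V j f) + gain k m [set j]%SET (V j f) (tnth y j)); last first.
    by rewrite -mu_upd -hybrid_upd.
  rewrite -addrA lerD2l addrC -lerBrDr yD.
  exact: (gain_strongly_concave k0 gamma0 hl mn [set j]%SET
    (hybrid_itv j (hp f) hy) (D0 j) (D1 j) hx).
(* Column sums 1 turn the total of the second moments into the sum of squares of [x]; the means are
   the entries of [y]. *)
have -> : \sum_i tnth x i ^+ 2 - \sum_i tnth y i ^+ 2 = \sum_j spread (D j) (tnth x).
  rewrite /spread sumrB; congr (_ - _); last by apply: eq_bigr => i _; rewrite yD.
  rewrite exchange_big/=; apply: eq_bigr => l _.
  by rewrite -mulr_suml D2 mul1r.
rewrite mulr_sumr -/c.
have E0 : mu k m y = W 0%N.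
  by rewrite -[LHS](Ew_cst DS) WE; apply: eq_Ew => f; rewrite /V hybrid0.
have En : Ew D (fun f => mu k m (pick_tuple x f)) = W n.
  by rewrite WE; apply: eq_Ew => f; rewrite /V hybridn.
rewrite E0 En -lerBrDl; clear - step.
have T := telescope_sumr (fun q => - W q) (leq0n n).
rewrite big_mkord opprK addrC in T; rewrite -T.
by apply: ler_sum => j _; rewrite opprK addrC lerBrDl.
Qed.

(* [cnt f q] is a sum of independent indicators with mean q + 1, hence within
   sqrt n of it on average; summing over the levels of [x] bounds the l^1 distance. *)
Lemma mu_pick_ge D x : doubly_stochastic D -> nonincr x ->
  (forall i, 0 <= tnth x i <= gamma) ->
  mu k m x - 2 ^+ k * xi * gamma * Num.sqrt n%:R <= Ew D (fun f => mu k m (pick_tuple x f)).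
Proof.
move=> DS nx hx.
have x0 i : 0 <= tnth x i by have /andP[] := hx i.
have L0 : 0 <= 2 ^+ k * xi by rewrite mulr_ge0 ?exprn_ge0// ltW.
pose w (q : nat) : R := nth 0 x q - nth 0 x q.+1.
have w0 (q : 'I_n) : 0 <= w q := level_ge0 nx x0 q.
pose T (f : {ffun 'I_n -> 'I_n}) : R := \sum_(q < n) w q * `|cnt R f q - q.+1%:R|.
apply: (@le_trans _ _ (Ew D (fun f => mu k m x - 2 ^+ k * xi * T f))); last first.
  apply: le_Ew => // f.
  have [s sT] := sorted_pick_dist nx x0 f.
  rewrite -(mu_perm k m (pick_tuple x f) s) lerBlDr -lerBlDl.
  apply: le_trans (mu_lipschitz hx _) _.
    by move=> i; rewrite !tnth_mktuple.
  exact: ler_wpM2l.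
have -> : Ew D (fun f => mu k m x - 2 ^+ k * xi * T f) =
    mu k m x - 2 ^+ k * xi * \sum_(q < n) w q * Ew D (fun f => `|cnt R f q - q.+1%:R|).
  rewrite -[in RHS](Ew_cst DS (mu k m x)).
  under eq_bigr do rewrite -EwZ.
  rewrite -Ew_sum -mulNr -EwZ -EwD; apply: eq_Ew => f.
  by rewrite mulNr.
rewrite lerD2l lerN2 -!mulrA; do 2 (apply: ler_wpM2l; first by rewrite ?exprn_ge0// ltW).
apply: (@le_trans _ _ (\sum_(q < n) w q * Num.sqrt n%:R)).
  by apply: ler_sum => q _; apply: ler_wpM2l => //; exact: Ew_cnt_abs.
rewrite -mulr_suml; apply: ler_wpM2r; first exact: sqrtr_ge0.
have [n0 _ _ _] := hl.
have := level_sum x (Ordinal n0); rewrite /w => E.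
have -> : \sum_(q < n) (nth 0 x q - nth 0 x q.+1) = tnth x (Ordinal n0).
  by rewrite E; apply: eq_bigr => q _; rewrite mulr1.
by have /andP[] := hx (Ordinal n0).
Qed.

Lemma mu_majorization x y : nonincr x -> nonincr y -> dominates_prefix x y ->
  (forall i, 0 <= tnth x i <= gamma) ->
  mu k m x + curvature k xi gamma * (\sum_i tnth x i ^+ 2 - \sum_i tnth y i ^+ 2)
    - 2 ^+ k * xi * gamma * Num.sqrt n%:R <= mu k m y.
Proof.
move=> nx ny dxy hx.
have [D DS yD] := dominates_stochastic ny dxy.
apply: le_trans (mu_resample DS yD hx); rewrite addrAC lerD2r.
exact: mu_pick_ge.
Qed.

End resampling.

(** * Separation on the line *)

Section line_cells.
Context (R : realType).
Notation U := (uniform_prob (@ltr01 R)).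
Notation pt := (1.-tuple (measurableTypeR R)).
Notation dst := (@dist2 R 1).
Notation P := (uniform_cube R 1).

Lemma Ex_uniform_itv (a b : R) : 0 <= a -> a <= b -> b <= 1 ->
  Ex U (fun x : measurableTypeR R => ((a <= x) && (x < b))%:R) = b - a.
Proof.
move=> a0 ab b1.
have mb : measurable_fun setT (fun x : measurableTypeR R => (a <= x) && (x < b)).
  apply: measurable_and; first exact: measurable_fun_ler.
  exact: measurable_fun_ltr.
apply: EFin_inj; rewrite EFin_Ex; last exact: bmfun_bool.
rewrite integral_uniform; last 2 first.
- by apply/measurable_EFinP; have [] := bmfun_bool R mb.
- by move=> x; rewrite lee_fin.
rewrite subr0 invr1 mul1e integral_mkcond.
rewrite (_ : (\int[_]_x _)%E = (\int[@lebesgue_measure R]_x (\1_(`[a, b[%classic) x)%:E)%E); last first.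
  apply: eq_integral => x _; rewrite patchE indicE.
  have -> : (x \in `[a, b[%classic) = (a <= x) && (x < b) :> bool.
    by apply/idP/idP; rewrite inE/= in_itv.
  case: ifPn => // xN; case: (boolP ((a <= x) && (x < b))) => // xab; exfalso.
  move/negP: xN; apply; rewrite inE/= in_itv/=.
  move/andP: xab => [ax xb]; apply/andP; split; first exact: le_trans ax.
  exact: ltW (lt_le_trans xb b1).
rewrite integral_indic//= setIT lebesgue_measure_itv/= lte_fin.
by case: ltP => // ba; rewrite (_ : b = a) ?subrr//; apply/eqP; rewrite eq_le ab ba.
Qed.

Definition pos (x : pt) : R := tnth x ord0.

Lemma measurable_pos : measurable_fun setT pos.
Proof. exact: measurable_tnth. Qed.

Lemma Ex_line (f : R -> R) : bmfun (f : measurableTypeR R -> R) ->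
  Ex P (fun u => f (pos u)) = Ex U (f : measurableTypeR R -> R).
Proof.
move=> bf; rewrite /uniform_cube Ex_iidS; last first.
  exact: (bmfun_comp bf measurable_pos).
apply: eq_Ex => x; rewrite -[RHS](Ex_cst (iid_prob U 0)).
by apply: eq_Ex => t.
Qed.

Lemma dist2_line (x y : pt) : dst x y <= `|pos x - pos y|.
Proof.
rewrite -[leRHS]mul1r; apply: dist2_le_coord => // i.
by rewrite (ord1 i).
Qed.

Variable w : R.
Hypothesis w0 : 0 < w.

Definition cell_index (x : pt) : nat := Num.truncn (pos x / w).

Lemma cell_indexE q x : 0 <= pos x ->
  (cell_index x == q) = (q%:R * w <= pos x) && (pos x < q.+1%:R * w).
Proof.
move=> x0; rewrite /cell_index truncn_eq; last by rewrite divr_ge0// ltW.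
by rewrite ler_pdivlMr// ltr_pdivrMr.
Qed.

Lemma measurable_cell_index q : measurable_fun setT (fun x => cell_index x == q).
Proof.
(* Negative positions are truncated to cell 0 and need their own clause. *)
rewrite (_ : (fun x => _) = fun x =>
   ((0 <= pos x) && ((q%:R * w <= pos x) && (pos x < q.+1%:R * w))) ||
   ((pos x < 0) && (q == 0%N))).
  have mp := measurable_pos.
  apply: measurable_or; apply: measurable_and.
  - by apply: measurable_fun_ler => //; exact: measurable_cst.
  - apply: measurable_and; first by apply: measurable_fun_ler => //; exact: measurable_cst.
    by apply: measurable_fun_ltr => //; exact: measurable_cst.
  - by apply: measurable_fun_ltr => //; exact: measurable_cst.
  - exact: measurable_cst.
apply/funext => x; case: (lerP 0 (pos x)) => x0; first by rewrite cell_indexE// orbF.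
rewrite /cell_index; have -> : Num.truncn (pos x / w) = 0%N.
  apply/truncn0Pn; rewrite -ltNge ltr_pdivrMr// mul1r; exact: lt_trans x0 w0.
by rewrite eq_sym.
Qed.

Lemma Ex_cell_index q : q.+1%:R * w <= 1 ->
  Ex P (fun x => (cell_index x == q)%:R) = w.
Proof.
move=> qw.
pose g (x : R) : R := ((q%:R * w <= x) && (x < q.+1%:R * w))%:R.
have mg : measurable_fun setT (fun x : measurableTypeR R => (q%:R * w <= x) && (x < q.+1%:R * w)).
  apply: measurable_and; first exact: measurable_fun_ler.
  exact: measurable_fun_ltr.
have bg : bmfun (g : measurableTypeR R -> R) by exact: bmfun_bool.
have w0' := ltW w0.
have -> : w = Ex P (fun x => g (pos x)).
  rewrite (Ex_line bg) Ex_uniform_itv.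
  - by rewrite -natr1; ring.
  - by rewrite mulr_ge0.
  - by rewrite -natr1 mulrDl lerDl mul1r.
  - exact: qw.
have bc : bmfun (fun x => (cell_index x == q)%:R : R) by apply: bmfun_bool; exact: measurable_cell_index.
have bgp := bmfun_comp bg measurable_pos.
have E x : incube x -> (cell_index x == q)%:R = g (pos x).
  by move=> /incubeP/(_ ord0)/andP[x0 _]; rewrite /g cell_indexE.
by apply/eqP; rewrite eq_le; apply/andP; split;
  apply: (le_Ex_as (C := @incube R 1)) => //;
  (exact: measurable_incube || exact: Ex_incube || (by move=> x ix; rewrite E)).
Qed.

Section separation.
Context (n m : nat) (gamma : R) (J : nat).
Hypothesis n0 : (0 < n)%N.
Hypothesis wE : w = 3 * gamma / n%:R.
Notation loc := ((n.-tuple pt) * (m.-tuple pt))%type.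
Notation LP := (location_prob R 1 n m).

(** The first condition discards blocks that leave [0, 1], whose cells need not have probability
    [w]. *)
Definition crowded (q : nat) (s : n.-tuple pt) : bool :=
  ((q + J)%:R * w <= 1) && all_hit cell_index (iota q J) s.

(* The cell is three times as wide as the largest range, so no demand is within
   reach of supplies on both sides. *)
Lemma gap_disconnected (r : n.-tuple R) (z : loc) i l (q : nat) :
  (forall a, 0 <= tnth r a <= gamma) ->
  pos (tnth z.1 i) < q%:R * w -> q.+1%:R * w <= pos (tnth z.1 l) ->
  (forall a, pos (tnth z.1 a) < q%:R * w \/ q.+1%:R * w <= pos (tnth z.1 a)) ->
  disconnected (service_graph r z.1 z.2) i l.
Proof.
move=> hr iq lq H.
exists [set a | pos (tnth z.1 a) < q%:R * w]%SET,
  [set b | pos (tnth z.2 b) < q%:R * w + w / 2]%SET; split.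
- by rewrite finset.inE.
- by rewrite finset.inE -leNgt; apply: le_trans lq; rewrite ler_wpM2r ?ler_nat// ltW.
move=> a b; rewrite /service_graph !finset.inE => ab.
have /andP[r0 rg] := hr a.
have := le_trans (coord_le_dist2 (tnth z.1 a) (tnth z.2 b) ord0) ab.
rewrite invr1 powRr1 ?divr_ge0// -/(pos (tnth z.1 a)) -/(pos (tnth z.2 b)) => h.
have {}h : `|pos (tnth z.1 a) - pos (tnth z.2 b)| <= w / 3.
  apply: le_trans h _; rewrite wE mulrAC [3 * gamma]mulrC mulfK ?pnatr_eq0//.
  by rewrite ler_wpM2r.
move: h; rewrite ler_norml => /andP[h1 h2].
have [ha|ha] := H a.
  by rewrite ha; apply/esym; lra.
have -> : (pos (tnth z.1 a) < q%:R * w) = false.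
  by apply/negbTE; rewrite -leNgt; apply: le_trans ha; rewrite ler_wpM2r ?ler_nat// ltW.
apply/esym/negbTE; rewrite -leNgt; rewrite -natr1 mulrDl mul1r in ha; lra.
Qed.

(** The [J] cells following the cell of [i] end before [l]; not being crowded, they include an empty
    cell, which is the gap. *)
Lemma far_disconnected (r : n.-tuple R) (z : loc) i l :
  (forall a, 0 <= tnth r a <= gamma) -> all (@incube R 1) z.1 ->
  (forall q, q%:R * w <= 1 -> ~~ crowded q z.1) ->
  (J + 2)%:R * w < pos (tnth z.1 l) - pos (tnth z.1 i) ->
  disconnected (service_graph r z.1 z.2) i l.
Proof.
move=> hr /all_tnthP iz nc far.
have in01 a : 0 <= pos (tnth z.1 a) <= 1 by have /incubeP/(_ ord0) := iz a.
pose q0 := (cell_index (tnth z.1 i)).+1.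
have /andP[i0 i1] := in01 i; have /andP[l0 l1] := in01 l.
have := cell_indexE (cell_index (tnth z.1 i)) i0; rewrite eqxx => /esym/andP[c1 c2].
rewrite natrD mulrDl in far.
have c3 : q0%:R * w <= pos (tnth z.1 i) + w.
  by rewrite /q0 -natr1 mulrDl mul1r lerD2r.
have J0 : 0 <= J%:R * w by rewrite mulr_ge0// ltW.
have q1 : q0%:R * w <= 1 by lra.
have := nc q0 q1; rewrite /crowded natrD mulrDl negb_and => /orP[|].
  by rewrite -ltNge => h; exfalso; lra.
move=> /allPn[q]; rewrite mem_iota => /andP[q0q qJ] /hasPn noq.
have qJ' : q.+1%:R * w <= (q0 + J)%:R * w by rewrite ler_wpM2r ?ler_nat// ltW.
rewrite natrD mulrDl in qJ'.
have q0q' : q0%:R * w <= q%:R * w by rewrite ler_wpM2r ?ler_nat// ltW.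
apply: (@gap_disconnected r z i l q) => //.
- exact: lt_le_trans c2 q0q'.
- lra.
move=> a; have /andP[a0 _] := in01 a.
have := noq _ (mem_tnth a z.1); rewrite cell_indexE// negb_and -ltNge -leNgt.
by case/orP => h; [left|right].
Qed.

Lemma disconnectedC (S D : finType) (G : S -> D -> bool) i l :
  disconnected G i l -> disconnected G l i.
Proof.
move=> [K [L [iK lK KL]]]; exists (~: K)%SET, (~: L)%SET; split.
- by rewrite finset.inE.
- by rewrite finset.inE negbK.
by move=> a b Gab; rewrite !finset.inE (KL a b Gab).
Qed.

(** Every block that starts inside [0, 1] has a starting index below this number. *)
Let B := (Num.truncn w^-1).+1.

(** It involves only supply positions and not the ranges, so one bound serves every vector met along
    the transfers. *)
Definition unsafe i l (z : loc) : bool :=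
  [|| ~~ all (@incube R 1) z.1, has (fun q => crowded q z.1) (iota 0 B) |
      dst (tnth z.1 i) (tnth z.1 l) <= (J + 2)%:R * w].

Lemma safe_disconnected (r : n.-tuple R) (z : loc) i l :
  (forall a, 0 <= tnth r a <= gamma) -> ~~ unsafe i l z ->
  disconnected (service_graph r z.1 z.2) i l.
Proof.
move=> hr; rewrite /unsafe 2!negb_or negbK -ltNge => /and3P[iz nc far].
have {}nc q : q%:R * w <= 1 -> ~~ crowded q z.1.
  move=> qw; apply: contra nc => cq; apply/hasP; exists q => //; rewrite mem_iota add0n /= /B ltnS truncn_ge_nat ?invr_ge0 ?(ltW w0)//.
  by rewrite -[leRHS]mul1r ler_pdivlMr.
have := lt_le_trans far (dist2_line _ _).
have [il|li] := leP (pos (tnth z.1 i)) (pos (tnth z.1 l)).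
  by rewrite distrC ger0_norm ?subr_ge0// => h; exact: far_disconnected.
rewrite ger0_norm ?subr_ge0 ?(ltW li)// => h.
by apply: disconnectedC; exact: far_disconnected.
Qed.

Lemma measurable_crowded q : measurable_fun setT (crowded q).
Proof.
apply: measurable_and; first exact: measurable_cst.
apply: measurable_all_hit => q'; exact: measurable_cell_index.
Qed.

Lemma measurable_unsafe i l : measurable_fun setT (unsafe i l).
Proof.
apply: measurable_or.
  apply: measurable_neg.
  exact: (measurableT_comp (measurable_all (@measurable_incube R 1)) measurable_fst).
apply: measurable_or.
  elim: (iota 0 B) => [|q Q IH] /=; first exact: measurable_cst.
  apply: measurable_or => //.
  exact: (measurableT_comp (measurable_crowded q) measurable_fst).
apply: measurable_fun_ler; last exact: measurable_cst.
by apply: measurable_dist2; exact: measurable_sup.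
Qed.

Hypothesis w1 : w <= 1.

(** Union bound: [B] possible crowded blocks, plus the event that the two supplies are close,
    estimated by redrawing one of them. *)
Lemma Ex_unsafe i l : i != l ->
  Ex LP (fun z => (unsafe i l z)%:R) <=
  B%:R * (1 - (1 - w) ^+ n) ^+ J + 2 * ((J + 2)%:R * w).
Proof.
move=> il; have w0' := ltW w0.
pose near (z : loc) : bool := dst (tnth z.1 i) (tnth z.1 l) <= (J + 2)%:R * w.
have bnear : bmfun (fun z => (near z)%:R : R).
  apply: bmfun_bool; apply: measurable_fun_ler; last exact: measurable_cst.
  by apply: measurable_dist2; exact: measurable_sup.
have bcr q : bmfun (fun z : loc => (crowded q z.1)%:R : R).
  by apply: bmfun_bool; exact: (measurableT_comp (measurable_crowded q) measurable_fst).
have bsum : bmfun (fun z : loc => \sum_(q < B) (crowded q z.1)%:R : R).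
  by apply: bmfun_sum => q; exact: bcr.
apply: (@le_trans _ _ (Ex LP (fun z => \sum_(q < B) (crowded q z.1)%:R + (near z)%:R))).
  apply: (le_Ex_as (C := fun z : loc => all (@incube R 1) z.1)).
  - exact: (measurableT_comp (measurable_all (@measurable_incube R 1)) measurable_fst).
  - rewrite Ex_prod; last first.
      apply: bmfun_bool.
      exact: (measurableT_comp (measurable_all (@measurable_incube R 1)) measurable_fst).
    rewrite (_ : Ex _ _ = Ex (iid_prob P n) (fun s => (all (@incube R 1) s)%:R)).
      by rewrite (Ex_iid_all P n (@measurable_incube R 1)) Ex_incube expr1n.
    by apply: eq_Ex => s /=; rewrite Ex_cst.
  - by apply: bmfun_bool; exact: measurable_unsafe.
  - exact: bmfunD.
  move=> z iz; rewrite /unsafe iz [~~ true]/= orFb -/(near z).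
  have s0 : 0 <= \sum_(q < B) (crowded q z.1)%:R :> R by apply: sumr_ge0.
  case: (boolP (has _ _)) => [/hasP[q]|_]; last by rewrite orFb lerDr.
  rewrite mem_iota add0n => /andP[_ qB] cq; rewrite orTb.
  rewrite (bigD1 (Ordinal qB))//= cq -addrA lerDl addr_ge0//.
  by apply: sumr_ge0.
rewrite ExD//; apply: lerD.
  rewrite Ex_sum//; apply: (@le_trans _ _ (\sum_(q < B) (1 - (1 - w) ^+ n) ^+ J)); last first.
    by rewrite sumr_const card_ord mulr_natl.
  apply: ler_sum => q _.
  rewrite Ex_prod// (_ : Ex _ _ = Ex (iid_prob P n) (fun s => (crowded q s)%:R)); last first.
    by apply: eq_Ex => s /=; rewrite Ex_cst.
  have [qw|qw] := boolP ((q + J)%:R * w <= 1); last first.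
    rewrite (_ : Ex _ _ = 0); first by rewrite exprn_ge0// subr_ge0 exprn_ile1// ?subr_ge0// lerBlDr lerDl.
    rewrite -[RHS](Ex_cst (iid_prob P n)); apply: eq_Ex => s.
    by rewrite /crowded (negbTE qw).
  rewrite (_ : Ex _ _ = Ex (iid_prob P n) (fun s => (all_hit cell_index (iota q J) s)%:R)); last first.
    by apply: eq_Ex => s; rewrite /crowded qw.
  rewrite -{2}(size_iota q J); apply: Ex_all_hit.
  - by rewrite w0' w1.
  - exact: measurable_cell_index.
  - exact: iota_uniq.
  move=> q'; rewrite mem_iota => /andP[_ q'J]; apply: Ex_cell_index.
  by apply: le_trans qw; rewrite ler_wpM2r ?ler_nat.
rewrite (Ex_resample_s i)// -[leRHS](Ex_cst LP); apply: le_Ex.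
- exact: (bmfun_Ex LP P (bmfun_upds i bnear)).
- exact: bmfun_cst.
move=> z; rewrite (_ : Ex _ _ = ballvol (tnth z.1 l) ((J + 2)%:R * w)).
  rewrite -[leRHS]expr1; apply: ballvol_ub.
  by rewrite mulr_gt0// ltr0n addn2.
apply: eq_Ex => u; rewrite /near /upds /= !tnth_upd eqxx.
by rewrite eq_sym (negbTE il).
Qed.

End separation.

End line_cells.

(** * Transfers between two supplies on the line *)

Lemma sumsq_transfer (R : realType) n (x : n.-tuple R) (j l : 'I_n) e : j != l ->
  \sum_i tnth x i ^+ 2 - \sum_i tnth (transfer x j l e) i ^+ 2 =
  2 * e * (tnth x j - tnth x l - e).
Proof.
move=> jl; rewrite -sumrB (bigD1 j)//= (bigD1 l)/=; last by rewrite eq_sym.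
rewrite big1 => [|i /andP[ij il]].
  rewrite !tnth_transfer// !eqxx (negbTE jl) [l == j]eq_sym (negbTE jl) /=; ring.
by rewrite tnth_transfer// (negbTE ij) (negbTE il) !mul0r subr0 addr0 subrr.
Qed.

(** Both a - e and b + e are mixtures of a and b, with weights exchanged; each has variance lam (1 -
    lam) (a - b)^2 = e (a - b - e), whence the factor 2. *)
Lemma transfer_gain (R : realType) (c gamma a b e : R) (F : R -> R) :
  0 <= b -> a <= gamma -> 0 < e -> b + e <= a - e ->
  (forall p x : bool -> R, (forall i, 0 <= p i) -> \sum_i p i = 1 ->
     (forall i, 0 <= x i <= gamma) -> c * spread p x <= jensen_gap p x F) ->
  F a + F b + c * (2 * e * (a - b - e)) <= F (a - e) + F (b + e).
Proof.
move=> b0 ag e0 bea H.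
have d0 : 0 < a - b by lra.
have dN : a - b != 0 by rewrite gt_eqF.
pose lam := e / (a - b).
have lamd : lam * (a - b) = e by rewrite /lam divfK.
have l0 : 0 <= lam by apply: divr_ge0; lra.
have l1 : lam <= 1 by rewrite /lam ler_pdivrMr//; lra.
have step x y : 0 <= x <= gamma -> 0 <= y <= gamma ->
    c * (lam * (1 - lam) * (x - y) ^+ 2) <=
    F (lam * x + (1 - lam) * y) - (lam * F x + (1 - lam) * F y).
  move=> hx hy; have [<- <-] := two_point_mean lam x y F.
  apply: H => [[]|| []] //; first lra.
  by rewrite big_bool /=; lra.
have ha : 0 <= a <= gamma by apply/andP; split; lra.
have hb : 0 <= b <= gamma by apply/andP; split; lra.
have h1 := step a b ha hb; have h2 := step b a hb ha.
have E1 : lam * a + (1 - lam) * b = b + e by rewrite -lamd; ring.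
have E2 : lam * b + (1 - lam) * a = a - e by rewrite -lamd; ring.
rewrite E1 in h1; rewrite E2 in h2.
have E3 : lam * (1 - lam) * (a - b) ^+ 2 = e * (a - b - e) by rewrite -lamd; ring.
have E4 : lam * (1 - lam) * (b - a) ^+ 2 = e * (a - b - e) by rewrite -E3; ring.
rewrite E3 in h1; rewrite E4 in h2.
have -> : c * (2 * e * (a - b - e)) = c * (e * (a - b - e)) + c * (e * (a - b - e)) by ring.
lra.
Qed.

Section line_transfer.
Context (R : realType) (n m : nat) (gamma : R).
Implicit Types u : n.-tuple R.
Notation LP := (location_prob R 1 n m).

Lemma mu_split_le k u (j l : 'I_n) : j != l ->
  mu k m u <= base k m [set j; l] u + gain k m [set j; l] u (tnth u j) +
              gain k m [set j; l] u (tnth u l).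
Proof.
move=> jl.
have [jZ lZ] : j \in [set j; l]%SET /\ l \in [set j; l]%SET.
  by rewrite !finset.inE !eqxx orbT.
rewrite -(Ex_reaches k m u jZ) -(Ex_reaches k m u lZ).
have b0 := bmfun_base k m [set j; l] u.
have bj := bmfun_reaches k m [set j; l] u j.
have bl := bmfun_reaches k m [set j; l] u l.
rewrite -ExD// -ExD//; last exact: bmfunD.
apply: le_Ex; [exact: bmfun_matching| by apply: bmfunD => //; exact: bmfunD|].
by move=> z; rewrite -!natrD ler_nat; exact: matching_number_without2_le.
Qed.

Lemma mu_split_ge u (j l : 'I_n) w J eta : j != l -> 0 < w -> w = 3 * gamma / n%:R ->
  (forall i, 0 <= tnth u i <= gamma) ->
  Ex LP (fun z => (unsafe w J j l z)%:R) <= eta ->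
  base 1 m [set j; l] u + gain 1 m [set j; l] u (tnth u j) +
     gain 1 m [set j; l] u (tnth u l) - 2 * eta <= mu 1 m u.
Proof.
move=> jl w0 wE hu heta.
have [jZ lZ] : j \in [set j; l]%SET /\ l \in [set j; l]%SET.
  by rewrite !finset.inE !eqxx orbT.
rewrite -(Ex_reaches 1 m u jZ) -(Ex_reaches 1 m u lZ).
have b0 := bmfun_base 1 m [set j; l] u.
have bj := bmfun_reaches 1 m [set j; l] u j.
have bl := bmfun_reaches 1 m [set j; l] u l.
have bu := bmfun_bool R (@measurable_unsafe R w w0 n m J j l).
have b2u := bmfunM (bmfun_cst _ (2 : R)) bu.
have bm := bmfun_matching 1 m u.
rewrite lerBlDr.
apply: (@le_trans _ _ (mu 1 m u + 2 * Ex LP (fun z => (unsafe w J j l z)%:R))); last first.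
  by rewrite lerD2l ler_pM2l.
rewrite -ExZ// -[in leRHS]ExD// -ExD// -ExD//; last exact: bmfunD.
apply: le_Ex; [by apply: bmfunD => //; exact: bmfunD | exact: bmfunD |].
(* On an unsafe configuration the two indicators are worth at most 2, which explains 2 [eta]. *)
move=> z; case: (boolP (unsafe w J j l z)) => hz.
  rewrite mulr1 -!natrD ler_nat -addnA; apply: leq_add; last first.
    by case: reaches; case: reaches.
  by apply: le_matching_number => a b /andP[].
rewrite mulr0 addr0 -!natrD ler_nat.
by apply: matching_number_without2_ge => //; exact: (safe_disconnected w0 wE hu hz).
Qed.

End line_transfer.

Section line_majorization.
Context (R : realType) (xi gamma : R) (n m : nat).
Hypothesis xi0 : 0 < xi.
Hypothesis gamma1 : 1 <= gamma.
Hypothesis hl : large 1 xi gamma n.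
Hypothesis mn : m%:R = xi * n%:R.

Let gamma0 : 0 < gamma.
Proof. exact: lt_le_trans gamma1. Qed.

Let w := 3 * gamma / n%:R.

(** The old vector needs the upper estimate only, which holds without separation, so [eta] is paid
    for the new vector alone. Base and gain without {j, l} ignore both ranges and are common to the
    two vectors. *)
Lemma mu_transfer u (j l : 'I_n) e J eta : j != l -> 0 < e ->
  tnth u l + e <= tnth u j - e ->
  (forall i, 0 <= tnth u i <= gamma) ->
  Ex (location_prob R 1 n m) (fun z => (unsafe w J j l z)%:R) <= eta ->
  mu 1 m u + curvature 1 xi gamma *
    (\sum_i tnth u i ^+ 2 - \sum_i tnth (transfer u j l e) i ^+ 2) - 2 * eta
  <= mu 1 m (transfer u j l e).
Proof.
move=> jl e0 uu hu heta.
have [n0 _ _ _] := hl.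
have w0 : 0 < w by rewrite /w divr_gt0 ?mulr_gt0 ?ltr0n.
have [jZ lZ] : j \in [set j; l]%SET /\ l \in [set j; l]%SET.
  by rewrite !finset.inE !eqxx orbT.
have /andP[uj0 uj1] := hu j; have /andP[ul0 ul1] := hu l.
have hu' i : 0 <= tnth (transfer u j l e) i <= gamma.
  rewrite tnth_transfer//; have [->|ij] := eqVneq i j.
    by rewrite (negbTE jl) mul0r addr0 mul1r; apply/andP; split; lra.
  rewrite mul0r subr0; have [->|il] := eqVneq i l; last by rewrite mul0r addr0.
  by rewrite mul1r; apply/andP; split; lra.
have h1 := mu_split_le m 1 u jl.
have h2 := mu_split_ge jl w0 erefl hu' heta.
have h3 := transfer_gain ul0 uj1 e0 uu (fun p x p0 p1 hx =>
  gain_strongly_concave (ltn0Sn 0) gamma0 hl mn [set j; l]%SET hu p0 p1 hx).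
rewrite sumsq_transfer//.
rewrite !tnth_transfer// !eqxx (negbTE jl) [l == j]eq_sym (negbTE jl) in h2.
rewrite !mul0r !mul1r subr0 addr0 in h2.
rewrite /transfer !gain_upd// !base_upd// in h2.
move: h1 h2 h3.
move: (gain _ _ _ _ (tnth u j)) (gain _ _ _ _ (tnth u l)) => g1 g2.
move: (gain _ _ _ _ _) (gain _ _ _ _ _) => g3 g4.
move: (base _ _ _ _) (mu _ _ (upd _ _ _)) (mu _ _ _) (curvature _ _ _ * _) => B0 M2 M1 V h1 h2 h3.
lra.
Qed.

End line_majorization.

Section unsafe_rate.
Context (R : realType) (xi gamma : R) (n m : nat).
Hypothesis gamma1 : 1 <= gamma.
Hypothesis hl : large 1 xi gamma n.
Hypothesis n2 : (1 < n)%N.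

Let gamma0 : 0 < gamma.
Proof. exact: lt_le_trans gamma1. Qed.

(* The first term comes from t^5 exp(- delta t) <= (5 / delta)^5. *)
Definition unsafe_const : R := (5 / expR (- (6 * gamma))) ^+ 5 + 24 * gamma.

(** Blocks of about t = n^(1/3) cells: closeness costs O(t/n), and over n transfers the total O(t)
    is of the order n theta^2 at theta = n^(-1/3). *)
Lemma Ex_unsafe_rate (t : R) (j l : 'I_n) : t ^+ 3 = n%:R -> 1 <= t -> j != l ->
  Ex (location_prob R 1 n m)
    (fun z => (unsafe (3 * gamma / n%:R) (Num.truncn t).+1 j l z)%:R) <=
  unsafe_const * t / n%:R.
Proof.
move=> tn t1 jl; have [n0 _ gn _] := hl; rewrite expr1 in gn.
have t0 : 0 < t by lra.
have n0' : 0 < n%:R :> R by rewrite ltr0n.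
have n2' : 2 <= n%:R :> R by rewrite ler_nat.
set w := 3 * gamma / n%:R.
have w0 : 0 < w by rewrite /w divr_gt0// mulr_gt0.
have wn : w * n%:R = 3 * gamma by rewrite /w divfK// gt_eqF.
have wh : w <= 2^-1 by rewrite /w ler_pdivrMr//; lra.
have w1 : w <= 1 by lra.
apply: le_trans (@Ex_unsafe R w w0 n m (Num.truncn t).+1 w1 j l jl) _.
rewrite /unsafe_const [_ * t]mulrDl [_ / n%:R]mulrDl.
pose delta := expR (- (6 * gamma)).
have d0 : 0 < delta by exact: expR_gt0.
(* As w n = 3 gamma, a given cell is empty with probability at least [delta], independently of n. *)
have dw : delta <= (1 - w) ^+ n.
  rewrite (_ : delta = expR (- (2 * w)) ^+ n).
    apply: lerXn2r; rewrite ?nnegrE ?expR_ge0 ?subr_ge0//.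
    by apply: expR_le_onem; rewrite (ltW w0).
  by rewrite -expRM_natl mulrN mulrCA [n%:R * w]mulrC wn /delta mulrA -natrM.
have wn1 : (1 - w) ^+ n <= 1 by apply: exprn_ile1; lra.
have miss : (1 - (1 - w) ^+ n) ^+ (Num.truncn t).+1 <= expR (- (delta * t)).
  apply: (@le_trans _ _ (expR (- delta) ^+ (Num.truncn t).+1)).
    apply: lerXn2r; rewrite ?nnegrE ?expR_ge0 ?subr_ge0//.
    by apply: le_trans (expR_ge1Dx _); lra.
  rewrite -expRM_natl ler_expR mulrN lerN2 mulrC ler_pM2r//.
  exact: ltW (truncnS_gt t).
apply: lerD; last first.
  (* With w = 3 gamma / n this gives the term 24 gamma t / n. *)
  have Jt : ((Num.truncn t).+1 + 2)%:R <= 4 * t :> R.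
    have := truncn_itv (ltW t0); move=> /andP[h _].
    by rewrite addn2 -!natr1; lra.
  have -> : 24 * gamma * t / n%:R = 2 * (4 * t * w) by rewrite /w; ring.
  by rewrite ler_pM2l// ler_wpM2r// ltW.
have cells : (Num.truncn w^-1).+1%:R <= n%:R :> R.
  have := truncn_itv (ltW (_ : 0 < w^-1)); rewrite invr_gt0 => /(_ w0)/andP[h _].
  rewrite -natr1; apply: (@le_trans _ _ (w^-1 + 1)); first by rewrite lerD2r.
  have : w^-1 <= n%:R / 3.
    by rewrite /w invf_div ler_pM2l// lef_pV2 ?posrE ?mulr_gt0// ler_peMr.
  by move: (w^-1) => v; lra.
have miss0 : 0 <= (1 - (1 - w) ^+ n) ^+ (Num.truncn t).+1 by rewrite exprn_ge0// subr_ge0.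
apply: (@le_trans _ _ (n%:R * expR (- (delta * t)))); first by apply: ler_pM.
(* As n = t^3, bounding n exp(- delta t) by K t / n means bounding t^5 exp(- delta t) by K; each
   fifth root is treated with s <= exp(s), s = delta t / 5. *)
have decay : t ^+ 5 * expR (- (delta * t)) <= (5 / delta) ^+ 5.
  have -> : - (delta * t) = 5%:R * (- (delta * t / 5)) by field.
  rewrite expRM_natl -exprMn; apply: lerXn2r; rewrite ?nnegrE.
  - by rewrite mulr_ge0 ?expR_ge0// ltW.
  - by rewrite divr_ge0// ltW.
  rewrite expRN ler_pdivrMr ?expR_gt0//.
  apply: (@le_trans _ _ (5 / delta * (delta * t / 5))).
    by rewrite le_eqVlt; apply/orP; left; apply/eqP; field; rewrite gt_eqF.
  apply: ler_wpM2l; first by rewrite divr_ge0// ltW.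
  by apply: le_trans (expR_ge1Dx _); rewrite lerDr.
rewrite -tn -/delta.
have -> : (5 / delta) ^+ 5 * t / t ^+ 3 = (5 / delta) ^+ 5 / t ^+ 2.
  by field; rewrite !gt_eqF.
by rewrite ler_pdivlMr ?exprn_gt0// mulrAC -exprD mulrC mulrC.
Qed.

End unsafe_rate.

Section line_transfers.
Context (R : realType) (xi gamma : R) (n m : nat).
Hypothesis xi0 : 0 < xi.
Hypothesis gamma1 : 1 <= gamma.
Hypothesis hl : large 1 xi gamma n.
Hypothesis mn : m%:R = xi * n%:R.
Hypothesis n2 : (1 < n)%N.

Lemma mu_majorization_line (t : R) (x y : n.-tuple R) : t ^+ 3 = n%:R -> 1 <= t ->
  nonincr y -> dominates_prefix x y -> (forall i, 0 <= tnth x i <= gamma) ->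
  mu 1 m x + curvature 1 xi gamma * (\sum_i tnth x i ^+ 2 - \sum_i tnth y i ^+ 2) -
    2 * unsafe_const gamma * t <= mu 1 m y.
Proof.
move=> tn t1 ny dxy hx.
have n0' : 0 < n%:R :> R by rewrite ltr0n ltnW.
have gamma0 : 0 < gamma := lt_le_trans ltr01 gamma1.
pose eta := unsafe_const gamma * t / n%:R.
have eta0 : 0 <= eta.
  apply: divr_ge0 => //; apply: mulr_ge0; last lra.
  by apply: addr_ge0; [apply: exprn_ge0; apply: divr_ge0 => //; exact: expR_ge0 | lra].
pose Q (u : n.-tuple R) (N : nat) := (forall i, 0 <= tnth u i <= gamma) ->
  mu 1 m u + curvature 1 xi gamma * (\sum_i tnth u i ^+ 2 - \sum_i tnth y i ^+ 2) -
    N%:R * (2 * eta) <= mu 1 m y.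
have Qy : Q y 0%N by move=> _; rewrite subrr mulr0 mul0r addr0 subr0.
have Qstep u N j l e : j != l -> 0 < e -> tnth u l + e <= tnth u j - e ->
    Q (transfer u j l e) N -> Q u N.+1.
  move=> jl e0 uu IH hu.
  have hu' i : 0 <= tnth (transfer u j l e) i <= gamma.
    have /andP[uj0 uj1] := hu j; have /andP[ul0 ul1] := hu l.
    rewrite tnth_transfer//; have [->|ij] := eqVneq i j.
      by rewrite (negbTE jl) mul0r addr0 mul1r; apply/andP; split; lra.
    rewrite mul0r subr0; have [->|il] := eqVneq i l; last by rewrite mul0r addr0.
    by rewrite mul1r; apply/andP; split; lra.
  have h1 := IH hu'.
  have h2 := mu_transfer gamma1 hl mn jl e0 uu hu (Ex_unsafe_rate m gamma1 hl n2 tn t1 jl).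
  rewrite -/eta in h2.
  rewrite -natr1 mulrDl mul1r; move: h1 h2; rewrite !mulrBr.
  move: (mu _ _ (transfer u j l e)) (mu _ _ u) (mu _ _ y) => M1 M2 M3.
  move: (_ * \sum_i tnth (transfer u j l e) i ^+ 2) (_ * \sum_i tnth u i ^+ 2)
    (_ * \sum_i tnth y i ^+ 2) (N%:R * (2 * eta)) => V1 V2 V3 E h1 h2.
  lra.
have [N Nn QN] := transfer_ind ny Qy Qstep dxy.
apply: le_trans (QN hx); rewrite lerD2l lerN2.
apply: (@le_trans _ _ (n%:R * (2 * eta))).
  by apply: ler_wpM2r; [exact: mulr_ge0 | rewrite ler_nat].
rewrite le_eqVlt; apply/orP; left; apply/eqP; rewrite /eta.
by rewrite mulrCA [n%:R * _]mulrC divfK ?gt_eqF// mulrA.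
Qed.

End line_transfers.

(** * Conclusion: the error terms against n theta^2 *)

Lemma mu_decr (R : realType) k n m (r : n.-tuple R) : mu k m (decr_tuple r) = mu k m r.
Proof. by have [s ->] := decr_tuple_perm r; exact: mu_perm. Qed.

Lemma decr_itv (R : realType) n (r : n.-tuple R) (c : R) :
  (forall i, 0 <= tnth r i <= c) -> forall i, 0 <= tnth (decr_tuple r) i <= c.
Proof. by move=> hr i; have [s ->] := decr_tuple_perm r; rewrite tnth_mktuple. Qed.

Lemma mu_lt (R : realType) k n m (r r' : n.-tuple R) (theta V err : R) :
  (0 < n)%N -> majorizes r r' -> 0 <= theta -> 0 < V ->
  theta * n%:R < decr_dist1 r r' -> err <= V * (theta ^+ 2 * n%:R) ->
  mu k m (decr_tuple r) + V * (\sum_i tnth (decr_tuple r) i ^+ 2 -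
    \sum_i tnth (decr_tuple r') i ^+ 2) - err <= mu k m (decr_tuple r') ->
  mu k m r < mu k m r'.
Proof.
move=> n0 maj t0 V0 td he; rewrite !mu_decr.
have n0' : 0 < n%:R :> R by rewrite ltr0n.
have := decr_dist1_sumsq maj.
set S := (\sum_i _ - \sum_i _) => hS h.
have tS : theta ^+ 2 * n%:R < S.
  rewrite -(ltr_pM2l n0'); apply: lt_le_trans hS.
  rewrite (_ : n%:R * _ = (theta * n%:R) ^+ 2); last by ring.
  by rewrite ltrXn2r ?nnegrE ?mulr_ge0 ?(ltW n0')// (le_trans _ (ltW td)) ?mulr_ge0 ?(ltW n0').
have VS : V * (theta ^+ 2 * n%:R) < V * S by rewrite ltr_pM2l.
have h1 : err < V * S := le_lt_trans he VS.
apply: lt_le_trans h; rewrite -addrA ltrDl subr_gt0; exact: h1.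
Qed.

(** Here v is the rate, n^(-1/3) or n^(-1/4), and q = v^2 n the growth of the error, n^(1/3) or sqrt
    n. *)
Lemma error_le (R : realType) (V C err theta v q N : R) :
  0 < V -> 1 <= C -> err <= V * C -> 0 <= v -> C * v <= theta -> 0 <= q ->
  q = v ^+ 2 * N -> 0 <= N -> err * q <= V * (theta ^+ 2 * N).
Proof.
move=> V0 C1 eC v0 Cv q0 qE N0.
have C0 : 0 <= C := le_trans ler01 C1.
apply: (@le_trans _ _ (V * C ^+ 2 * q)).
  apply: ler_wpM2r => //; apply: le_trans eC _.
  by rewrite ler_pM2l// expr2 ler_peMr.
rewrite qE (_ : V * C ^+ 2 * _ = V * ((C * v) ^+ 2 * N)); last by ring.
rewrite ler_pM2l//; apply: ler_wpM2r => //.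
by apply: lerXn2r; rewrite ?nnegrE ?mulr_ge0// (le_trans _ Cv)// mulr_ge0.
Qed.

Theorem theorem1 (R : realType) (k : nat) (xi gamma : R)
  (hk : (1 <= k)%N) (hxi : 0 < xi) (hgamma : Num.max 1 xi^-1 <= gamma) :
  exists2 C : R, 0 < C & exists N : nat,
  forall (n m : nat), (N <= n)%N -> m%:R = xi * n%:R ->
  forall r r' : n.-tuple R,
    (forall i, 0 <= tnth r i <= gamma) ->
    (forall i, 0 <= tnth r' i <= gamma) ->
    majorizes r r' ->
  forall theta : R,
    (k = 1%N -> C * (ln n%:R / n%:R) `^ (3%:R^-1) < theta) ->
    ((2 <= k)%N -> C * (1 / n%:R) `^ (1 / (4 * (k + 1))%:R) < theta) ->
    theta * n%:R < decr_dist1 r r' ->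
  (mean_matching k m r < mean_matching k m r')%E.
Proof.
have gamma1 : 1 <= gamma by move: hgamma; rewrite ge_max => /andP[].
have gamma0 : 0 < gamma := lt_le_trans ltr01 gamma1.
have V0 := curvature_gt0 gamma hk hxi; set V := curvature k xi gamma in V0.
have E1 : 0 <= 2 ^+ k * xi * gamma.
  by apply: mulr_ge0; [apply: mulr_ge0; [exact: exprn_ge0|exact: ltW]|exact: ltW].
have E2 : 0 <= 2 * unsafe_const gamma.
  apply: mulr_ge0 => //; apply: addr_ge0; last by apply: mulr_ge0 => //; exact: ltW.
  by apply: exprn_ge0; apply: divr_ge0 => //; exact: expR_ge0.
(* Either error constant is then at most V C, and the summand 1 gives C <= C^2. *)
pose C := 1 + (2 ^+ k * xi * gamma + 2 * unsafe_const gamma) / V.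
have C1 : 1 <= C by rewrite lerDl; apply: divr_ge0; [exact: addr_ge0|exact: ltW].
have VC : V * C = V + (2 ^+ k * xi * gamma + 2 * unsafe_const gamma).
  by rewrite /C mulrDr mulr1 mulrCA mulfV ?mulr1// gt_eqF.
have C0 : 0 < C := lt_le_trans ltr01 C1.
have [N0 HN0] := eventually_large k hxi gamma0.
(* From n >= e follows ln n >= 1, hence n^(-1/3) <= (ln n / n)^(1/3). *)
exists C => //; exists (maxn N0 (maxn 2 (Num.truncn (expR 1 : R)).+1)) => n m.
rewrite !geq_max => /and3P[/HN0 hl n2 ne] mn r r' hr hr' maj theta th1 th2 td.
have n0 : (0 < n)%N := ltnW n2.
have n0' : 0 < n%:R :> R by rewrite ltr0n.
have n1' : 1 <= n%:R :> R by rewrite ler1n.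
rewrite !mean_matchingE lte_fin.
have [k1|k1] := eqVneq k 1%N.
  have lnn : 1 <= ln n%:R :> R.
    rewrite -[leLHS]expRK ler_ln ?posrE ?expR_gt0//.
    by apply: le_trans (ltW (truncnS_gt _)) _; rewrite ler_nat.
  pose t : R := n%:R `^ (3%:R^-1).
  have t1 : 1 <= t by rewrite -(powRr0 n%:R); apply: ler_powR.
  have tn : t ^+ 3 = n%:R.
    by rewrite -powR_mulrn ?powR_ge0// -powRrM mulVf ?powRr1.
  have t0 : 0 < t := lt_le_trans ltr01 t1.
  have tV : t^-1 <= (ln n%:R / n%:R) `^ (3%:R^-1).
    have -> : t^-1 = (1 / n%:R) `^ (3%:R^-1).
      by rewrite div1r -(powR_inv1 (ltW n0')) -powRrM mulN1r powRN.
    apply: ge0_ler_powR; rewrite ?nnegrE ?divr_ge0//.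
    - exact: le_trans lnn.
    - by rewrite ler_pM2r ?invr_gt0.
  have Ct : C * t^-1 <= theta.
    by apply: le_trans (ltW (th1 k1)); rewrite ler_pM2l.
  have th0 : 0 <= theta by apply: le_trans Ct; rewrite mulr_ge0 ?(ltW C0)// invr_ge0 ltW.
  apply: (mu_lt (err := 2 * unsafe_const gamma * t) n0 maj th0 V0 td).
    apply: (error_le V0 C1 _ _ Ct) => //.
    - by rewrite VC addrA lerDr; apply: addr_ge0 => //; exact: ltW.
    - by rewrite invr_ge0 ltW.
    - exact: ltW.
    - by rewrite -tn; field; rewrite gt_eqF.
  rewrite /V; move: hl; rewrite k1 => hl.
  exact: (mu_majorization_line gamma1 hl mn n2 tn t1 (nonincr_decr r')
    (majorizes_dominates maj) (decr_itv hr)).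
have k2 : (2 <= k)%N by rewrite ltn_neqAle eq_sym k1.
(* The base is at most 1 and 1 / (4 (k + 1)) <= 1/4, so [v] is below the rate of (U2). *)
pose v : R := (1 / n%:R) `^ (4%:R^-1).
have v0 : 0 <= v by exact: powR_ge0.
have Cv : C * v <= theta.
  apply: le_trans (ltW (th2 k2)); rewrite ler_pM2l//.
  apply: ger_powR; first by rewrite div1r invr_gt0 n0' invf_le1.
  rewrite div1r lef_pV2 ?posrE ?ltr0n ?muln_gt0 ?addn1//.
  by rewrite ler_nat leq_pmulr.
have th0 : 0 <= theta by apply: le_trans Cv; rewrite mulr_ge0 ?(ltW C0).
apply: (mu_lt (err := 2 ^+ k * xi * gamma * Num.sqrt n%:R) n0 maj th0 V0 td).
  apply: (error_le V0 C1 _ _ Cv) => //.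
  - by rewrite VC addrCA lerDl; apply: addr_ge0 => //; exact: ltW.
  rewrite /v -powR_mulrn ?powR_ge0// -powRrM.
  rewrite (_ : 4^-1 * 2%:R = 2^-1 :> R); last by field.
  rewrite powR12_sqrt ?divr_ge0 ?ler0n// div1r sqrtrV ?ler0n//.
  have s0 : Num.sqrt n%:R != 0 :> R by rewrite gt_eqF// sqrtr_gt0.
  by apply: (mulfI s0); rewrite -expr2 sqr_sqrtr ?(ltW n0')// mulrA mulfV// mul1r.
exact: (mu_majorization hk hxi gamma0 hl mn (nonincr_decr r) (nonincr_decr r')
  (majorizes_dominates maj) (decr_itv hr)).
Qed.
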